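(* Every non-trivial action by homeomorphisms of Thompson's group $T$ on the circle $\mathbb{S}^1$ is semi-conjugate to the standard action of $T$ on $\mathbb{S}^1$.
   Context: Thompson's group $T$ is the group of orientation preserving homeomorphisms of $\mathbb{S}^1=\mathbb{R}/\mathbb{Z}$ which are piecewise linear, with only finitely many breakpoints, all at dyadic rationals, slopes in $2^{\mathbb{Z}}$, and preserving the set of dyadic rationals (as is part of the usual definition); its standard action is the tautological one. A representation $\tau\colon G\to\mathrm{Homeo}(\mathbb{S}^1)$ is semi-conjugate to $\sigma\colon G\to\mathrm{Homeo}_+(\mathbb{S}^1)$ if there is a continuous surjective map $\varphi\colon\mathbb{S}^1\to\mathbb{S}^1$ with $\varphi\circ\tau(g)=\sigma(g)\circ\varphi$ for all $g\in G$, such that $\varphi$ is monotone (non-increasing or non-decreasing) with respect to the circular order on $\mathbb{S}^1$ and has degree $\pm1$. *)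

(* Defs.v *)
From HB Require Import structures.
From mathcomp Require Import all_boot all_order all_algebra.
From mathcomp Require Import all_classical all_reals all_analysis.

Set Implicit Arguments.
Unset Strict Implicit.
Unset Printing Implicit Defensive.

Import Order.TTheory GRing.Theory Num.Theory.
Import numFieldNormedType.Exports.

Local Open Scope classical_set_scope.
Local Open Scope ring_scope.
Local Open Scope quotient_scope.

Section homeo_group.
Variable X : topologicalType.

Record homeo := Homeo {
  homeo_fun :> X -> X;
  homeo_inv : X -> X;
  homeo_funK : cancel homeo_fun homeo_inv;
  homeo_invK : cancel homeo_inv homeo_fun;
  homeo_cont : continuous homeo_fun;
  homeo_inv_cont : continuous homeo_inv }.

HB.instance Definition _ := gen_eqMixin homeo.
HB.instance Definition _ := gen_choiceMixin homeo.

Lemma homeoP (f g : homeo) : (forall x, f x = g x) -> f = g.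
Proof.
case: f g => [f f' fK f'K cf cf'] [g g' gK g'K cg cg'] /= /funext fg.
subst g; have fg' : f' = g'.
  by apply/funext => x; rewrite -[in LHS](g'K x) fK.
by subst g'; congr Homeo; exact: Prop_irrelevance.
Qed.

Definition homeo_one : homeo :=
  @Homeo idfun idfun (fun=> erefl) (fun=> erefl)
    (fun x => @cvg_id _ (nbhs x)) (fun x => @cvg_id _ (nbhs x)).

Definition homeo_mul (f g : homeo) : homeo :=
  @Homeo (f \o g) (homeo_inv g \o homeo_inv f)
    (can_comp (@homeo_funK f) (@homeo_funK g))
    (can_comp (@homeo_invK g) (@homeo_invK f))
    (fun x => continuous_comp (@homeo_cont g x) (@homeo_cont f (g x)))
    (fun x => continuous_comp (@homeo_inv_cont f x)
                (@homeo_inv_cont g (homeo_inv f x))).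

Definition homeo_invg (f : homeo) : homeo :=
  Homeo (@homeo_invK f) (@homeo_funK f) (@homeo_inv_cont f) (@homeo_cont f).

Let mulA : associative homeo_mul. Proof. by move=> f g h; apply: homeoP. Qed.
Let mul1 : left_id homeo_one homeo_mul.
Proof. by move=> f; apply: homeoP. Qed.
Let mulr1 : right_id homeo_one homeo_mul.
Proof. by move=> f; apply: homeoP. Qed.
Let mulV : left_inverse homeo_one homeo_invg homeo_mul.
Proof. by move=> f; apply: homeoP => x /=; rewrite homeo_funK. Qed.
Let mulrV : right_inverse homeo_one homeo_invg homeo_mul.
Proof. by move=> f; apply: homeoP => x /=; rewrite homeo_invK. Qed.

HB.instance Definition _ := isGroup.Build homeo mulA mul1 mulr1 mulV mulrV.

End homeo_group.

Section circle.
Variable R : realType.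

Definition mod1 (x y : R) : bool := x - y \is a Num.int.

Let mod1_refl : reflexive mod1.
Proof. by move=> x; rewrite /mod1 subrr rpred0. Qed.
Let mod1_sym : symmetric mod1.
Proof. by move=> x y; rewrite /mod1 -rpredN opprB. Qed.
Let mod1_trans : transitive mod1.
Proof.
by move=> y x z xy yz; rewrite /mod1 -(subrK y x) -addrA rpredD.
Qed.

Canonical mod1_equiv := EquivRel mod1 mod1_refl mod1_sym mod1_trans.

Definition circle : Type := quotient_topology {eq_quot mod1_equiv}.
HB.instance Definition _ :=
  Topological.copy circle (quotient_topology {eq_quot mod1_equiv}).

Definition to_circle (x : R) : circle := \pi_{eq_quot mod1_equiv} x.

Lemma to_circleP (x y : R) :
  to_circle x = to_circle y <-> x - y \is a Num.int.
Proof.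
have e := @eqmodP _ mod1_equiv x y.
by split=> [H|H]; [exact: (introT e H)|exact: (elimT e H)].
Qed.

Lemma to_circle_surj (a : circle) : exists x, to_circle x = a.
Proof. by exists (repr (a : {eq_quot mod1_equiv})); exact: reprK. Qed.

(* The weak circular order: a, b, c occur in this order when the circle is
   travelled once counterclockwise.  It holds whenever two of the three points
   coincide. *)
Definition cyclic_le (a b c : circle) : Prop :=
  exists x y z : R,
    [/\ to_circle x = a, to_circle y = b, to_circle z = c
      & [/\ x <= y, y <= z & z <= x + 1]].

Definition circ_nondecreasing (phi : circle -> circle) : Prop :=
  forall a b c, cyclic_le a b c -> cyclic_le (phi a) (phi b) (phi c).

Definition circ_nonincreasing (phi : circle -> circle) : Prop :=
  forall a b c, cyclic_le a b c -> cyclic_le (phi c) (phi b) (phi a).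

Definition has_degree (phi : circle -> circle) (d : int) : Prop :=
  exists Phi : R -> R,
    [/\ continuous Phi,
        forall x, phi (to_circle x) = to_circle (Phi x)
      & forall x, Phi (x + 1) = Phi x + d%:~R].

Definition semi_conjugate (G : Type) (tau sigma : G -> homeo circle) : Prop :=
  exists phi : circle -> circle,
    [/\ continuous phi,
        forall b, exists a, phi a = b,
        forall g a, phi (tau g a) = sigma g (phi a),
        circ_nondecreasing phi \/ circ_nonincreasing phi
      & has_degree phi 1 \/ has_degree phi (- 1)].

Definition dyadic : set circle :=
  [set a | exists (m : int) (n : nat), a = to_circle (m%:~R / 2 ^+ n)].

Definition orientation_preserving (g : circle -> circle) : Prop :=
  forall a b c, cyclic_le (g a) (g b) (g c) <-> cyclic_le a b c.

(* In the coordinates given by [to_circle], [g] is affine near [a] with slope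
   a power of 2. *)
Definition affine_pow2_at (g : circle -> circle) (a : circle) : Prop :=
  exists (k : int) (x y : R), to_circle x = a /\
    \forall h \near (0 : R), g (to_circle (x + h)) = to_circle (y + 2 ^ k * h).

Definition breakpoints (g : circle -> circle) : set circle :=
  [set a | ~ affine_pow2_at g a].

Definition is_thompsonT (g : circle -> circle) : Prop :=
  [/\ orientation_preserving g,
      finite_set (breakpoints g),
      breakpoints g `<=` dyadic
    & g @` dyadic = dyadic].

Lemma affine_pow2_atP (g : circle -> circle) (x : R) :
  affine_pow2_at g (to_circle x) -> exists (k : int) (y : R),
    \forall h \near (0 : R), g (to_circle (x + h)) = to_circle (y + 2 ^ k * h).
Proof.
move=> [k [x' [y [/to_circleP xx' H]]]]; exists k, y.
apply: filterS H => h <-; congr g; apply/to_circleP.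
by rewrite -rpredN opprB opprD addrACA subrr addr0.
Qed.

Lemma near0_scale (c : R) (P : R -> Prop) :
  (\forall h \near (0 : R), P h) -> \forall h \near (0 : R), P (c * h).
Proof.
have : (fun h : R => c * h) @ (0 : R) --> (0 : R).
  rewrite -[X in _ --> X](mulr0 c).
  exact: (@mulrl_continuous R c 0).
exact.
Qed.

Lemma affine_pow2_at_comp (f g : circle -> circle) (a : circle) :
  affine_pow2_at g a -> affine_pow2_at f (g a) -> affine_pow2_at (f \o g) a.
Proof.
move=> [k [x [y [<- H]]]].
have -> : g (to_circle x) = to_circle y.
  by have := nbhs_singleton H; rewrite mulr0 !addr0.
move=> /affine_pow2_atP[l [z H']].
exists (l + k), x, z; split=> //.
apply: filterS2 H (near0_scale (2 ^ k) H') => h /= -> ->.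
by rewrite expfzDr ?pnatr_eq0// mulrA.
Qed.

Lemma affine_pow2_at_inv (f g : circle -> circle) (a : circle) :
  cancel f g -> affine_pow2_at f a -> affine_pow2_at g (f a).
Proof.
move=> fK [k [x [y [<- H]]]]; exists (- k), y, x; split.
  by have := nbhs_singleton H; rewrite mulr0 !addr0.
apply: filterS (near0_scale (2 ^ (- k)) H) => h.
by rewrite mulrA -expfzDr ?pnatr_eq0// subrr expr0z mul1r => <-.
Qed.

Definition thompsonT_pred : {pred homeo circle} :=
  fun g => `[< is_thompsonT g >].

Let thompsonT1 : (1%g : homeo circle) \in thompsonT_pred.
Proof.
have b0 : breakpoints (1%g : homeo circle) = set0.
  rewrite -subset0 => a; apply; have [x <-] := to_circle_surj a.
  exists 0, x, x; split=> //; apply: (@nearW _ (nbhs (0 : R))) => h.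
  by rewrite expr0z mul1r.
by apply/asboolP; split=> //; rewrite ?b0//; exact: image_id.
Qed.

Let thompsonTM (f g : homeo circle) : f \in thompsonT_pred ->
  g \in thompsonT_pred -> (f * g)%g \in thompsonT_pred.
Proof.
move=> /asboolP[of_ ff bf df] /asboolP[og fg bg dg].
have sub : breakpoints (f * g)%g `<=`
    breakpoints g `|` homeo_inv g @` breakpoints f.
  move=> a ba; have [ga|] := pselect (affine_pow2_at g a); last by left.
  right; exists (g a); last exact: homeo_funK.
  by move=> fga; apply: ba; exact: affine_pow2_at_comp.
apply/asboolP; split.
- by move=> a b c; rewrite of_ og.
- apply: (sub_finite_set sub); rewrite finite_setU; split=> //.
  exact: finite_image.
- apply: (subset_trans sub) => a [/bg//|[b /bf]].
  by rewrite -{1}dg => -[c dc <- <-]; rewrite homeo_funK.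
- by rewrite -[in RHS]df -[in RHS]dg -image_comp.
Qed.

Let thompsonTV (f : homeo circle) :
  f \in thompsonT_pred -> (f^-1)%g \in thompsonT_pred.
Proof.
move=> /asboolP[of_ ff bf df].
have sub : breakpoints (f^-1)%g `<=` f @` breakpoints f.
  move=> a ba; exists (homeo_inv f a); last exact: homeo_invK.
  move=> fa; apply: ba; rewrite -[a](@homeo_invK _ f).
  by apply: affine_pow2_at_inv fa; exact: homeo_funK.
apply/asboolP; split.
- by move=> a b c; rewrite -of_ /= !homeo_invK.
- exact: (sub_finite_set sub (finite_image _ _)).
- by apply: (subset_trans sub) => a [b /bf db <-]; rewrite -df; exists b.
- apply/seteqP; split=> [a [b]|a da].
    by rewrite -{1}df => -[c dc <- <-] /=; rewrite homeo_funK.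
  by exists (f a); [rewrite -df; exists a|rewrite /= homeo_funK].
Qed.

Lemma thompsonT_group_closed : group_closed thompsonT_pred.
Proof.
split; first exact: thompsonT1.
by move=> f g fT gT; apply: thompsonTM => //; exact: thompsonTV.
Qed.

Record thompsonT := ThompsonT {
  thompsonT_homeo :> homeo circle;
  thompsonT_mem : thompsonT_homeo \in thompsonT_pred }.

HB.instance Definition _ := [isSub for thompsonT_homeo].
HB.instance Definition _ := [Choice of thompsonT by <:].
HB.instance Definition _ :=
  SubChoice_isSubGroup.Build (homeo circle) thompsonT_pred thompsonT
    thompsonT_group_closed.

Definition standard_action (g : thompsonT) : homeo circle := g.

End circle.

(* Main.v *)
Require Import Defs.
From HB Require Import structures.
From mathcomp Require Import all_boot all_order all_algebra.
From mathcomp Require Import all_classical all_reals all_analysis.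
From mathcomp Require Import ring lra zify.

Set Implicit Arguments.
Unset Strict Implicit.
Unset Printing Implicit Defensive.

Import Order.TTheory GRing.Theory Num.Theory.
Import numFieldNormedType.Exports.

Local Open Scope classical_set_scope.
Local Open Scope ring_scope.

(** Why the theorem holds.

    For a point [x] of the circle let [T_x] be the group of the elements of
    Thompson's group that are the identity near [x].  If the action [tau] is
    semi-conjugate to the standard one by [phi], then [tau T_x] fixes the ends
    of the fibre of [phi] over [x].  The proof goes backwards: it shows that
    the fixed point set [C_x] of [tau T_x] is nonempty for every [x]
    ([corresponds_total]), that these sets are pairwise disjoint
    ([corresponds_inj]), and that the map sending the points of [C_x] to [x],
    which is equivariant and has a closed graph by construction, extends to
    the whole circle as a constant on every gap of its domain
    ([corresponds_gap], [over_path_continuous]).  A lift [Phi] of this map to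
    the line has degree 1 or -1 ([equivariant_degree]).  It need not be
    monotone, but since the lifts of the actions are increasing, the running
    supremum of [Phi] (or of [Phi] read backwards) is again equivariant, and
    it is the lift of the required semi-conjugacy.

    Everything about the group itself comes from its elementary elements
    [tX a k]: the standard generator of Thompson's group F implanted in the
    arc from [a] to [a + 2 ^- k].  Those supported in a given arc, and
    arbitrarily small, generate the group of all elements supported in that
    arc ([xgen_supported]); those of small length generate the whole group,
    at the level of lifts as well ([xgen_all]).  An elementary element is
    conjugate to each of its two halves, and the pentagon relation
    [tX_pentagon] says that modulo the differences of an element and its
    halves one has [x ^ 2 = x ^ 3].  Hence an elementary element vanishes in
    every situation where it is identified with its halves.  This shows that
    [tau] preserves the orientation ([tau_incr]) and that it has no global
    fixed point ([fixpoint_trivial]).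

    The heart of the proof is that the elements supported in a proper arc have
    a common fixed point under [tau] ([arc_fixpoint]).  Two disjoint arcs give
    two commuting subgroups.  The fixed point sets of the elements of the
    second one are invariant under the first one.  If invariant closed sets
    always meet, then by compactness all elements of the second subgroup
    having fixed points share one; otherwise the first subgroup has a finite
    orbit, which is fixed pointwise by those of its elements that have a fixed
    point ([common_fixpoint_alternative]).  On the other hand, when [u]
    commutes with a conjugate [u'] of itself, [u] and [u'] have the same
    translation number, and [u * u'^-1] has a fixed point
    ([commuting_conjugates_fixpoint]).  So modulo the elements having fixed
    points an elementary element equals its disjoint conjugates, hence its
    halves, and the pentagon applies once more ([elementary_fix]). *)

(** * Points of the circle and lifts of circle-valued maps *)
Section circle_lifts.
Context {R : realType}.
Implicit Types (x y t : R) (p q : circle R).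

Lemma to_circle_eq x y : to_circle x = to_circle y -> exists n : int, x = y + n%:~R.
Proof.
move=> /to_circleP /intrP[n xyn]; exists n.
by rewrite -xyn addrC subrK.
Qed.

Lemma to_circleD x (n : int) : to_circle (x + n%:~R) = to_circle x.
Proof. by apply/to_circleP; rewrite addrC addKr intr_int. Qed.

Lemma to_circleD1 x : to_circle (x + 1) = to_circle x.
Proof. exact: (to_circleD x 1). Qed.

Lemma to_circle_continuous : continuous (@to_circle R).
Proof. exact: pi_continuous. Qed.

Lemma near_to_circle x (e : R) : 0 < e ->
  \forall p \near to_circle x, exists2 y, `|y - x| < e & to_circle y = p.
Proof.
move=> e0; set A := [set p | exists2 y, `|y - x| < e & to_circle y = p].
suff oA : open A by apply: open_nbhs_nbhs; split=> //; exists x => //; rewrite subrr normr0.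
have : open (@to_circle R @^-1` A); last by [].
rewrite openE => t [y yx /to_circle_eq[n yn]]; rewrite /interior.
have r0 : 0 < e - `|y - x| by rewrite subr_gt0.
apply/nbhs_ballP; exists (e - `|y - x|) => //= s st; exists (s + n%:~R); last exact: to_circleD.
rewrite (_ : s + _ - x = (y - x) - (t - s)); last by rewrite yn; ring.
by apply: le_lt_trans (ler_normB _ _) _; rewrite addrC -ltrBrDr.
Qed.

(** The projection of the line onto the circle is continuous and open, so
    continuity can be tested on real representatives. *)
Lemma continuous_circleP (g : R -> circle R) t x : to_circle x = g t ->
  {for t, continuous g} <->
  forall e, 0 < e -> \forall s \near t, exists2 y, `|y - x| < e & to_circle y = g s.
Proof.
move=> xt; split=> [ct e e0|H].
  by have := near_to_circle x e0; rewrite xt => /ct.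
move=> U; rewrite -xt => /to_circle_continuous /nbhs_ballP[e /= e0 eU].
have := H _ e0; apply: filterS => s [y yx ys] /=.
by rewrite -ys; apply: eU; rewrite /ball /= distrC.
Qed.

Definition circle_repr p : R := projT1 (cid (to_circle_surj p)).

Lemma circle_reprK p : to_circle (circle_repr p) = p.
Proof. exact: projT2 (cid (to_circle_surj p)). Qed.

(** The signed distance from [q] to [p], as the representative of [p - q] of
    least absolute value. *)
Definition circle_diff p q : R :=
  let u := circle_repr p - circle_repr q in u - (Num.floor (u + 1 / 2))%:~R.

Lemma circle_diffE x y : `|x - y| < 1 / 2 ->
  circle_diff (to_circle x) (to_circle y) = x - y.
Proof.
rewrite ltr_norml => /andP[h1 h2]; rewrite /circle_diff.
have /to_circle_eq[m ->] := circle_reprK (to_circle x).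
have /to_circle_eq[n ->] := circle_reprK (to_circle y).
rewrite (_ : Num.floor _ = m - n); first by rewrite intrB; ring.
by apply: floor_def; rewrite !rmorphD /= !rmorphN /=; apply/andP; split; lra.
Qed.

Lemma circle_diffK x p : to_circle (x + circle_diff p (to_circle x)) = p.
Proof.
rewrite /circle_diff; have /to_circle_eq[n ->] := circle_reprK (to_circle x).
rewrite -[RHS]circle_reprK; apply/to_circleP.
set f := Num.floor _.
rewrite (_ : _ - _ = - (n + f)%:~R) ?rpredN ?intr_int// intrD; ring.
Qed.

Lemma continuous_circle_diff (f g : R -> circle R) t x y :
  {for t, continuous f} -> {for t, continuous g} ->
  to_circle x = f t -> to_circle y = g t -> `|x - y| < 1 / 4 ->
  {for t, continuous (fun s => circle_diff (f s) (g s))}.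
Proof.
move=> cf cg xf yg xy; apply/cvgrPdist_lt => e e0.
pose d := Num.min (e / 2) (1 / 8).
have d0 : 0 < d by rewrite lt_min; apply/andP; split; lra.
have d1 : d <= e / 2 by rewrite ge_min lexx.
have d2 : d <= 1 / 8 by rewrite ge_min lexx orbT.
have := (continuous_circleP xf).1 cf _ d0.
have := (continuous_circleP yg).1 cg _ d0.
apply: filterS2 => s [y' yy' <-] [x' xx' <-]; rewrite -xf -yg.
move: xy yy' xx'; rewrite !ltr_norml => /andP[a1 a2] /andP[b1 b2] /andP[c1 c2].
rewrite !circle_diffE ?ltr_norml; by apply/andP; split; lra.
Qed.

Lemma continuous_int_cst (f : R -> R) (a b : R) :
  (forall t, a <= t <= b -> {for t, continuous f}) ->
  (forall t, a <= t <= b -> f t \is a Num.int) -> a <= b -> f a = f b.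
Proof.
move=> cf fi ab.
have cw : {within `[a, b], continuous f}.
  by apply: continuous_in_subspaceT => t; rewrite inE /= in_itv /= => /cf.
have ai : f a \is a Num.int by apply: fi; rewrite lexx.
have bi : f b \is a Num.int by apply: fi; rewrite lexx andbT.
(* two distinct integers have a half-integer between them *)
pose v := Num.min (f a) (f b) + 1 / 2.
have vi : v - 1 / 2 \is a Num.int by rewrite addrK /Num.min; case: ifP.
have [//|] := eqVneq (f a) (f b) => ne; exfalso.
have d1 : 1 <= `|f a - f b|.
  by apply: norm_intr_ge1; rewrite ?rpredB// subr_eq0.
have /(IVT ab cw)[c] : Num.min (f a) (f b) <= v <= Num.max (f a) (f b).
  move: d1; rewrite /v; have [h|h] := leP (f a) (f b).
    rewrite distrC ger0_norm ?subr_ge0// => d1; apply/andP; split; lra.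
  rewrite gtr0_norm ?subr_gt0// => d1; apply/andP; split; lra.
rewrite in_itv /= => /fi fci fcv.
have : (1 / 2 : R) \is a Num.int by rewrite -[1/2](subKr v) -{1}fcv rpredB.
move=> /intrP[n hn].
have : 1%:~R = (2 * n)%:~R :> R by rewrite intrM -hn; lra.
by move=> /eqP; rewrite eqr_int; lia.
Qed.


(** Lebesgue-number form of the compactness of the unit interval. *)
Lemma unit_uniform (P : R -> R -> Prop) :
  (forall t, 0 <= t <= 1 ->
     exists2 e, 0 < e & forall s d, `|s - t| < e -> 0 < d < e -> P d s) ->
  exists2 d, 0 < d & forall t, 0 <= t <= 1 -> P d t.
Proof.
move=> H; have /compact_near_coveringP cc := @segment_compact R 0 1.
have : \forall d \near (0 : R)^'+, `[0, 1] `<=` P d.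
  apply: (cc _ _ P) => t; rewrite /= in_itv /= => /H[e e0 He].
  exists ([set s | `|s - t| < e], [set d | 0 < d < e]) => /=.
    split.
      by apply/nbhs_ballP; exists e => //= s; rewrite /ball /= distrC.
    near=> d; apply/andP; split; near: d; [exact: nbhs_right_gt|exact: nbhs_right_lt].
  by move=> [s d] /= [h1 h2]; exact: He.
move=> h; near (0 : R)^'+ => d; exists d.
  by near: d; exact: nbhs_right_gt.
have hd : `[0, 1] `<=` P d by near: d.
by move=> t t01; apply: hd; rewrite /= in_itv.
Unshelve. all: by end_near. Qed.

Lemma near_ballP (P : R -> Prop) t : (\forall s \near t, P s) <->
  exists2 e, 0 < e & forall s, `|s - t| < e -> P s.
Proof.
split=> [nP|[e e0 He]].
  case/nbhs_ballP: nP => e /= e0 He; exists e => // s st; apply: He.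
  by rewrite /ball /= distrC.
by apply/nbhs_ballP; exists e => //= s; rewrite /ball /= distrC; exact: He.
Qed.

Lemma near_itv (a b t : R) : a < t < b -> \forall s \near t, a < s < b.
Proof.
by move=> ab; apply: filterS2 (lt_nbhsr (andP ab).1) (lt_nbhsl (andP ab).2) => s -> ->.
Qed.

Lemma frac_itv t : 0 <= t - (Num.floor t)%:~R <= 1.
Proof.
have /andP[h1] := floor_itv t; rewrite rmorphD /= => h2.
by apply/andP; split; lra.
Qed.

Lemma periodic_int (T : Type) (f : R -> T) : (forall t, f (t + 1) = f t) ->
  forall t (n : int), f (t + n%:~R) = f t.
Proof.
move=> fp; have fn t (n : nat) : f (t + n%:R) = f t.
  by elim: n => [|n IH]; rewrite ?addr0// -natr1 addrA fp.
move=> t [n|n]; first exact: fn.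
by rewrite NegzE rmorphN -[in RHS](subrK n.+1%:R t) fn.
Qed.

Lemma path_uniform (g : R -> circle R) : continuous g -> (forall t, g (t + 1) = g t) ->
  exists2 d, 0 < d & forall s t, `|s - t| < d ->
    exists x y, [/\ `|x - y| < 1 / 4, to_circle x = g s & to_circle y = g t].
Proof.
move=> cg gp.
pose P d t := forall s, `|s - t| < d ->
  exists x y, [/\ `|x - y| < 1 / 4, to_circle x = g s & to_circle y = g t].
have [|d d0 Hd] := @unit_uniform P; first move=> t _; last first.
  exists d => // s t st; have t01 := frac_itv t.
  set n := Num.floor t in t01.
  have sn : `|(s - n%:~R) - (t - n%:~R)| < d by rewrite opprB addrA subrK.
  have [x [y]] := Hd _ t01 _ sn.
  by rewrite -!rmorphN !(periodic_int gp) => ?; exists x, y.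
have xt := circle_reprK (g t).
have e8 : 0 < (1 / 8 : R) by lra.
have := (continuous_circleP xt).1 (@cg t) _ e8.
move=> nt; case/nbhs_ballP: nt => e /= e0 He; exists (e / 2); first by lra.
move=> s d sts /andP[d0 de] s' ss'.
have [|x xr xs] := He s; first by rewrite /ball /= distrC; lra.
have [|y yr ys] := He s'.
  rewrite /ball /= distrC.
  by have := ler_distD s s' t; lra.
exists y, x; split=> //.
by have := ler_distD (circle_repr (g t)) y x; rewrite (distrC (circle_repr _) x); lra.
Qed.

(** Path lifting.  On a bounded interval the lift is the sum of the small
    signed differences along a fine subdivision of the segment from 0 to [t];
    the periodicity of the path then propagates it to the whole line. *)
Theorem circle_lift (g : R -> circle R) : continuous g ->
  (forall t, g (t + 1) = g t) ->
  exists (f : R -> R) (d : int), [/\ continuous f,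
    forall t, to_circle (f t) = g t & forall t, f (t + 1) = f t + d%:~R].
Proof.
move=> cg gp; have [d d0 Hd] := path_uniform cg gp.
pose N := (Num.truncn (3 / d)).+1.
have Nd : 3 / N%:R < d.
  rewrite ltr_pdivrMr ?ltr0n// mulrC -ltr_pdivrMr//.
  exact: truncnS_gt.
pose u t (i : nat) := t * i%:R / N%:R.
pose D t (i : nat) := circle_diff (g (u t i.+1)) (g (u t i)).
pose x0 := circle_repr (g 0).
pose psi t := x0 + \sum_(i < N) D t i.
have psiK t : to_circle (psi t) = g t.
  have psin n : to_circle (x0 + \sum_(i < n) D t i) = g (u t n).
    elim: n => [|n IH]; first by rewrite big_ord0 addr0 circle_reprK /u mulr0 mul0r.
    by rewrite big_ord_recr /= addrA /D -IH circle_diffK.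
  by rewrite psin /u mulfK// pnatr_eq0.
have psic t : `|t| < 3 -> {for t, continuous psi}.
  move=> t3.
  have cD i : (i < N)%N -> {for t, continuous (fun s => D s i)}.
    move=> iN.
    have cu j : {for t, continuous (fun s => g (u s j))}.
      apply: continuous_comp; last exact: cg.
      apply: (@continuous_comp _ _ _ (fun s : R => s * j%:R) ( *%R^~ N%:R^-1)); exact: mulrr_continuous.
    have [|x [y [xy xt yt]]] := Hd (u t i.+1) (u t i).
      rewrite /u -mulrBl -mulrBr -natrB// subSnn mulr1 normrM normfV.
      rewrite [`|N%:R|]ger0_norm//; apply: lt_trans Nd.
      by rewrite ltr_pM2r// invr_gt0 ltr0n.
    exact: (continuous_circle_diff (cu _) (cu _) xt yt xy).
  have cn n : (n <= N)%N -> {for t, continuous (fun s => x0 + \sum_(i < n) D s i)}.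
    elim: n => [_|n IH nN].
      rewrite (_ : (fun _ => _) = cst x0); first exact: cst_continuous.
      by apply/funext => s; rewrite big_ord0 addr0.
    rewrite (_ : (fun _ => _) = (fun s => x0 + \sum_(i < n) D s i) + (D ^~ n)).
      by apply: continuousD; [exact: IH (ltnW nN)|exact: cD].
    by apply/funext => s; rewrite big_ord_recr /= addrA.
  exact: cn.
have shift_c (f : R -> R) (c s : R) : {for s + c, continuous f} -> {for s, continuous (fun r => f (r + c))}.
  move=> cf; apply: (@continuous_comp _ _ _ (fun r => r + c) f) => //.
  by apply: cvgD; [exact: cvg_id|exact: cvg_cst].
have /intrP[m hm] : psi 1 - psi 0 \is a Num.int.
  by apply/to_circleP; rewrite !psiK -[1]add0r gp.
have psi1 t : -2 <= t <= 1 -> psi (t + 1) = psi t + m%:~R.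
  move=> /andP[t1 t2]; pose f s := psi (s + 1) - psi s.
  have fc s : -2 <= s <= 1 -> {for s, continuous f}.
    move=> /andP[s1 s2].
    apply: cvgB; last by apply: psic; rewrite ltr_norml; apply/andP; split; lra.
    by apply: shift_c; apply: psic; rewrite ltr_norml; apply/andP; split; lra.
  have fi s : f s \is a Num.int by apply/to_circleP; rewrite !psiK gp.
  suff : f t = f 0 by rewrite /f add0r hm => <-; rewrite addrCA subrr addr0.
  have [t0|t0] := lerP t 0.
    apply: continuous_int_cst => // s /andP[s1 s2]; apply: fc; apply/andP; split; lra.
  apply/esym; apply: continuous_int_cst => //; last exact: ltW.
  by move=> s /andP[s1 s2]; apply: fc; apply/andP; split; lra.
pose phi t := psi (t - (Num.floor t)%:~R) + m%:~R * (Num.floor t)%:~R.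
have phiE (n : int) t : n%:~R - 1 < t < n%:~R + 1 -> phi t = psi (t + (- n)%:~R) + (m * n)%:~R.
  move=> /andP[h1 h2]; rewrite intrM rmorphN /= /phi; have [tn|tn] := lerP n%:~R t.
    by rewrite (@floor_def _ t n)// tn /= rmorphD.
  rewrite (@floor_def _ t (n - 1)); last by rewrite subrK tn andbT rmorphD /= rmorphN ltW.
  rewrite (_ : t - _ = t - n%:~R + 1); last by rewrite rmorphB /=; ring.
  by rewrite psi1; [rewrite rmorphB /=; ring|apply/andP; split; lra].
exists phi, m; split.
- move=> /= t; pose n := Num.floor (t : R).
  have /andP[h1 h2] := floor_itv t; rewrite -/n rmorphD /= in h2.
  rewrite -/n in h1.
  have : {for t, continuous (fun s : R => psi (s + (- n)%:~R) + (m * n)%:~R : R)}.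
    apply: cvgD; last exact: cvg_cst.
    by apply: shift_c; apply: psic; rewrite rmorphN ltr_norml /=; apply/andP; split; lra.
  move=> ct; rewrite /continuous_at (phiE n); last by apply/andP; split; lra.
  apply: cvg_trans ct; apply: near_eq_cvg.
  have tn : n%:~R - 1 < (t : R) < n%:~R + 1 by apply/andP; split; lra.
  by apply: filterS (near_itv tn) => s sn; rewrite (phiE n).
- by move=> t; rewrite /phi -intrM to_circleD psiK -rmorphN (periodic_int gp).
- move=> t; rewrite /phi (floorDrz _ (rpred1 _)) floor1.
  rewrite rmorphD /=; rewrite (_ : t + 1 - _ = t - (Num.floor t)%:~R); last by ring.
  by ring.
Qed.

End circle_lifts.

(** * Lifts of circle homeomorphisms *)
Section homeo_lifts.
Context {R : realType}.
Implicit Types (f : R -> R) (h : homeo (circle R)) (t : R).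

Definition deg1 f : Prop :=
  [/\ continuous f, {homo f : x y / x < y} & forall t, f (t + 1) = f t + 1].

Definition ilift f h : Prop :=
  deg1 f /\ forall t, h (to_circle t) = to_circle (f t).

Definition dlift f h : Prop :=
  [/\ continuous f, {homo f : x y / x < y >-> y < x}, forall t, f (t + 1) = f t - 1
    & forall t, h (to_circle t) = to_circle (f t)].

Lemma deg1_int f t (n : int) : deg1 f -> f (t + n%:~R) = f t + n%:~R.
Proof.
move=> [_ _ f1].
have fp s : f (s + 1) - (s + 1) = f s - s by rewrite f1; ring.
have := periodic_int fp t n; lra.
Qed.

Lemma deg1_le f : deg1 f -> {mono f : x y / x <= y}.
Proof. by move=> [_ fm _]; exact: le_mono. Qed.

Lemma deg1_lt f : deg1 f -> {mono f : x y / x < y}.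
Proof. by move=> /deg1_le; exact: leW_mono. Qed.

Lemma deg1_comp f f' : deg1 f -> deg1 f' -> deg1 (f \o f').
Proof.
move=> [c m p] [c' m' p']; split.
- by move=> t; apply: continuous_comp; [exact: c'|exact: c].
- by move=> x y xy; apply: m; exact: m'.
- by move=> t /=; rewrite p' p.
Qed.

Lemma deg1_trans (c : R) : deg1 (fun t => t + c).
Proof.
split=> [t|x y|t]; first by apply: cvgD; [exact: cvg_id|exact: cvg_cst].
- by rewrite ltrD2r.
- by rewrite addrAC.
Qed.

Lemma lift_unique f f' : continuous f -> continuous f' ->
  (forall t, to_circle (f t) = to_circle (f' t)) ->
  exists n : int, forall t, f' t = f t + n%:~R.
Proof.
move=> cf cf' ff'.
have int t : f' t - f t \is a Num.int by apply/to_circleP.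
have cont t : {for t, continuous (fun t => f' t - f t)}.
  by apply: cvgB; [exact: cf'|exact: cf].
have /intrP[n hn] := int 0; exists n => t; rewrite -hn.
suff -> : f' 0 - f 0 = f' t - f t by ring.
have [t0|t0] := lerP 0 t; last apply/esym;
  by apply: (@continuous_int_cst _ (fun t => f' t - f t)) => //; exact: ltW.
Qed.

Lemma ilift_unique f f' h : ilift f h -> ilift f' h ->
  exists n : int, forall t, f' t = f t + n%:~R.
Proof.
by move=> [[c _ _] l] [[c' _ _] l']; apply: lift_unique => // t; rewrite -l -l'.
Qed.

Lemma ilift_addint f h (n : int) : ilift f h -> ilift (fun t => f t + n%:~R) h.
Proof.
move=> [d l]; split; last by move=> t; rewrite l to_circleD.
exact: deg1_comp (deg1_trans _) d.
Qed.

Lemma ilift_comp f f' h h' : ilift f h -> ilift f' h' ->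
  ilift (f \o f') (h * h')%g.
Proof.
move=> [d l] [d' l']; split; first exact: deg1_comp.
by move=> t /=; rewrite l' l.
Qed.

Lemma ilift1 : ilift id (1%g : homeo (circle R)).
Proof.
by split=> //; split=> // t; exact: cvg_id.
Qed.

Lemma homeo_lift h : exists f, ilift f h \/ dlift f h.
Proof.
have lift (k : homeo (circle R)) : exists f (d : int), [/\ continuous f,
    forall t, k (to_circle t) = to_circle (f t)
  & forall t, f (t + 1) = f t + d%:~R].
  have [||f [d [c l p]]] := @circle_lift _ (fun t => k (to_circle t)).
  - by move=> t; apply: continuous_comp; [exact: to_circle_continuous|exact: homeo_cont].
  - by move=> t; rewrite to_circleD1.
  - by exists f, d; split=> // t; rewrite l.
have [f [d [cf lf pf]]] := lift h.
have [f' [d' [cf' lf' pf']]] := lift (h^-1)%g.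
have [||t|n hn] := @lift_unique id (f' \o f).
- by move=> t; exact: cvg_id.
- by move=> t; apply: continuous_comp; [exact: cf|exact: cf'].
- by rewrite /= -lf' -lf /= homeo_funK.
have injf : injective f.
  by move=> x y xy; have := hn x; rewrite /= xy -[f' _]/((f' \o f) y) hn => /addIr.
have pf'n t (k : int) : f' (t + k%:~R) = f' t + d'%:~R * k%:~R.
  have pp s : f' (s + 1) - d'%:~R * (s + 1) = f' s - d'%:~R * s by rewrite pf'; ring.
  by have := periodic_int pp t k; lra.
have dd : d' * d = 1.
  have : (d' * d)%:~R = 1%:~R :> R.
    have := hn (0 + 1); have := hn 0.
    rewrite /= pf pf'n intrM; lra.
  by move=> /eqP; rewrite eqr_int => /eqP.
have d2 : d = 1 \/ d = -1.
  move: (congr1 absz dd); rewrite abszM => /eqP; rewrite muln_eq1 => /andP[_ /eqP].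
  by lia.
have p0 := pf 0; rewrite add0r in p0.
have [||fi|fi] := @itv_continuous_inj_mono _ f `]-oo, +oo[.
- exact: continuous_subspaceT.
- by move=> x y _ _; exact: injf.
- have fm : {homo f : x y / x < y} by move=> x y xy; rewrite fi ?in_itv.
  exists f; left; split=> //; split=> // t; rewrite pf; case: d2 => [->//|d1].
  have := fm 0 1 ltr01; rewrite p0 d1 rmorphN /=; lra.
- have fm : {homo f : x y / x < y >-> y < x}.
    by move=> x y xy; rewrite fi ?in_itv.
  exists f; right; split=> // t; rewrite pf; case: d2 => [d1|->]; last by rewrite rmorphN.
  have := fm 0 1 ltr01; rewrite p0 d1; lra.
Qed.

Lemma ilift_inv f h : ilift f h ->
  exists f', [/\ ilift f' (h^-1)%g, cancel f f' & cancel f' f].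
Proof.
move=> lf; have [c m p] := lf.1; have [g] := homeo_lift (h^-1)%g.
have comp g' : continuous g' -> (forall t, (h^-1)%g (to_circle t) = to_circle (g' t)) ->
    exists n : int, forall t, g' (f t) = t + n%:~R.
  move=> cg lg; have [||t|n hn] := @lift_unique id (g' \o f); last by exists n.
  - by move=> t; exact: cvg_id.
  - by move=> t; apply: continuous_comp; [exact: c|exact: cg].
  - by rewrite /= -lg -lf.2 /= homeo_funK.
case=> [lg|[cg mg pg lg]]; last first.
  have [n hn] := comp _ cg lg.
  by have := mg _ _ (m 0 1 ltr01); rewrite !hn; lra.
have [[cg mg pg] l] := lg; have [n hn] := comp _ cg l.
exists (fun t => g t + (- n)%:~R); split; first exact: ilift_addint.
  by move=> t; rewrite hn rmorphN /= addrK.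
move=> t; apply/eqP; rewrite -(inj_eq (inc_inj (deg1_le lg.1))).
by rewrite hn rmorphN /= subrK.
Qed.

(** Every homeomorphism has an increasing or a decreasing lift, so [incr]
    behaves like a sign: it is multiplicative. *)
Definition incr h : Prop := exists f, ilift f h.

Lemma incr1 : incr 1%g. Proof. by exists id; exact: ilift1. Qed.

Lemma incrM h h' : incr h -> incr h' -> incr (h * h')%g.
Proof. by move=> [f l] [f' l']; exists (f \o f'); exact: ilift_comp. Qed.

Lemma incrV h : incr h -> incr (h^-1)%g.
Proof. by move=> [f /ilift_inv[f' [l _ _]]]; exists f'. Qed.

Lemma nincrM h h' : ~ incr h -> ~ incr h' -> incr (h * h')%g.
Proof.
move=> n n'; have [f [l|[c m p l]]] := homeo_lift h; first by case: n; exists f.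
have [f' [l'|[c' m' p' l']]] := homeo_lift h'; first by case: n'; exists f'.
exists (f \o f'); split; last by move=> t /=; rewrite l' l.
split=> [t|x y xy|t].
- by apply: continuous_comp; [exact: c'|exact: c].
- by apply: m; exact: m'.
- by rewrite /= p' -{2}[f' t](subrK 1) p subrK.
Qed.

Lemma incrMl h h' : incr h -> (incr (h * h')%g <-> incr h').
Proof.
move=> ih; split; last exact: incrM.
by move=> /(incrM (incrV ih)); rewrite mulgA mulVg mul1g.
Qed.

Lemma incrMr h h' : incr h' -> (incr (h * h')%g <-> incr h).
Proof.
move=> ih; split; last by move=> /incrM; exact.
by move=> /incrM/(_ (incrV ih)); rewrite -mulgA mulgV mulg1.
Qed.

Lemma incr_conj h k : incr (h * k * h^-1)%g <-> incr k.
Proof.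
have [ih|nh] := pselect (incr h).
  by rewrite incrMr; [exact: incrMl|exact: incrV].
have nV : ~ incr (h^-1)%g by move=> /incrV; rewrite invgK.
have [ik|nk] := pselect (incr k); split=> //.
  by move=> _; apply: nincrM => //; rewrite incrMr.
by rewrite incrMl//; exact: nincrM.
Qed.

End homeo_lifts.

(** * Elementary elements of the group *)
Section dyadic_reals.
Context {R : realType}.
Implicit Types x y : R.

Definition dyad : set R := [set x | exists (m : int) (n : nat), x = m%:~R / 2 ^+ n].

Lemma exp2_neq0 n : (2 : R) ^+ n != 0. Proof. by rewrite expf_neq0// pnatr_eq0. Qed.

Lemma exp2_gt0 n : 0 < (2 : R) ^+ n. Proof. by rewrite exprn_gt0. Qed.

Lemma dyad_int (n : int) : dyad (n%:~R).
Proof. by exists n, 0%N; rewrite expr0 divr1. Qed.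

Lemma dyadD x y : dyad x -> dyad y -> dyad (x + y).
Proof.
move=> [m [n ->]] [m' [n' ->]]; exists (m * 2 ^+ n' + m' * 2 ^+ n), (n + n')%N.
rewrite intrD !intrM !rmorphXn /= exprD.
by field; rewrite !exp2_neq0.
Qed.

Lemma dyadN x : dyad x -> dyad (- x).
Proof. by move=> [m [n ->]]; exists (- m), n; rewrite rmorphN mulNr. Qed.

Lemma dyadB x y : dyad x -> dyad y -> dyad (x - y).
Proof. by move=> dx dy; apply: dyadD => //; exact: dyadN. Qed.

Lemma dyadM x y : dyad x -> dyad y -> dyad (x * y).
Proof.
move=> [m [n ->]] [m' [n' ->]]; exists (m * m'), (n + n')%N.
by rewrite intrM exprD; field; rewrite !exp2_neq0.
Qed.

Lemma dyad_exp2V n : dyad (2 ^- n).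
Proof. by exists 1, n; rewrite mul1r. Qed.

Lemma dyad_nat n : dyad (n%:R). Proof. exact: (dyad_int n). Qed.

Lemma dyad_half : dyad (2^-1). Proof. exact: (dyad_exp2V 1). Qed.

Lemma dyad_quarter : dyad (4^-1).
Proof. by rewrite (_ : 4^-1 = 2 ^- 2 :> R); [exact: dyad_exp2V|rewrite expr2; field]. Qed.

Lemma dyadicP x : dyadic (to_circle x) <-> dyad x.
Proof.
split=> [[m [n /to_circle_eq[k ->]]]|[m [n ->]]]; last by exists m, n.
by apply: dyadD (dyad_int _); exists m, n.
Qed.

Lemma exp2V_gt0 n : 0 < (2 : R) ^- n. Proof. by rewrite invr_gt0 exp2_gt0. Qed.

Lemma exp2VS n : (2 : R) ^- n.+1 = 2 ^- n / 2.
Proof. by rewrite exprS invfM mulrC. Qed.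

Lemma exp2V_le m n : (m <= n)%N -> (2 : R) ^- n <= 2 ^- m.
Proof. by move=> mn; rewrite lef_pV2 ?posrE ?exp2_gt0// ler_eXn2l// ltr1n. Qed.

End dyadic_reals.

Section periodized_bumps.
Context {R : realType}.
Implicit Types (a l t u : R) (b : R -> R).

Definition is_bump b : Prop :=
  [/\ continuous b, {homo b : x y / x < y}, forall u, u <= 0 -> b u = u
    & forall u, 1 <= u -> b u = u].

Definition periodize b a l t : R :=
  let n := (Num.floor (t - a))%:~R in a + n + l * b ((t - a - n) / l).

(** The formula for [periodize] holds with any neighbouring period as origin,
    since the bump is the identity outside the unit interval. *)
Lemma periodizeE b a l t (n : int) : is_bump b -> 0 < l <= 1 ->
  n%:~R - 1 + l <= t - a <= n%:~R + 1 ->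
  periodize b a l t = a + n%:~R + l * b ((t - a - n%:~R) / l).
Proof.
move=> [_ _ b0 b1] /andP[l0 l1] /andP[h1 h2]; have ln : l != 0 by rewrite gt_eqF.
rewrite /periodize; have [tn|tn] := ltrP (t - a) n%:~R.
  rewrite (@floor_def _ _ (n - 1)); last first.
    by rewrite subrK tn andbT rmorphD /= rmorphN; lra.
  rewrite b1; last by rewrite ler_pdivlMr// rmorphD /= rmorphN; lra.
  rewrite b0; last by rewrite ler_pdivrMr//; lra.
  by rewrite rmorphD /= rmorphN; field.
have [tn'|tn'] := ltrP (t - a) (n%:~R + 1).
  by rewrite (@floor_def _ _ n)// tn /= rmorphD.
have e : t - a = n%:~R + 1 by lra.
rewrite (@floor_def _ _ (n + 1)); last first.
  by rewrite e !rmorphD /=; apply/andP; split; lra.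
rewrite b0; last by rewrite ler_pdivrMr// e rmorphD /=; lra.
rewrite b1; last by rewrite ler_pdivlMr// e; lra.
by rewrite e !rmorphD /=; field.
Qed.

Lemma periodize_id b a l t (n : int) : is_bump b -> 0 < l <= 1 ->
  n%:~R - 1 + l <= t - a <= n%:~R -> periodize b a l t = t.
Proof.
move=> bb l1 /andP[h1 h2]; rewrite (@periodizeE _ _ _ _ n)//; last by apply/andP; split; lra.
have /andP[l0 _] := l1; have ln : l != 0 by rewrite gt_eqF.
have [_ _ b0 _] := bb; rewrite b0; last by rewrite ler_pdivrMr//; lra.
by field.
Qed.

Lemma floor_itv_shift (t a : R) : exists n : int, n%:~R <= t - a < n%:~R + 1.
Proof.
by exists (Num.floor (t - a)); have := floor_itv (t - a); rewrite rmorphD.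
Qed.

Lemma periodize_itv b a l t (n : int) : is_bump b -> 0 < l <= 1 ->
  n%:~R <= t - a < n%:~R + 1 -> n%:~R <= periodize b a l t - a < n%:~R + 1.
Proof.
move=> bb l1 /andP[h1 h2]; have /andP[l0 l1'] := l1.
rewrite (@periodizeE _ _ _ _ n)//; last by apply/andP; split; lra.
have [_ bm b0 b1] := bb.
have e0 : 0 <= b ((t - a - n%:~R) / l).
  by rewrite -[X in X <= _](b0 0 (lexx _)) (le_mono bm) divr_ge0//; [lra|exact: ltW].
have e1 : b ((t - a - n%:~R) / l) < l^-1.
  rewrite -[X in _ < X](b1 l^-1); last by rewrite -div1r ler_pdivlMr ?mul1r.
  by apply: bm; rewrite -[X in _ < X]div1r ltr_pM2r ?invr_gt0//; lra.
have e2 : 0 <= l * b ((t - a - n%:~R) / l) by rewrite mulr_ge0// ltW.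
have e3 : l * b ((t - a - n%:~R) / l) < 1.
  by rewrite mulrC -ltr_pdivlMr// mul1r.
apply/andP; split; lra.
Qed.

Lemma periodize_deg1 b a l : is_bump b -> 0 < l <= 1 / 2 -> deg1 (periodize b a l).
Proof.
move=> bb /andP[l0 l2]; have l1 : 0 < l <= 1 by rewrite l0 /=; lra.
have [bc bm b0 b1] := bb.
split.
- move=> t; have [n /andP[h1 h2]] := floor_itv_shift t a.
  pose f (s : R) : R := a + n%:~R + l * b ((s - a - n%:~R) / l).
  have cf : {for t, continuous f}.
    apply: cvgD; first exact: cvg_cst.
    apply: cvgM; first exact: cvg_cst.
    apply: (@continuous_comp _ _ _ (fun s : R => (s - a - n%:~R) / l) b); last exact: bc.
    apply: cvgM; last exact: cvg_cst.
    apply: cvgB; last exact: cvg_cst.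
    by apply: cvgB; [exact: cvg_id|exact: cvg_cst].
  rewrite /continuous_at (@periodizeE _ _ _ _ n)//; last by apply/andP; split; lra.
  apply: cvg_trans cf; apply: near_eq_cvg.
  have tn : a + n%:~R - 1 + l < (t : R) < a + n%:~R + 1 by apply/andP; split; lra.
  apply: filterS (near_itv tn) => s /andP[s1 s2]; rewrite (@periodizeE _ _ _ _ n)//.
  by apply/andP; split; lra.
- move=> x y xy.
  have [n nx] := floor_itv_shift x a; have [m my] := floor_itv_shift y a.
  have [mn|mn|mn] := ltgtP m n.
  + have : m%:~R + 1 <= n%:~R :> R by rewrite -[1]/(1%:~R) -rmorphD ler_int /=; lia.
    by move/andP: nx => [? ?]; move/andP: my => [? ?]; lra.
  + have := periodize_itv bb l1 nx; have := periodize_itv bb l1 my.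
    have : n%:~R + 1 <= m%:~R :> R by rewrite -[1]/(1%:~R) -rmorphD ler_int /=; lia.
    by move=> h /andP[? ?] /andP[? ?]; lra.
  + rewrite mn in my; move/andP: nx => [? ?]; move/andP: my => [? ?].
    rewrite !(@periodizeE _ _ _ _ n)//; try by apply/andP; split; lra.
    by rewrite ltrD2l ltr_pM2l//; apply: bm; rewrite ltr_pM2r ?invr_gt0//; lra.
- move=> t; rewrite /periodize (_ : t + 1 - a = t - a + 1); last by ring.
  rewrite (floorDrz _ (rpred1 _)) floor1 rmorphD /=.
  by rewrite (_ : t - a + 1 - _ = t - a - (Num.floor (t - a))%:~R); ring.
Qed.

Lemma periodize_comp b b' a l t : is_bump b -> is_bump b' -> 0 < l <= 1 ->
  periodize b a l (periodize b' a l t) = periodize (b \o b') a l t.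
Proof.
move=> bb bb' l1; have /andP[l0 _] := l1; have ln : l != 0 by rewrite gt_eqF.
have [n nt] := floor_itv_shift t a; have /andP[h1 h2] := nt.
have /andP[k1 k2] := periodize_itv bb' l1 nt.
rewrite (@periodizeE b _ _ _ n)//; last by apply/andP; split; lra.
rewrite (@periodizeE b' _ _ _ n)//; last by apply/andP; split; lra.
rewrite /periodize.
have -> : Num.floor (t - a) = n by apply: floor_def; rewrite rmorphD.
by rewrite /=; congr (_ + _ * b _); field.
Qed.

End periodized_bumps.

Section standard_bump.
Context {R : realType}.
Implicit Types (a t u : R) (k : nat).

(** The standard generator of Thompson's group F, with slopes 2, 1 and 1/2 on
    the unit interval and the identity elsewhere.  Written with [max] and
    [min], it is visibly continuous and increasing. *)
Definition stdbump u : R := Num.max u (Num.min (2 * u) (Num.min (u + 1 / 4) (u / 2 + 1 / 2))).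

Definition stdbumpV u : R := Num.min u (Num.max (u / 2) (Num.max (u - 1 / 4) (2 * u - 1))).

Lemma stdbump_le0 u : u <= 0 -> stdbump u = u.
Proof. by move=> h; rewrite /stdbump min_l ?le_min ?max_l//; try apply/andP; lra. Qed.

Lemma stdbump_left u : 0 <= u <= 1 / 4 -> stdbump u = 2 * u.
Proof.
by move=> h; rewrite /stdbump min_l ?le_min ?max_r//; try apply/andP; lra.
Qed.

Lemma stdbump_mid u : 1 / 4 <= u <= 1 / 2 -> stdbump u = u + 1 / 4.
Proof. by move=> h; rewrite /stdbump (@min_l _ _ (u + _)) ?min_r ?max_r//; lra. Qed.

Lemma stdbump_right u : 1 / 2 <= u <= 1 -> stdbump u = u / 2 + 1 / 2.
Proof. by move=> h; rewrite /stdbump (@min_r _ _ (u + _)) ?min_r ?max_r//; lra. Qed.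

Lemma stdbump_ge1 u : 1 <= u -> stdbump u = u.
Proof. by move=> h; rewrite /stdbump (@min_r _ _ (u + _)) ?min_r ?max_l//; lra. Qed.

Lemma stdbumpV_le0 u : u <= 0 -> stdbumpV u = u.
Proof. by move=> h; rewrite /stdbumpV (@max_l _ _ (u - _)) ?max_l ?min_l//; lra. Qed.

Lemma stdbumpV_left u : 0 <= u <= 1 / 2 -> stdbumpV u = u / 2.
Proof. by move=> h; rewrite /stdbumpV max_l ?ge_max ?min_r//; try apply/andP; lra. Qed.

Lemma stdbumpV_mid u : 1 / 2 <= u <= 3 / 4 -> stdbumpV u = u - 1 / 4.
Proof. by move=> h; rewrite /stdbumpV (@max_l _ _ (u - _)) ?max_r ?min_r//; lra. Qed.

Lemma stdbumpV_right u : 3 / 4 <= u <= 1 -> stdbumpV u = 2 * u - 1.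
Proof. by move=> h; rewrite /stdbumpV (@max_r _ _ (u - _)) ?max_r ?min_r//; lra. Qed.

Lemma stdbumpV_ge1 u : 1 <= u -> stdbumpV u = u.
Proof. by move=> h; rewrite /stdbumpV (@max_r _ _ (u - _)) ?max_r ?min_l//; lra. Qed.

Lemma stdbumpK : cancel stdbump stdbumpV.
Proof.
move=> u; have [h0|h0] := lerP u 0; first by rewrite stdbump_le0 ?stdbumpV_le0.
have [h1|h1] := lerP u (1 / 4).
  by rewrite stdbump_left ?stdbumpV_left; lra.
have [h2|h2] := lerP u (1 / 2).
  by rewrite stdbump_mid ?stdbumpV_mid; lra.
have [h3|h3] := lerP u 1.
  by rewrite stdbump_right ?stdbumpV_right; lra.
by rewrite stdbump_ge1 ?stdbumpV_ge1 ?ltW.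
Qed.

Lemma stdbumpVK : cancel stdbumpV stdbump.
Proof.
move=> u; have [h0|h0] := lerP u 0; first by rewrite stdbumpV_le0 ?stdbump_le0.
have [h1|h1] := lerP u (1 / 2).
  by rewrite stdbumpV_left ?stdbump_left; lra.
have [h2|h2] := lerP u (3 / 4).
  by rewrite stdbumpV_mid ?stdbump_mid; lra.
have [h3|h3] := lerP u 1.
  by rewrite stdbumpV_right ?stdbump_right; lra.
by rewrite stdbumpV_ge1 ?stdbump_ge1 ?ltW.
Qed.

Let max_lt (a b c d : R) : a < c -> b < d -> Num.max a b < Num.max c d.
Proof. by move=> ac bd; rewrite gt_max !lt_max ac bd orbT. Qed.

Let min_lt (a b c d : R) : a < c -> b < d -> Num.min a b < Num.min c d.
Proof. by move=> ac bd; rewrite lt_min !gt_min ac bd orbT. Qed.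

Lemma stdbump_is_bump : is_bump stdbump.
Proof.
split; [move=> u| |exact: stdbump_le0|exact: stdbump_ge1].
- apply: (@continuous_max _ R id (fun u => Num.min (2 * u) _)); first exact: cvg_id.
  apply: (@continuous_min _ R (fun u => 2 * u) (fun u => Num.min (u + 1 / 4) _)).
    exact: mulrl_continuous.
  apply: (@continuous_min _ R (fun u => u + 1 / 4) (fun u => u / 2 + 1 / 2)).
    by apply: cvgD; [exact: cvg_id|exact: cvg_cst].
  by apply: cvgD; [exact: mulrr_continuous|exact: cvg_cst].
- move=> x y xy; apply: max_lt => //; apply: min_lt; first lra.
  by apply: min_lt; lra.
Qed.

Lemma stdbumpV_is_bump : is_bump stdbumpV.
Proof.
split; [move=> u| |exact: stdbumpV_le0|exact: stdbumpV_ge1].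
- apply: (@continuous_min _ R id (fun u => Num.max (u / 2) _)); first exact: cvg_id.
  apply: (@continuous_max _ R (fun u => u / 2) (fun u => Num.max (u - 1 / 4) _)).
    exact: mulrr_continuous.
  apply: (@continuous_max _ R (fun u => u - 1 / 4) (fun u => 2 * u - 1)).
    by apply: cvgB; [exact: cvg_id|exact: cvg_cst].
  by apply: cvgB; [exact: mulrl_continuous|exact: cvg_cst].
- move=> x y xy; apply: min_lt => //; apply: max_lt; first lra.
  by apply: max_lt; lra.
Qed.

Definition X a k : R -> R := periodize stdbump a (2 ^- k).
Definition XV a k : R -> R := periodize stdbumpV a (2 ^- k).

Lemma exp2V_half k : (0 < k)%N -> 0 < (2 : R) ^- k <= 1 / 2.
Proof.
move=> k0; rewrite exp2V_gt0 /=; apply: le_trans (exp2V_le k0) _.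
by rewrite expr1; lra.
Qed.

Lemma exp2V_le1 k : 0 < (2 : R) ^- k <= 1.
Proof. by rewrite exp2V_gt0 /=; apply: le_trans (exp2V_le (leq0n k)) _; rewrite expr0 invr1. Qed.

Lemma X_deg1 a k : (0 < k)%N -> deg1 (X a k).
Proof. by move=> /exp2V_half; exact: periodize_deg1 stdbump_is_bump. Qed.

Lemma XV_deg1 a k : (0 < k)%N -> deg1 (XV a k).
Proof. by move=> /exp2V_half; exact: periodize_deg1 stdbumpV_is_bump. Qed.

Lemma periodize_idfun a (l : R) t : l != 0 -> periodize id a l t = t.
Proof. by move=> l0; rewrite /periodize; field. Qed.

Lemma XK a k : cancel (X a k) (XV a k).
Proof.
move=> t; rewrite /X /XV (periodize_comp _ _ stdbumpV_is_bump stdbump_is_bump (exp2V_le1 k)).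
rewrite (_ : _ \o _ = id) ?periodize_idfun ?gt_eqF ?exp2V_gt0//.
by apply/funext => u; exact: stdbumpK.
Qed.

Lemma XVK a k : cancel (XV a k) (X a k).
Proof.
move=> t; rewrite /X /XV (periodize_comp _ _ stdbump_is_bump stdbumpV_is_bump (exp2V_le1 k)).
rewrite (_ : _ \o _ = id) ?periodize_idfun ?gt_eqF ?exp2V_gt0//.
by apply/funext => u; exact: stdbumpVK.
Qed.

Lemma X_out a k t (n : int) : 2 ^- k - 1 <= t - a - n%:~R <= 0 -> X a k t = t.
Proof.
move=> /andP[h1 h2]; apply: (@periodize_id _ _ _ _ _ n stdbump_is_bump (exp2V_le1 k)).
by apply/andP; split; lra.
Qed.

Let XE a k t (n : int) : 0 <= t - a - n%:~R <= 2 ^- k ->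
  X a k t = a + n%:~R + 2 ^- k * stdbump ((t - a - n%:~R) / 2 ^- k).
Proof.
have /andP[l0 l1] := exp2V_le1 k.
move=> /andP[h1 h2]; apply: (@periodizeE _ _ _ _ _ n stdbump_is_bump (exp2V_le1 k)).
by apply/andP; split; lra.
Qed.

Lemma X_left a k t (n : int) : 0 <= t - a - n%:~R <= 2 ^- k / 4 ->
  X a k t = t + (t - a - n%:~R).
Proof.
have /andP[l0 l1] := exp2V_le1 k; have ln : (2 : R) ^- k != 0 by rewrite gt_eqF.
move=> /andP[h1 h2]; rewrite (@XE _ _ _ n); last by apply/andP; split; lra.
pose u := (t - a - n%:~R) / 2 ^- k; have et : t - a - n%:~R = 2 ^- k * u by rewrite /u mulrC divfK.
rewrite -/u.
have u0 : 0 <= u by rewrite divr_ge0// ltW.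
have u1 : u <= 1 / 4 by rewrite ler_pdivrMr//; lra.
rewrite stdbump_left ?u0// mulrCA -et; ring.
Qed.

Lemma X_mid a k t (n : int) : 2 ^- k / 4 <= t - a - n%:~R <= 2 ^- k / 2 ->
  X a k t = t + 2 ^- k / 4.
Proof.
have /andP[l0 l1] := exp2V_le1 k; have ln : (2 : R) ^- k != 0 by rewrite gt_eqF.
move=> /andP[h1 h2]; rewrite (@XE _ _ _ n); last by apply/andP; split; lra.
pose u := (t - a - n%:~R) / 2 ^- k; have et : t - a - n%:~R = 2 ^- k * u by rewrite /u mulrC divfK.
rewrite -/u.
have u0 : 1 / 4 <= u by rewrite ler_pdivlMr//; lra.
have u1 : u <= 1 / 2 by rewrite ler_pdivrMr//; lra.
rewrite stdbump_mid ?u0// mulrDr -et; ring.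
Qed.

Lemma X_right a k t (n : int) : 2 ^- k / 2 <= t - a - n%:~R <= 2 ^- k ->
  X a k t = t + (2 ^- k - (t - a - n%:~R)) / 2.
Proof.
have /andP[l0 l1] := exp2V_le1 k; have ln : (2 : R) ^- k != 0 by rewrite gt_eqF.
move=> /andP[h1 h2]; rewrite (@XE _ _ _ n); last by apply/andP; split; lra.
pose u := (t - a - n%:~R) / 2 ^- k; have et : t - a - n%:~R = 2 ^- k * u by rewrite /u mulrC divfK.
rewrite -/u.
have u0 : 1 / 2 <= u by rewrite ler_pdivlMr//; lra.
have u1 : u <= 1 by rewrite ler_pdivrMr//; lra.
by rewrite stdbump_right ?u0// mulrDr (mulrA _ u) -et; field; rewrite exp2_neq0.
Qed.

End standard_bump.

Section elements.
Context {R : realType}.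
Implicit Types (f : R -> R) (a t : R) (k : nat).

Definition circle_map f (p : circle R) : circle R := to_circle (f (circle_repr p)).

Lemma circle_mapE f t : deg1 f -> circle_map f (to_circle t) = to_circle (f t).
Proof.
move=> df; rewrite /circle_map; have /to_circle_eq[n ->] := circle_reprK (to_circle t).
by rewrite (deg1_int _ _ df) to_circleD.
Qed.

Lemma circle_map_continuous f : deg1 f -> continuous (circle_map f).
Proof.
move=> df; have [c _ _] := df; apply/quotient_continuous => t.
rewrite (_ : _ \o _ = @to_circle R \o f).
  by apply: continuous_comp; [exact: c|exact: to_circle_continuous].
by apply/funext => s; exact: circle_mapE.
Qed.

Lemma circle_mapK f f' : deg1 f -> deg1 f' -> cancel f f' ->
  cancel (circle_map f) (circle_map f').
Proof.
move=> df df' fK p; have [t <-] := to_circle_surj p.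
by rewrite !circle_mapE// fK.
Qed.

Definition mk_homeo f f' (df : deg1 f) (df' : deg1 f') (fK : cancel f f')
    (f'K : cancel f' f) : homeo (circle R) :=
  Homeo (circle_mapK df df' fK) (circle_mapK df' df f'K)
    (circle_map_continuous df) (circle_map_continuous df').

Lemma ilift_cyclic_le f (h : homeo (circle R)) : ilift f h ->
  orientation_preserving h.
Proof.
have dir g (k : homeo (circle R)) : ilift g k -> forall p q r,
    cyclic_le p q r -> cyclic_le (k p) (k q) (k r).
  move=> [dg lg] _ _ _ [x [y [z [<- <- <- [xy yz zx]]]]].
  have [_ _ per] := dg; exists (g x), (g y), (g z); rewrite -per !(deg1_le dg).
  by rewrite !lg.
move=> lf p q r; split; last exact: dir lf _ _ _.
have [f' [lf' _ _]] := ilift_inv lf.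
by move=> /(dir _ _ lf'); rewrite /= !homeo_funK.
Qed.

Lemma thompsonT_of_lift f f' (S : set (circle R)) (df : deg1 f) (df' : deg1 f')
    (fK : cancel f f') (f'K : cancel f' f) : finite_set S -> S `<=` @dyadic R ->
  (forall t, dyad t -> dyad (f t)) -> (forall t, dyad t -> dyad (f' t)) ->
  (forall t, ~ S (to_circle t) -> exists (m : int),
     \forall h \near (0 : R), f (t + h) = f t + 2 ^ m * h) ->
  exists g : thompsonT R, ilift f g.
Proof.
move=> finS dS fd f'd aff; pose h := mk_homeo df df' fK f'K.
have lh : ilift f h by split=> // t; exact: circle_mapE.
have bS : breakpoints h `<=` S.
  move=> p; have [t <-] := to_circle_surj p => nb; apply: contrapT => /aff[m nm].
  apply: nb; exists m, t, (f t); split=> //.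
  by apply: filterS nm => u e; rewrite lh.2 e.
have hT : h \in @thompsonT_pred R.
  apply/asboolP; split.
  - exact: ilift_cyclic_le lh.
  - exact: sub_finite_set bS finS.
  - exact: subset_trans bS dS.
  - apply/seteqP; split=> [_ [p dp <-]|p dp].
      have [t tp] := to_circle_surj p; move: dp; rewrite -tp lh.2 !dyadicP.
      exact: fd.
    have [t tp] := to_circle_surj p; exists (to_circle (f' t)).
      by apply/dyadicP/f'd/dyadicP; rewrite tp.
    by rewrite lh.2 f'K.
by exists (ThompsonT hT).
Qed.

Lemma dyad_floor_frac a t (n : int) : dyad a -> dyad t -> dyad (t - a - n%:~R).
Proof. by move=> da dt; apply: dyadB (dyad_int _); exact: dyadB. Qed.

Lemma X_dyad a k t : (0 < k)%N -> dyad a -> dyad t -> dyad (X a k t).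
Proof.
move=> k0 da dt; have [n /andP[h1 h2]] := floor_itv_shift t a.
have dv := dyad_floor_frac n da dt; have dl := @dyad_exp2V R k.
have dl4 : dyad ((2 : R) ^- k / 4) by apply: dyadM => //; exact: dyad_quarter.
have /andP[l0 l1] := exp2V_half (R := R) k0.
have [c0|c0] := lerP (t - a - n%:~R) (2 ^- k / 4).
  by rewrite (@X_left _ _ _ _ n); [exact: dyadD|apply/andP; split; lra].
have [c1|c1] := lerP (t - a - n%:~R) (2 ^- k / 2).
  by rewrite (@X_mid _ _ _ _ n); [exact: dyadD|apply/andP; split; lra].
have [c2|c2] := lerP (t - a - n%:~R) (2 ^- k).
  rewrite (@X_right _ _ _ _ n); last by apply/andP; split; lra.
  by apply: dyadD => //; apply: dyadM (dyad_half); exact: dyadB.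
by rewrite (@X_out _ _ _ _ (n + 1))// rmorphD /=; apply/andP; split; lra.
Qed.

Lemma XV_dyad a k t : (0 < k)%N -> dyad a -> dyad t -> dyad (XV a k t).
Proof.
move=> k0 da; rewrite -{1}(XVK a k t); set s := XV a k t.
have [n /andP[h1 h2]] := floor_itv_shift s a.
have dn := @dyad_int R n; have dl := @dyad_exp2V R k.
have dl4 : dyad ((2 : R) ^- k / 4) by apply: dyadM => //; exact: dyad_quarter.
have /andP[l0 l1] := exp2V_half (R := R) k0.
have [c0|c0] := lerP (s - a - n%:~R) (2 ^- k / 4).
  rewrite (@X_left _ _ _ _ n) => [dt|]; last by apply/andP; split; lra.
  rewrite (_ : s = (s + (s - a - n%:~R) + (a + n%:~R)) * 2^-1); last by field.
  by apply: dyadM dyad_half; apply: dyadD => //; exact: dyadD.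
have [c1|c1] := lerP (s - a - n%:~R) (2 ^- k / 2).
  rewrite (@X_mid _ _ _ _ n) => [dt|]; last by apply/andP; split; lra.
  by rewrite -[s](addrK (2 ^- k / 4)); exact: dyadB.
have [c2|c2] := lerP (s - a - n%:~R) (2 ^- k).
  rewrite (@X_right _ _ _ _ n) => [dt|]; last by apply/andP; split; lra.
  rewrite (_ : s = 2%:R * (s + (2 ^- k - (s - a - n%:~R)) / 2) - (2 ^- k + (a + n%:~R))).
    by apply: dyadB; [apply: dyadM => //; exact: dyad_nat|apply: dyadD => //; exact: dyadD].
  by field; rewrite exp2_neq0.
by rewrite (@X_out _ _ _ _ (n + 1))// rmorphD /=; apply/andP; split; lra.
Qed.

Lemma X_thompson a k : dyad a -> (0 < k)%N -> exists g : thompsonT R, ilift (X a k) g.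
Proof.
move=> da k0.
pose l : R := 2 ^- k.
have /andP[l0 l1] := exp2V_half (R := R) k0; rewrite -/l in l0 l1.
pose S : set (circle R) := [set to_circle a] `|` [set to_circle (a + l / 4)] `|`
   [set to_circle (a + l / 2)] `|` [set to_circle (a + l)].
have dl : dyad l by exact: dyad_exp2V.
apply: (thompsonT_of_lift (S := S) (X_deg1 a k0) (XV_deg1 a k0) (@XK _ a k) (@XVK _ a k)).
- by rewrite !finite_setU; split; [split; [split|]|]; exact: finite_set1.
- move=> p [[[|]|]|] /= ->; apply/dyadicP => //; apply: dyadD => //; apply: dyadM => //.
    exact: dyad_quarter.
  exact: dyad_half.
- by move=> t; exact: X_dyad.
- by move=> t; exact: XV_dyad.
- move=> t nS; have [n /andP[h1 h2]] := floor_itv_shift t a.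
  have off (c : R) : t = a + c + n%:~R -> to_circle t = to_circle (a + c).
    by move=> ->; exact: to_circleD.
  have n0 : t - a - n%:~R != 0.
    apply/eqP => e; apply: nS; left; left; left => /=.
    by rewrite -[a]addr0; apply: off; lra.
  have n1 : t - a - n%:~R != l / 4.
    by apply/eqP => e; apply: nS; left; left; right => /=; apply: off; lra.
  have n2 : t - a - n%:~R != l / 2.
    by apply/eqP => e; apply: nS; left; right => /=; apply: off; lra.
  have n3 : t - a - n%:~R != l.
    by apply/eqP => e; apply: nS; right => /=; apply: off; lra.
  have [c0|c0|e] := ltgtP (t - a - n%:~R) 0; [lra| |by rewrite e eqxx in n0].
  have near0 (u v : R) : u < t - a - n%:~R < v ->
      \forall h \near (0 : R), u < t + h - a - n%:~R < v.
    move=> /andP[uv1 uv2].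
    have : u - (t - a - n%:~R) < 0 < v - (t - a - n%:~R) by apply/andP; split; lra.
    by move/near_itv; apply: filterS => h /andP[? ?]; apply/andP; split; lra.
  have [c1|c1|e] := ltgtP (t - a - n%:~R) (l / 4); last by rewrite e eqxx in n1.
    exists 1; have : 0 < t - a - n%:~R < l / 4 by rewrite c0 c1.
    move/near0; apply: filterS => h /andP[e1 e2].
    rewrite !(@X_left _ _ _ _ n) -/l; try by apply/andP; split; lra.
    by rewrite expr1z; ring.
  have [c2|c2|e] := ltgtP (t - a - n%:~R) (l / 2); last by rewrite e eqxx in n2.
    exists 0; have : l / 4 < t - a - n%:~R < l / 2 by rewrite c1 c2.
    move/near0; apply: filterS => h /andP[e1 e2].
    rewrite !(@X_mid _ _ _ _ n) -/l; try by apply/andP; split; lra.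
    by rewrite expr0z; ring.
  have [c3|c3|e] := ltgtP (t - a - n%:~R) l; last by rewrite e eqxx in n3.
    exists (-1); have : l / 2 < t - a - n%:~R < l by rewrite c2 c3.
    move/near0; apply: filterS => h /andP[e1 e2].
    rewrite !(@X_right _ _ _ _ n) -/l; try by apply/andP; split; lra.
    by rewrite exprN1; field.
  exists 0; have : l < t - a - n%:~R < 1 by apply/andP; split; lra.
  move/near0; apply: filterS => h /andP[e1 e2].
  rewrite !(@X_out _ _ _ _ (n + 1)) -/l ?rmorphD /=; try by apply/andP; split; lra.
  by rewrite expr0z; ring.
Qed.

Lemma rot_thompson b : dyad b -> exists g : thompsonT R, ilift (fun t => t + b) g.
Proof.
move=> db; apply: (@thompsonT_of_lift _ (fun t => t - b) set0).
- exact: deg1_trans.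
- exact: deg1_trans.
- exact: addrK.
- exact: subrK.
- exact: finite_set0.
- by [].
- by move=> t dt; exact: dyadD.
- by move=> t dt; exact: dyadB.
- move=> t _; exists 0; apply: (@nearW _ (nbhs (0 : R))) => h.
  by rewrite expr0z; ring.
Qed.

Definition tX a k : thompsonT R :=
  if pselect (dyad a /\ (0 < k)%N) is left H
  then projT1 (cid (X_thompson H.1 H.2)) else 1%g.

Definition tR (b : R) : thompsonT R :=
  if pselect (dyad b) is left H then projT1 (cid (rot_thompson H)) else 1%g.

Lemma tXE a k : dyad a -> (0 < k)%N -> ilift (X a k) (tX a k).
Proof.
move=> da k0; rewrite /tX; case: pselect => [H|[]//]; by case: cid.
Qed.

Lemma tRE b : dyad b -> ilift (fun t => t + b) (tR b).
Proof.
move=> db; rewrite /tR; case: pselect => [H|[]//]; by case: cid.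
Qed.

Lemma thompsonT_eq (g h : thompsonT R) f : ilift f g -> ilift f h -> g = h.
Proof.
move=> [_ lg] [_ lh]; apply: val_inj; apply: homeoP => p.
by have [t <-] := to_circle_surj p; rewrite lg lh.
Qed.

End elements.

(** * Relations between the elementary elements *)
Section relations.
Context {R : realType}.
Implicit Types (f : R -> R) (a t u l : R) (b : R -> R) (k : nat).

Lemma ilift_inv_of f f' (h : homeo (circle R)) : ilift f h -> deg1 f' -> cancel f' f ->
  ilift f' (h^-1)%g.
Proof.
by move=> [_ l] d' f'K; split=> // t; rewrite -{1}(f'K t) -l /= homeo_funK.
Qed.

Lemma tXVE a k : dyad a -> (0 < k)%N -> ilift (XV a k) ((tX a k)^-1)%g.
Proof.
by move=> da k0; apply: ilift_inv_of (tXE da k0) (XV_deg1 a k0) (@XVK _ a k).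
Qed.

Lemma tRVE (c : R) : dyad c -> ilift (fun t => t - c) ((tR c)^-1)%g.
Proof. by move=> dc; apply: ilift_inv_of (tRE dc) (deg1_trans _) (@subrK _ c). Qed.

Definition left_half b u : R := b (2 * u) / 2.
Definition right_half b u : R := 1 / 2 + b (2 * u - 1) / 2.

Lemma left_half_bump b : is_bump b -> is_bump (left_half b).
Proof.
move=> [bc bm b0 b1]; split.
- move=> u; apply: cvgM; last exact: cvg_cst.
  by apply: (@continuous_comp _ _ _ (fun u => 2 * u) b); [exact: mulrl_continuous|exact: bc].
- by move=> x y xy; rewrite ltr_pM2r// bm// ltr_pM2l.
- by move=> u u0; rewrite /left_half b0; lra.
- by move=> u u1; rewrite /left_half b1; lra.
Qed.

Lemma right_half_bump b : is_bump b -> is_bump (right_half b).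
Proof.
move=> [bc bm b0 b1]; split.
- move=> u; apply: cvgD; first exact: cvg_cst.
  apply: cvgM; last exact: cvg_cst.
  apply: (@continuous_comp _ _ _ (fun u => 2 * u - 1) b); last exact: bc.
  by apply: cvgB; [exact: mulrl_continuous|exact: cvg_cst].
- by move=> x y xy; rewrite /right_half ltrD2l ltr_pM2r// bm//; lra.
- by move=> u u0; rewrite /right_half b0; lra.
- by move=> u u1; rewrite /right_half b1; lra.
Qed.

Lemma periodize_left_half b a l t : periodize (left_half b) a l t = periodize b a (l / 2) t.
Proof.
rewrite /periodize /left_half; congr (_ + _).
rewrite invfM invrK mulrCA mulrA [in RHS]mulrAC; congr (_ * _).
by rewrite mulrC; congr (_ * b _); ring.
Qed.

Lemma periodize_right_half b a l t : is_bump b -> 0 < l <= 1 ->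
  periodize (right_half b) a l t = periodize b (a + l / 2) (l / 2) t.
Proof.
move=> bb l1; have /andP[l0 l1'] := l1; have [n /andP[h1 h2]] := floor_itv_shift t a.
rewrite (@periodizeE _ _ _ _ _ n (right_half_bump bb) l1); last by apply/andP; split; lra.
rewrite (@periodizeE _ _ _ _ _ n bb); last 2 first.
- by apply/andP; split; lra.
- by apply/andP; split; lra.
rewrite /right_half (_ : (t - (a + _) - _) / _ = 2 * ((t - a - n%:~R) / l) - 1).
  by field.
by field; rewrite gt_eqF.
Qed.

Lemma X_left_half a k : X a k.+1 = periodize (left_half stdbump) a (2 ^- k) :> (R -> R).
Proof. by apply/funext => t; rewrite periodize_left_half -exp2VS. Qed.

Lemma X_right_half a k :
  X (a + 2 ^- k.+1) k.+1 = periodize (right_half stdbump) a (2 ^- k) :> (R -> R).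
Proof.
apply/funext => t; rewrite periodize_right_half ?exp2V_le1// -?exp2VS//.
exact: stdbump_is_bump.
Qed.

Ltac bump_eval := repeat match goal with
  | |- context [stdbump ?e] =>
      lazymatch e with context [stdbump] => fail | _ =>
        first [rewrite (@stdbump_le0 _ e); [|lra] | rewrite (@stdbump_left _ e); [|lra]
          | rewrite (@stdbump_mid _ e); [|lra] | rewrite (@stdbump_right _ e); [|lra]
          | rewrite (@stdbump_ge1 _ e); [|lra]]
      end
  end; lra.

(** The pentagon: both sides turn the binary tree (((1 2) 3) 4) into
    (1 (2 (3 4))), the left one by two moves at the root, the right one by a
    move at the left child, one at the root and one at the right child. *)
Lemma bump_pentagon u : stdbump (stdbump u) =
  right_half stdbump (stdbump (left_half stdbump u)) :> R.
Proof.
rewrite /right_half /left_half.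
case: (lerP u 0) => ?; first by bump_eval.
case: (lerP u (1 / 8)) => ?; first by bump_eval.
case: (lerP u (1 / 4)) => ?; first by bump_eval.
case: (lerP u (1 / 2)) => ?; first by bump_eval.
case: (lerP u 1) => ?; first by bump_eval.
by bump_eval.
Qed.

Lemma bump_left_conj u : stdbump (left_half (left_half stdbump) u) =
  left_half stdbump (stdbump u) :> R.
Proof.
rewrite /left_half.
case: (lerP u 0) => ?; first by bump_eval.
case: (lerP u (1 / 16)) => ?; first by bump_eval.
case: (lerP u (1 / 8)) => ?; first by bump_eval.
case: (lerP u (1 / 4)) => ?; first by bump_eval.
case: (lerP u (1 / 2)) => ?; first by bump_eval.
case: (lerP u 1) => ?; first by bump_eval.
by bump_eval.
Qed.

Lemma bump_right_conj u : stdbump (right_half stdbump u) =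
  right_half (right_half stdbump) (stdbump u) :> R.
Proof.
rewrite /right_half.
case: (lerP u 0) => ?; first by bump_eval.
case: (lerP u (1 / 4)) => ?; first by bump_eval.
case: (lerP u (1 / 2)) => ?; first by bump_eval.
case: (lerP u (5 / 8)) => ?; first by bump_eval.
case: (lerP u (3 / 4)) => ?; first by bump_eval.
case: (lerP u 1) => ?; first by bump_eval.
by bump_eval.
Qed.

End relations.

Section group_relations.
Context {R : realType}.
Implicit Types (f : R -> R) (a t : R) (b : R -> R) (k : nat).

Lemma bump_comp b b' : is_bump b -> is_bump b' -> is_bump (b \o b').
Proof.
move=> [c m z o] [c' m' z' o']; split=> [u|x y xy|u u0|u u1] /=.
- by apply: continuous_comp; [exact: c'|exact: c].
- by apply: m; exact: m'.
- by rewrite z' ?z.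
- by rewrite o' ?o.
Qed.

Lemma tX_rot a k (c : R) : dyad a -> dyad c -> (0 < k)%N ->
  (tR c * tX a k * (tR c)^-1)%g = tX (a + c) k.
Proof.
move=> da dc k0; apply: (@thompsonT_eq _ _ _ (X (a + c) k)).
  have := ilift_comp (ilift_comp (tRE dc) (tXE da k0)) (tRVE dc).
  rewrite (_ : _ \o _ = X (a + c) k)//; apply/funext => t /=.
  rewrite /X /periodize (_ : t - (a + c) = t - c - a); last by ring.
  by ring.
by apply: tXE => //; exact: dyadD.
Qed.

(** [X a k] maps the left quarter of its arc affinely onto the left half, so
    conjugation by it turns the elementary element of the former into that of
    the latter.  Symmetrically, it maps the right half onto the right
    quarter. *)
Lemma tX_left_conj a k : dyad a -> (0 < k)%N ->
  (tX a k * tX a k.+2 * (tX a k)^-1)%g = tX a k.+1.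
Proof.
move=> da k0; apply: (@thompsonT_eq _ _ _ (X a k.+1)); last exact: tXE.
have := ilift_comp (ilift_comp (tXE da k0) (tXE da (isT : (0 < k.+2)%N))) (tXVE da k0).
rewrite (_ : _ \o _ = X a k.+1)//; apply/funext => t /=.
rewrite !X_left_half /X /XV.
have e r : periodize (left_half stdbump) a (2 ^- k.+1) r =
         periodize (left_half (left_half stdbump)) a (2 ^- k) r.
  by rewrite !periodize_left_half -?exp2VS.
have bb := @stdbump_is_bump R; have bl := left_half_bump bb; have bll := left_half_bump bl.
have bV := @stdbumpV_is_bump R; have b1 := bump_comp bb bll; have b2 := bump_comp bl bb.
rewrite -[in RHS](XVK a k t) e /X /XV !periodize_comp ?exp2V_le1//.
by congr (periodize _ a _ t); apply/funext => u; exact: bump_left_conj.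
Qed.

Lemma tX_right_conj a k : dyad a -> (0 < k)%N ->
  (tX a k * tX (a + 2 ^- k.+1) k.+1 * (tX a k)^-1)%g =
  tX (a + 2 ^- k.+1 + 2 ^- k.+2) k.+2.
Proof.
move=> da k0; have dh := dyadD da (dyad_exp2V k.+1).
apply: (@thompsonT_eq _ _ _ (X (a + 2 ^- k.+1 + 2 ^- k.+2) k.+2)); last first.
  by apply: tXE => //; apply: dyadD => //; exact: dyad_exp2V.
have := ilift_comp (ilift_comp (tXE da k0) (tXE dh (isT : (0 < k.+1)%N))) (tXVE da k0).
rewrite (_ : _ \o _ = X (a + 2 ^- k.+1 + 2 ^- k.+2) k.+2)//; apply/funext => t /=.
have bb := @stdbump_is_bump R; have bl := right_half_bump bb; have bll := right_half_bump bl.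
have e r : periodize (right_half stdbump) (a + 2 ^- k.+1) (2 ^- k.+1) r =
         periodize (right_half (right_half stdbump)) a (2 ^- k) r.
  by rewrite [in RHS]periodize_right_half ?exp2V_le1// -?exp2VS.
have bV := @stdbumpV_is_bump R; have b1 := bump_comp bb bl; have b2 := bump_comp bll bb.
rewrite -[in RHS](XVK a k t) !X_right_half /X /XV e !periodize_comp ?exp2V_le1//.
by congr (periodize _ a _ t); apply/funext => u; exact: bump_right_conj.
Qed.

Lemma tX_pentagon a k : dyad a -> (0 < k)%N ->
  (tX a k * tX a k)%g = (tX (a + 2 ^- k.+1) k.+1 * tX a k * tX a k.+1)%g.
Proof.
move=> da k0; have dh := dyadD da (dyad_exp2V k.+1).
apply: (@thompsonT_eq _ _ _ (X a k \o X a k)).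
  exact: ilift_comp (tXE da k0) (tXE da k0).
have := ilift_comp (ilift_comp (tXE dh (isT : (0 < k.+1)%N)) (tXE da k0))
  (tXE da (isT : (0 < k.+1)%N)).
rewrite (_ : _ \o _ = X a k \o X a k)//; apply/funext => t /=.
have bb := @stdbump_is_bump R; have br := right_half_bump bb; have bl := left_half_bump bb.
have b1 := bump_comp bb bl; have b2 := bump_comp br bb; have b3 := bump_comp br b1.
rewrite X_right_half (X_left_half a) /X !periodize_comp ?exp2V_le1//.
by congr (periodize _ a _ t); apply/funext => u; rewrite /= -bump_pentagon.
Qed.

(** Words in the elementary elements, together with the lifts that they spell:
    a lift tells the identity from a full turn, which the degree computation
    depends on. *)
Inductive xgen (P : R -> nat -> Prop) : thompsonT R -> (R -> R) -> Prop :=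
| xgen1 : xgen P 1%g id
| xgenX a k : dyad a -> (0 < k)%N -> P a k -> xgen P (tX a k) (X a k)
| xgenV a k : dyad a -> (0 < k)%N -> P a k -> xgen P (tX a k)^-1%g (XV a k)
| xgenM g g' f f' : xgen P g f -> xgen P g' f' -> xgen P (g * g')%g (f \o f').

Lemma xgen_ilift P (g : thompsonT R) f : xgen P g f -> ilift f g.
Proof.
elim=> [|a k da k0 _|a k da k0 _|g1 g2 f1 f2 _ l1 _ l2].
- exact: ilift1.
- exact: tXE.
- exact: tXVE.
- exact: ilift_comp.
Qed.

Lemma xgenW (P Q : R -> nat -> Prop) (g : thompsonT R) f :
  (forall a k, P a k -> Q a k) -> xgen P g f -> xgen Q g f.
Proof.
move=> PQ; elim=> [|a k da k0 p|a k da k0 p|g1 g2 f1 f2 _ l1 _ l2].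
- exact: xgen1.
- by apply: xgenX => //; exact: PQ.
- by apply: xgenV => //; exact: PQ.
- exact: xgenM.
Qed.

Lemma xgen_inv P (g : thompsonT R) f : xgen P g f ->
  exists f', [/\ xgen P g^-1%g f', cancel f f' & cancel f' f].
Proof.
elim=> [|a k da k0 p|a k da k0 p|g1 g2 f1 f2 _ [f1' [x1 c1 d1]] _ [f2' [x2 c2 d2]]].
- by exists id; split=> //; rewrite invg1; exact: xgen1.
- by exists (XV a k); split; [exact: xgenV|exact: XK|exact: XVK].
- by exists (X a k); rewrite invgK; split; [exact: xgenX|exact: XVK|exact: XK].
- by exists (f2' \o f1'); rewrite invgM; split; [exact: xgenM|exact: can_comp|exact: can_comp].
Qed.

Lemma xgen_group P (Q : thompsonT R -> Prop) : Q 1%g ->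
  (forall g h, Q g -> Q h -> Q (g * h)%g) -> (forall g, Q g -> Q g^-1%g) ->
  (forall a k, dyad a -> (0 < k)%N -> P a k -> Q (tX a k)) ->
  forall g f, xgen P g f -> Q g.
Proof.
move=> q1 qM qV qX g f; elim=> [|a k da k0 p|a k da k0 p|g1 g2 f1 f2 _ l1 _ l2] //.
- exact: qX.
- by apply: qV; exact: qX.
- exact: qM.
Qed.

Definition region (c d : R) (k0 : nat) a k : Prop :=
  [/\ c <= a, a + 2 ^- k <= d & (k0 <= k)%N].

Lemma xgen_out c d k0 (g : thompsonT R) f : c <= d -> xgen (region c d k0) g f ->
  forall t, d - 1 <= t <= c -> f t = t.
Proof.
move=> cd; elim=> [|a k da kp [h1 h2 _]|a k da kp [h1 h2 _]|g1 g2 f1 f2 _ l1 _ l2] t tcd //.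
- by apply: (@X_out _ _ _ _ 0); move/andP: tcd => [? ?]; apply/andP; split; lra.
- rewrite -{1}(@X_out _ a k t 0) ?XK//.
  by move/andP: tcd => [? ?]; apply/andP; split; lra.
- by rewrite /= l2 ?l1.
Qed.

End group_relations.

(** * Piecewise affine maps and binary forests *)
Section forests.
Context {R : realType}.
Implicit Types (f e : R -> R) (a l y h : R).

Inductive tree := Leaf | Node of tree & tree.

Fixpoint leaves t : nat := if t is Node t1 t2 then (leaves t1 + leaves t2)%N else 1%N.

Definition forest_leaves (F : seq tree) : nat := sumn (map leaves F).

Lemma leaves_gt0 t : (0 < leaves t)%N.
Proof. by elim: t => //= t1 h1 t2 h2; rewrite addn_gt0 h1. Qed.

Lemma size_forest_leaves F : (size F <= forest_leaves F)%N.
Proof.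
elim: F => // t F IH; rewrite /forest_leaves /= -add1n; apply: leq_add => //.
exact: leaves_gt0.
Qed.

Definition affine_onto f a l y h : Prop := forall s, 0 <= s <= 1 -> f (a + l * s) = y + h * s.

(** The leaves of a tree are the intervals of a subdivision by repeated halving.
    All their images are required to have the same length [h], so that the
    place of an image depends only on the number of leaves before it; this is
    what makes the normal form of a forest depend on two numbers only. *)
Fixpoint fits_tree f h (t : tree) a l y : Prop :=
  if t is Node t1 t2 then
    fits_tree f h t1 a (l / 2) y /\
    fits_tree f h t2 (a + l / 2) (l / 2) (y + h * (leaves t1)%:R)
  else affine_onto f a l y h.

Fixpoint fits f h (F : seq tree) a l y : Prop :=
  if F is t :: F' then
    fits_tree f h t a l y /\ fits f h F' (a + l) l (y + h * (leaves t)%:R)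
  else True.

Lemma affine_onto_comp f e a l a' l' y h : affine_onto f a l y h ->
  affine_onto e a' l' a l -> affine_onto (f \o e) a' l' y h.
Proof. by move=> ff ee s s1; rewrite /= ee// ff. Qed.

Lemma affine_onto_left e a l y h : affine_onto e a l y h ->
  affine_onto e a (l / 2) y (h / 2).
Proof.
move=> ee s /andP[s0 s1].
have -> : a + l / 2 * s = a + l * (s / 2) by ring.
by rewrite ee; [ring|apply/andP; split; lra].
Qed.

Lemma affine_onto_right e a l y h : affine_onto e a l y h ->
  affine_onto e (a + l / 2) (l / 2) (y + h / 2) (h / 2).
Proof.
move=> ee s /andP[s0 s1].
have -> : a + l / 2 + l / 2 * s = a + l * ((1 + s) / 2) by field.
by rewrite ee; [field|apply/andP; split; lra].
Qed.

Lemma fits_tree_comp f e h t a l a' l' y : fits_tree f h t a l y ->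
  affine_onto e a' l' a l -> fits_tree (f \o e) h t a' l' y.
Proof.
elim: t a l a' l' y => [|t1 IH1 t2 IH2] a l a' l' y /=; first exact: affine_onto_comp.
move=> [f1 f2] ee; split; first exact: IH1 f1 (affine_onto_left ee).
exact: IH2 f2 (affine_onto_right ee).
Qed.

Lemma affine_onto_id e a l : 0 <= l -> (forall s, a <= s <= a + l -> e s = s) ->
  affine_onto e a l a l.
Proof.
move=> l0 ee s /andP[s0 s1]; rewrite ee//.
have := mulr_ge0 l0 s0; have : l * s <= l by rewrite ler_piMr.
by move=> ? ?; apply/andP; split; lra.
Qed.

Lemma fits_comp_id f e h F a l y : 0 <= l -> fits f h F a l y ->
  (forall s, a <= s <= a + l * (size F)%:R -> e s = s) -> fits (f \o e) h F a l y.
Proof.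
move=> l0; elim: F a y => // t F IH a y /= [ft fF] ee.
have sl : 0 <= l * (size F)%:R by rewrite mulr_ge0.
rewrite -natr1 mulrDr mulr1 in ee.
split.
  apply: fits_tree_comp ft _; apply: affine_onto_id => // s /andP[s1 s2].
  by apply: ee; apply/andP; split; lra.
apply: IH => // s /andP[s1 s2]; apply: ee; apply/andP; split; lra.
Qed.

Lemma fits_tree_inj f f' h t a l y : 0 < l -> fits_tree f h t a l y ->
  fits_tree f' h t a l y -> forall s, a <= s <= a + l -> f s = f' s.
Proof.
elim: t a l y => [|t1 IH1 t2 IH2] a l y l0 /=.
  move=> ff ff' s /andP[s1 s2].
  have -> : s = a + l * ((s - a) / l) by field; rewrite gt_eqF.
  have h01 : 0 <= (s - a) / l <= 1.
    by apply/andP; split; [rewrite divr_ge0 ?subr_ge0 ?(ltW l0)|rewrite ler_pdivrMr//; lra].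
  by rewrite ff// ff'.
move=> [f1 f2] [f1' f2'] s /andP[s1 s2].
have [c|c] := lerP s (a + l / 2).
  by apply: (IH1 _ _ _ _ f1 f1'); [lra|apply/andP; split; lra].
by apply: (IH2 _ _ _ _ f2 f2'); [lra|apply/andP; split; lra].
Qed.

Lemma fits_inj f f' h F a l y : 0 < l -> F <> [::] -> fits f h F a l y ->
  fits f' h F a l y -> forall s, a <= s <= a + l * (size F)%:R -> f s = f' s.
Proof.
move=> l0; elim: F a y => // t F IH a y _ /= [ft fF] [ft' fF'] s.
rewrite -natr1 mulrDr mulr1 => /andP[s1 s2].
have [c|c] := lerP s (a + l).
  by apply: (fits_tree_inj l0 ft ft'); rewrite s1 c.
case: F IH fF fF' s2 => [|t' F] IH fF fF' s2; first by rewrite mulr0 in s2; lra.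
apply: (IH _ _ _ fF fF') => //; apply/andP; split; lra.
Qed.

Fixpoint comb n : tree := if n is m.+1 then Node Leaf (comb m) else Leaf.

(** All the leaves are pushed as far to the right as possible, so that the
    normal form depends only on the numbers [m] of trees and [n] of leaves. *)
Definition normal_forest (m n : nat) : seq tree := nseq m.-1 Leaf ++ [:: comb (n - m)].

Lemma size_normal_forest m n : (0 < m)%N -> size (normal_forest m n) = m.
Proof. by move=> m0; rewrite size_cat size_nseq addn1 prednK. Qed.

Definition normalizes (F : seq tree) a k (k0 : nat) : Prop :=
  exists (g : thompsonT R) e,
    xgen (region a (a + 2 ^- k * (size F)%:R) k0) g e /\
    forall f h y, fits f h F a (2 ^- k) y ->
      fits (f \o e) h (normal_forest (size F) (forest_leaves F)) a (2 ^- k) y.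

(** One sliding move: the right child of a tree is handed over to the next
    tree.  On the source side this is precomposition with the inverse of an
    elementary element. *)
Lemma slide_fits t1 t2 t3 F a k f h y : (0 < k)%N ->
  2 ^- k.+1 * (size F).+2%:R <= 1 :> R ->
  fits f h [:: Node t1 t2, t3 & F] a (2 ^- k.+1) y ->
  fits (f \o XV a k) h [:: t1, Node t2 t3 & F] a (2 ^- k.+1) y.
Proof.
move=> k0 szF /= [[f1 f2] [f3 fF]]; set l : R := 2 ^- k.+1 in szF f1 f2 f3 fF *.
have l0 : 0 < l by exact: exp2V_gt0.
have kl : 2 ^- k = 2 * l by rewrite /l exp2VS; field; rewrite exp2_neq0.
have XVE s r : X a k r = s -> XV a k s = r by move=> <-; exact: XK.
have sF : 0 <= l * (size F)%:R by rewrite mulr_ge0// ltW.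
rewrite -2!natr1 !mulrDr !mulr1 in szF.
split; [|split; [split|]].
- apply: fits_tree_comp f1 _ => s /andP[s0 s1]; apply: XVE.
  have := mulr_ge0 (ltW l0) s0; have : l * s <= l by rewrite ler_piMr ?(ltW l0).
  move=> hs1 hs0.
  rewrite (@X_left _ _ _ _ 0) ?kl; last by apply/andP; split; lra.
  by field.
- rewrite natrD mulrDr addrA in fF *.
  apply: fits_tree_comp f2 _ => s /andP[s0 s1]; apply: XVE.
  have := mulr_ge0 (ltW l0) s0; have : l * s <= l by rewrite ler_piMr ?(ltW l0).
  move=> hs1 hs0.
  rewrite (@X_mid _ _ _ _ 0) ?kl; last by apply/andP; split; lra.
  by field.
- rewrite (_ : _ + h * _ = y + h * (leaves (Node t1 t2))%:R); last by rewrite /= natrD; ring.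
  apply: fits_tree_comp f3 _ => s /andP[s0 s1]; apply: XVE.
  have := mulr_ge0 (ltW l0) s0; have : l * s <= l by rewrite ler_piMr ?(ltW l0).
  move=> hs1 hs0.
  rewrite (@X_right _ _ _ _ 0) ?kl; last by apply/andP; split; lra.
  by field.
- rewrite (_ : _ + h * _ = y + h * (leaves t1 + leaves t2)%:R + h * (leaves t3)%:R).
    apply: fits_comp_id => //; first exact: ltW.
    move=> s /andP[s1 s2]; apply: XVE; apply: (@X_out _ _ _ _ 1).
    by rewrite kl; apply/andP; split; lra.
  by rewrite /= !natrD; ring.
Qed.

Lemma forest_leaves_cons t F : forest_leaves (t :: F) = (leaves t + forest_leaves F)%N.
Proof. by []. Qed.

Lemma normal_forest_leaf m n : (0 < m)%N -> (m <= n)%N ->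
  normal_forest m.+1 n.+1 = Leaf :: normal_forest m n.
Proof. by case: m. Qed.

(** Slides empty the first tree into the second one, then the second one into
    the third one, and so on.  A single tree [Node t1 t2] is treated as the
    forest of [t1] and [t2] over intervals of half the length.  Every step
    decreases the number of leaves of the forest or, for the same number, that
    of its first tree. *)
Theorem forest_normalizes F a k k0 : (0 < k0 < k)%N -> dyad a -> F <> [::] ->
  2 ^- k * (size F)%:R <= 1 :> R -> normalizes F a k k0.
Proof.
have [N] := ubnP (forest_leaves F); elim: N F a k => // N IHN F a k.
have [m] := ubnP (leaves (head Leaf F)); elim: m F a k => // m IHm [//|t F] a k.
rewrite ltnS => tm FN /andP[k00 k0k] da _ sz.
have l0 := @exp2V_gt0 R k.
rewrite [head _ _]/= in tm.
case: t => [|t1 t2] in tm FN sz *.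
- clear tm; case: F FN sz => [|t3 F] FN sz.
    exists 1%g, id; split; first exact: xgen1.
    by [].
  have l3 := leaves_gt0 t3.
  have sF : 0 <= (2 ^- k : R) * (size F)%:R by rewrite mulr_ge0// ltW.
  rewrite [size _]/= -(natr1 (size F).+1) -(natr1 (size F)) !mulrDr !mulr1 in sz.
  have [|||||g [e [ge fe]]] := IHN (t3 :: F) (a + 2 ^- k) k.
  + by move: FN; rewrite !forest_leaves_cons /=; lia.
  + by rewrite k00.
  + by apply: dyadD => //; exact: dyad_exp2V.
  + by [].
  + by rewrite [size _]/= -(natr1 (size F)) mulrDr mulr1; lra.
  exists g, e; split.
    apply: xgenW ge => a' k' [h1 h2 h3]; split=> //; first lra.
    apply: le_trans h2 _; rewrite /= -(natr1 (size F).+1) -(natr1 (size F)); lra.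
  move=> f h y [ft fF].
  rewrite (_ : normal_forest _ _ =
    Leaf :: normal_forest (size (t3 :: F)) (forest_leaves (t3 :: F))); last first.
    exact: (@normal_forest_leaf (size (t3 :: F)) _ isT (size_forest_leaves (t3 :: F))).
  split; last exact: fe.
  apply: (@fits_tree_comp _ _ _ Leaf) ft _; apply: affine_onto_id; first exact: ltW.
  move=> s /andP[s1 s2]; apply: (xgen_out _ ge).
    by rewrite lerDl mulr_ge0// ltW.
  by rewrite [size _]/= -(natr1 (size F)) mulrDr mulr1; apply/andP; split; lra.
- have l1 := leaves_gt0 t1; have l2 := leaves_gt0 t2.
  case: F FN sz => [|t3 F] FN sz.
    have kS : (2 : R) ^- k.+1 * 2 = 2 ^- k by rewrite exp2VS; field; rewrite exp2_neq0.
    have [||||||g [e [ge fe]]] := IHm [:: t1; t2] a k.+1.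
    + by move: tm => /=; lia.
    + by move: FN; rewrite /forest_leaves /=; lia.
    + by rewrite k00 ltnS ltnW.
    + by [].
    + by [].
    + by rewrite /= kS; rewrite /= mulr1 in sz.
    exists g, e; split.
      by apply: xgenW ge => a' k'; rewrite /= kS mulr1.
    move=> f h y /= [[f1 f2] _].
    have := fe f h y; rewrite /= exp2VS => fe'.
    have [|n1 [n2 _]] := fe'; first by split.
    rewrite (_ : forest_leaves _ = forest_leaves [:: t1; t2]); last first.
      by rewrite /forest_leaves /= !addn0.
    have [n en] : exists n, forest_leaves [:: t1; t2] = n.+2.
      by exists (forest_leaves [:: t1; t2]).-2; rewrite /forest_leaves /=; lia.
    move: n2; rewrite en /normal_forest /= !subSS !subn0 => n2.
    by rewrite ?exp2VS.
  have [k' ek] : exists k', k = k'.+1 by exists k.-1; lia.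
  subst k; have k'0 : (0 < k')%N by lia.
  have [||||||g [e [ge fe]]] := IHm [:: t1, Node t2 t3 & F] a k'.+1.
  + by move: tm => /=; lia.
  + by move: FN; rewrite /forest_leaves /=; lia.
  + by rewrite k00.
  + by [].
  + by [].
  + by [].
  exists ((tX a k')^-1 * g)%g, (XV a k' \o e); split.
    apply: xgenM ge; apply: xgenV => //; split=> //.
    have -> : (2 : R) ^- k' = 2 ^- k'.+1 * 2%:R by rewrite exp2VS; field; rewrite exp2_neq0.
    by rewrite lerD2l ler_pM2l// ler_nat.
  move=> f h y ff; rewrite compA.
  have <- : forest_leaves [:: t1, Node t2 t3 & F] = forest_leaves [:: Node t1 t2, t3 & F].
    by rewrite /forest_leaves /= !addnA.
  by apply: fe; exact: slide_fits.
Qed.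

End forests.

(** * Generation by elementary elements *)
Section generation.
Context {R : realType}.
Implicit Types (f e : R -> R) (a t : R).

Lemma locally_constant (A : R -> Prop) (u v : R) :
  (forall t, u < t < v -> exists2 e, 0 < e & forall s, `|s - t| < e -> (A s <-> A t)) ->
  forall s t, u < s < v -> u < t < v -> A s -> A t.
Proof.
move=> H s t /andP[s1 s2] /andP[t1 t2] As.
pose p (x : R) := s + (t - s) * x.
have pin x : 0 <= x <= 1 -> u < p x < v.
  move=> /andP[x0 x1]; rewrite /p; have [st|ts] := lerP s t.
    have h1 : 0 <= (t - s) * x by rewrite mulr_ge0// subr_ge0.
    have h2 : (t - s) * x <= t - s by rewrite ler_piMr// subr_ge0.
    by apply/andP; split; lra.
  have h1 : 0 <= (s - t) * x by rewrite mulr_ge0// subr_ge0 ltW.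
  have h2 : (s - t) * x <= s - t by rewrite ler_piMr// subr_ge0 ltW.
  by apply/andP; split; lra.
pose P (d x : R) := forall y, `|y - x| < d -> (A (p y) <-> A (p x)).
have [|d d0 Hd] := @unit_uniform _ P.
  move=> x /pin /H[e e0 He]; pose c := `|t - s| + 1.
  have c0 : 0 < c by rewrite ltr_wpDl.
  have ec : 0 < e / c by rewrite divr_gt0.
  exists (e / c / 2); first by rewrite divr_gt0.
  move=> y d yx /andP[d0 de] z zy.
  have close w : `|w - x| < e / c -> A (p w) <-> A (p x).
    move=> wx; apply: He; rewrite /p (_ : _ - _ = (t - s) * (w - x)); last by ring.
    rewrite normrM; apply: (@le_lt_trans _ _ (c * `|w - x|)).
      by rewrite ler_wpM2r// /c lerDl.
    by rewrite mulrC -ltr_pdivlMr.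
  rewrite (close z) ?(close y)//; first by lra.
  by have := ler_distD y z x; lra.
pose N := (Num.truncn d^-1).+1.
have Nd : N%:R^-1 < d by rewrite -[d]invrK ltf_pV2 ?posrE ?invr_gt0//; exact: truncnS_gt.
have step i : (i <= N)%N -> A (p (i%:R / N%:R)).
  elim: i => [_|i IH iN]; first by rewrite mul0r /p mulr0 addr0.
  have /IH Ai := ltnW iN.
  have i01 : 0 <= (i%:R / N%:R : R) <= 1.
    by rewrite divr_ge0//= ler_pdivrMr ?ltr0n// mul1r ler_nat ltnW.
  apply: (Hd _ i01 (i.+1%:R / N%:R) _).2 Ai; rewrite -mulrBl -natrB// subSnn mul1r.
  by rewrite ger0_norm ?invr_ge0.
have := step N (leqnn N); rewrite divff ?pnatr_eq0// /p mulr1 addrC subrK.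
exact.
Qed.

(** The line followed by [f] near a point is locally constant as a function of
    that point, hence constant on the open interval; the ends are reached by
    continuity. *)
Lemma affine_of_locally_affine f a (l : R) : 0 < l -> continuous f ->
  (forall t, a < t < a + l -> exists m : int,
     \forall h \near (0 : R), f (t + h) = f t + 2 ^ m * h) ->
  exists m : int, forall s, 0 <= s <= l -> f (a + s) = f a + 2 ^ m * s.
Proof.
move=> l0 cf H; pose t0 := a + l / 2.
have t0in : a < t0 < a + l by apply/andP; rewrite /t0; split; lra.
have [m Hm] := H _ t0in; exists m.
pose A (t : R) := \forall h \near (0 : R), f (t + h) = f t0 + 2 ^ m * (t + h - t0).
have A0 : A t0 by move: Hm; apply: filterS => h ->; congr (_ + _ * _); ring.
have AA t : a < t < a + l -> A t.
  move=> tin; apply: (locally_constant _ t0in tin A0) => {tin}t /H[m' Hm'].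
  have /near_ballP[e e0 He] := Hm'; exists e => // s st.
  pose L := f t = f t0 + 2 ^ m * (t - t0) /\ (2 : R) ^ m' = 2 ^ m.
  have chr r : `|r - t| < e -> A r <-> L.
    move=> rt; have fr : \forall h \near (0 : R), f (r + h) = f t + 2 ^ m' * (r + h - t).
      have : - (e - `|r - t|) < 0 < e - `|r - t| by apply/andP; split; lra.
      move/near_itv; apply: filterS => h /andP[h1 h2].
      rewrite -(He (r + h - t)); first by congr f; ring.
      rewrite subr0 (_ : _ - t = h + (r - t)); last by ring.
      apply: le_lt_trans (ler_normD _ _) _; rewrite -ltrBrDr ltr_norml.
      by apply/andP; split.
    split=> [Ar|[e1 e2]]; last first.
      by move: fr; apply: filterS => h ->; rewrite e1 e2; ring.
    have /near_ballP[d d0 Hd] : \forall h \near (0 : R), f (r + h) = f t0 + 2 ^ m * (r + h - t0) /\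
        f (r + h) = f t + 2 ^ m' * (r + h - t) by exact: filterI Ar fr.
    have [|u1 u2] := Hd 0; first by rewrite subrr normr0.
    have [|v1 v2] := Hd (d / 2).
      by rewrite subr0 ger0_norm; lra.
    rewrite u1 in u2; rewrite v1 in v2; split; last first.
      apply/eqP; rewrite -subr_eq0; apply/eqP.
      have d2 : d / 2 != 0 by lra.
      by apply: (mulIf d2); rewrite mul0r; lra.
    have e2 : (2 : R) ^ m' = 2 ^ m.
      apply/eqP; rewrite -subr_eq0; apply/eqP.
      have d2 : d / 2 != 0 by lra.
      by apply: (mulIf d2); rewrite mul0r; lra.
    by move: u2; rewrite e2; lra.
  by rewrite (chr s st) (chr t) ?subrr ?normr0.
pose L (t : R) := f t0 + 2 ^ m * (t - t0).
have fin t : a < t < a + l -> f t = L t.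
  by move=> /AA At; have := nbhs_singleton At; rewrite addr0.
have fcl t : a <= t <= a + l -> f t = L t.
  move=> tin; apply/eqP; rewrite -subr_eq0 -normr_le0; apply/ler_addgt0Pr => e e0.
  have cD : {for t, continuous (fun t => f t - L t)}.
    apply: cvgB; first exact: cf.
    apply: cvgD; first exact: cvg_cst.
    apply: cvgM; first exact: cvg_cst.
    by apply: cvgB; [exact: cvg_id|exact: cvg_cst].
  have /cvgrPdist_lt/(_ _ e0)/near_ballP[d d0 Hd] := cD.
  have [s [s1 s2]] : exists s, a < s < a + l /\ `|s - t| < d.
    move/andP: tin => [ta tl]; pose r := Num.min (d / 2) (l / 3).
    have r0 : 0 < r by rewrite lt_min; apply/andP; split; lra.
    have rd : r <= d / 2 by rewrite ge_min lexx.
    have rl : r <= l / 3 by rewrite ge_min lexx orbT.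
    have [c|c] := lerP t (a + l / 2).
      by exists (t + r); rewrite addrAC subrr add0r gtr0_norm//; split; [apply/andP; split|]; lra.
    by exists (t - r); rewrite addrAC subrr add0r normrN gtr0_norm//; split; [apply/andP; split|]; lra.
  have := Hd s s2; rewrite /= (fin s s1) subrr subr0 add0r => /ltW; exact.
move=> s /andP[s0 sl]; rewrite !fcl; try by apply/andP; split; lra.
by rewrite /L; ring.
Qed.

Lemma common_denominator (S : set (circle R)) : finite_set S -> S `<=` @dyadic R ->
  exists n0, forall n t, (n0 <= n)%N -> S (to_circle t) ->
    exists i : int, t = i%:~R * 2 ^- n.
Proof.
move=> /finite_seqP[s ->]; elim: s => [|p s IH] sd; first by exists 0%N => n t _.
have [|n0 H0] := IH; first by move=> q qs; apply: sd; rewrite /= inE qs orbT.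
have /= := sd p; rewrite inE eqxx => /(_ isT)[m [n1 pE]].
exists (maxn n0 n1) => n t; rewrite geq_max => /andP[nn0 nn1]; rewrite /= inE.
case/orP=> [/eqP|ts]; last exact: H0.
rewrite pE => /to_circle_eq[j ->]; exists (m * 2 ^+ (n - n1) + j * 2 ^+ n).
rewrite intrD !intrM !rmorphXn /= -(subnK nn1) addnK exprD.
by field; rewrite !exp2_neq0.
Qed.

(** A fine enough dyadic grid contains all the breakpoints. *)
Lemma thompson_affine (g : thompsonT R) f : ilift f g ->
  exists n0, forall n (i : int), (n0 <= n)%N -> exists m : int,
    forall s, 0 <= s <= 2 ^- n -> f (i%:~R * 2 ^- n + s) = f (i%:~R * 2 ^- n) + 2 ^ m * s.
Proof.
have small0 (z : int) : `|z| < 1 -> z = 0 by lia.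
move=> [[cf _ _] lf]; have /asboolP[_ fin_b dy_b _] := thompsonT_mem g.
have [n0 H] := common_denominator fin_b dy_b; exists n0 => n i nn0.
apply: (affine_of_locally_affine (exp2V_gt0 n) cf).
move=> t /andP[t1 t2].
have aff : affine_pow2_at g (to_circle t).
  apply: contrapT => nb; have [j tj] := H n t nn0 nb.
  have l0 := @exp2V_gt0 R n.
  move: t1 t2; rewrite tj -[X in _ < _ + X]mul1r -mulrDl !ltr_pM2r// -[1]/(1%:~R).
  by rewrite -intrD !ltr_int; lia.
have [m [y /near_ballP[e e0 He]]] := affine_pow2_atP aff; exists m.
have /to_circle_eq[N fty] : to_circle (f t) = to_circle y.
  have := He 0; rewrite subrr normr0 => /(_ e0); rewrite mulr0 !addr0 => <-.
  by rewrite lf.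
have e4 : 0 < (1 / 4 : R) by lra.
have /near_ballP[e1 e10 H1] : \forall h \near (0 : R), `|f t - f (t + h)| < 1 / 4.
  have /cvgrPdist_lt/(_ _ e4)/near_ballP[d d0 Hd] := cf t.
  by apply/near_ballP; exists d => // h; rewrite subr0 => h0; apply: Hd; rewrite addrC addKr.
have /near_ballP[e2 e20 H2] : \forall h \near (0 : R), `|2 ^ m * h| < 1 / 4.
  have pm : 0 < (2 : R) ^ m by rewrite exprz_gt0.
  apply/near_ballP; exists ((1 / 4) / 2 ^ m); first by rewrite divr_gt0.
  by move=> h; rewrite subr0 ltr_pdivlMr// normrM (gtr0_norm pm) mulrC.
have d0 : 0 < Num.min e (Num.min e1 e2) by rewrite !lt_min e0 e10 e20.
apply/near_ballP; exists (Num.min e (Num.min e1 e2)) => // h.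
rewrite !lt_min => /and3P[he h1 h2].
have := He h he; rewrite lf => /to_circle_eq[M fth].
have k1 := H1 h h1; have k2 := H2 h h2.
have NM : (M - N)%:~R = f (t + h) - f t - 2 ^ m * h by rewrite intrB fth fty; ring.
have : `|(M - N)%:~R : R| < 1.
  rewrite NM; move: k1 k2; rewrite !ltr_norml => /andP[? ?] /andP[? ?].
  by apply/andP; split; lra.
rewrite -intr_norm -[1]/(1%:~R) ltr_int => h0.
move: NM; rewrite (small0 _ h0) => /esym/eqP.
by rewrite -addrA -opprD subr_eq0 => /eqP.
Qed.

Fixpoint full_tree n : tree := if n is m.+1 then Node (full_tree m) (full_tree m) else Leaf.

Lemma leaves_full_tree n : leaves (full_tree n) = (2 ^ n)%N.
Proof. by elim: n => //= n ->; rewrite expnS mul2n addnn. Qed.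

Lemma fits_full_tree f n a (l y h : R) : affine_onto f a l y (h * (2 ^ n)%:R) ->
  fits_tree f h (full_tree n) a l y.
Proof.
elim: n a l y => [|n IH] a l y ff /=; first by rewrite mulr1 in ff.
have e : h * (2 ^ n.+1)%:R / 2 = h * (2 ^ n)%:R.
  by rewrite expnS natrM; field.
by split; apply: IH; [have := affine_onto_left ff|have := affine_onto_right ff];
  rewrite ?leaves_full_tree e.
Qed.

(** A piece of slope [2 ^ q] over a grid interval is cut by a full binary tree,
    whose depth makes the images of the leaves have length [2 ^- M]; all
    pieces can be treated with the same [M] as soon as it is large. *)
Lemma forest_of_affine f (k m : nat) a :
  (forall j, (j < m)%N -> exists q : int, forall s, 0 <= s <= 2 ^- k ->
     f (a + 2 ^- k * j%:R + s) = f (a + 2 ^- k * j%:R) + 2 ^ q * s) ->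
  exists M0, forall M, (M0 <= M)%N -> exists F, [/\ size F = m,
    fits f (2 ^- M) F a (2 ^- k) (f a) &
    f (a + 2 ^- k * m%:R) = f a + 2 ^- M * (forest_leaves F)%:R].
Proof.
have l0 := @exp2V_gt0 R k.
elim: m a => [|m IH] a H.
  by exists 0%N => M _; exists [::]; split=> //; rewrite !mulr0 !addr0.
have [|M1 H1] := IH (a + 2 ^- k).
  move=> j jm; have [q Hq] := H j.+1 jm; exists q => s s1.
  rewrite (_ : a + _ + _ = a + 2 ^- k * j.+1%:R); first exact: Hq.
  by rewrite -(natr1 j); ring.
have [q Hq] := H 0%N isT; rewrite mulr0 addr0 in Hq.
exists (maxn M1 (`|q| + k)) => M; rewrite geq_max => /andP[MM1 Mq].
have [F [sF fF eF]] := H1 M MM1.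
have [d dE] : exists d : nat, M%:Z + q - k%:Z = d%:Z.
  by exists (absz (M%:Z + q - k%:Z)%R); lia.
have hd : 2 ^- M * (2 ^ d)%:R = 2 ^ q * 2 ^- k :> R.
  have e : (2 : R) ^+ M * 2 ^ q = 2 ^+ d * 2 ^+ k.
    by rewrite !exprnP -!expfzDr ?pnatr_eq0//; congr (_ ^ _); lia.
  apply: (mulfI (exp2_neq0 M)); apply: (mulIf (exp2_neq0 k)).
  rewrite natrX; transitivity ((2 : R) ^+ d * 2 ^+ k); first by field; rewrite exp2_neq0.
  by rewrite -e; field; rewrite exp2_neq0.
have fal : f (a + 2 ^- k) = f a + 2 ^- M * (2 ^ d)%:R.
  by rewrite hd Hq// lexx ltW.
exists (full_tree d :: F); split; first by rewrite /= sF.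
  split.
    apply: fits_full_tree => s /andP[s0 s1]; rewrite Hq ?hd; first by rewrite mulrA.
    by apply/andP; split; [exact: mulr_ge0 (ltW l0) s0|rewrite ler_piMr ?(ltW l0)].
  by rewrite leaves_full_tree -fal.
rewrite -(natr1 m) mulrDr mulr1 [_ * _ + _]addrC addrA eF fal /forest_leaves /=.
by rewrite leaves_full_tree natrD mulrDr addrA.
Qed.

(** The element and the identity fit forests with the same number of trees and
    of leaves, both of which can be brought to the same normal form by
    products of small elementary elements; a map is determined by a forest
    that it fits. *)
Theorem xgen_supported (g : thompsonT R) f (c d : R) k0 : (0 < k0)%N -> ilift f g ->
  dyad c -> dyad d -> c < d <= c + 1 -> (forall t, d <= t <= c + 1 -> f t = t) ->
  xgen (region c d k0) g f.
Proof.
move=> k00 lf dc dd /andP[cd d1] fid.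
have [n0 Hn0] := thompson_affine lf.
have [mc [nc cE]] := dc; have [md [nd dE]] := dd.
pose n := maxn n0 (maxn k0.+1 (maxn nc nd)).
have n0n : (n0 <= n)%N by rewrite leq_maxl.
have k0n : (k0 < n)%N by rewrite /n !leq_max leqnn orbT.
have ncn : (nc <= n)%N by rewrite /n !leq_max leqnn !orbT.
have ndn : (nd <= n)%N by rewrite /n !leq_max leqnn !orbT.
have mult (x : R) m k : x = m%:~R / 2 ^+ k -> (k <= n)%N -> x = (m * 2 ^+ (n - k))%:~R * 2 ^- n.
  move=> -> kn; rewrite intrM rmorphXn /= -{2}(subnK kn) exprD.
  by field; rewrite !exp2_neq0.
have := mult _ _ _ cE ncn; have := mult _ _ _ dE ndn.
move: (md * _) (mc * _) => jd ic dE' cE' {mult cE dE}.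
have l0 := @exp2V_gt0 R n; set l : R := 2 ^- n in l0 cE' dE'.
have icd : ic < jd by rewrite -(ltr_int R) -(ltr_pM2r l0) -cE' -dE'.
pose m := absz (jd - ic)%R.
have cm : c + l * m%:R = d.
  have -> : m%:R = (jd - ic)%:~R :> R by rewrite -[jd - ic]gtz0_abs ?subr_gt0.
  by rewrite cE' dE' intrB; ring.
have df := lf.1.
have fc : f c = c.
  have := fid (c + 1); rewrite d1 lexx => /(_ isT).
  by have [_ _ ->] := df => /addIr.
have fd : f d = d by apply: fid; rewrite lexx.
have [j _|M1 H1] := @forest_of_affine f n m c.
  have [q Hq] := Hn0 n (ic + j%:Z) n0n; exists q => s s1.
  rewrite (_ : c + _ = (ic + j%:Z)%:~R * 2 ^- n); first exact: Hq.
  by rewrite cE' intrD -/l; ring.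
have [j _|M2 H2] := @forest_of_affine id n m c.
  by exists 0 => s _; rewrite expr0z mul1r.
have [F [sF fF]] := H1 _ (leq_maxl M1 M2).
have [F' [sF' fF']] := H2 _ (leq_maxr M1 M2).
rewrite -/l cm fc fd => dN' dN.
have NN : forest_leaves F' = forest_leaves F.
  apply/eqP; rewrite -(eqr_nat R); apply/eqP.
  by apply: (mulfI (lt0r_neq0 (exp2V_gt0 (maxn M1 M2)))); lra.
have F0 : F <> [::] by move=> F0; move: icd cm; rewrite -sF F0 /= mulr0; lra.
have F'0 : F' <> [::] by move=> F0'; move: icd cm; rewrite -sF' F0' /= mulr0; lra.
have [||||g1 [e1 [x1 h1]]] := @forest_normalizes R F c n k0.
- by rewrite k00.
- by [].
- by [].
- by rewrite sF -/l; lra.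
have [||||g2 [e2 [x2 h2]]] := @forest_normalizes R F' c n k0.
- by rewrite k00.
- by [].
- by [].
- by rewrite sF' -/l; lra.
rewrite sF -/l cm in x1; rewrite sF' -/l cm in x2.
have l1 := xgen_ilift x1; have l2 := xgen_ilift x2.
have fe t : f (e1 t) = e2 t.
  have [i /andP[i1 i2]] := floor_itv_shift t c.
  suff key s : c <= s <= c + 1 -> f (e1 s) = e2 s.
    have := key (t + (- i)%:~R).
    rewrite (deg1_int _ _ l1.1) (deg1_int _ _ df) (deg1_int _ _ l2.1) => h.
    by apply: (addIr (- i)%:~R); apply: h; rewrite rmorphN; apply/andP; split; lra.
  move=> /andP[s1 s2]; have [sd|sd] := lerP s d.
    have nz : normal_forest (size F) (forest_leaves F) <> [::].
      by rewrite /normal_forest; case: nseq.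
    apply: (@fits_inj _ (f \o e1) e2 _ _ c l c l0 nz).
    - by move: fF; rewrite fc => /h1; exact.
    - by move: fF' => /h2; rewrite sF' -sF NN; exact.
    - by rewrite size_normal_forest ?sF ?cm ?s1//; rewrite -sF; case: (F) F0.
  have out e g' : xgen (region c d k0) g' e -> e s = s.
    move=> xe; have de := (xgen_ilift xe).1; rewrite -[s](subrK 1).
    have [_ _ ->] := de; congr (_ + 1); apply: (xgen_out _ xe); first exact: ltW.
    by apply/andP; split; lra.
  by rewrite (out _ _ x1) (out _ _ x2) fid// (ltW sd).
have [e1' [x1' k1 k1']] := xgen_inv x1.
have -> : f = e2 \o e1' by apply/funext => t /=; rewrite -fe k1'.
have -> : g = (g2 * g1^-1)%g.
  apply: (thompsonT_eq lf); have -> : f = e2 \o e1' by apply/funext => t /=; rewrite -fe k1'.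
  exact: xgen_ilift (xgenM x2 x1').
exact: xgenM.
Qed.

End generation.

Section generation_all.
Context {R : realType}.
Implicit Types (f e : R -> R) (a t : R).

Definition small k0 : R -> nat -> Prop := fun _ k => (k0 <= k)%N.

Lemma xgen_transitive k0 (x y : R) : (0 < k0)%N -> dyad x -> dyad y ->
  exists (g : thompsonT R) e, xgen (small k0) g e /\ e x = y.
Proof.
move=> k00.
(* an elementary element translates the second quarter of its arc *)
have up k z (N : nat) : (k0 <= k)%N -> dyad z -> exists (g : thompsonT R) e,
    xgen (small k0) g e /\ e z = z + N%:R * 2 ^- k.+2.
  move=> kk dz; elim: N => [|N [g [e [xe ez]]]].
    by exists 1%g, id; split; [exact: xgen1|rewrite mul0r addr0].
  have l4 : 2 ^- k / 4 = 2 ^- k.+2 :> R by rewrite !exp2VS; field; rewrite exp2_neq0.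
  pose a := z + N%:R * 2 ^- k.+2 - 2 ^- k / 4.
  have da : dyad a.
    rewrite /a l4; apply: dyadB; last exact: dyad_exp2V.
    by apply: dyadD => //; apply: dyadM; [exact: dyad_nat|exact: dyad_exp2V].
  exists (tX a k * g)%g, (X a k \o e); split.
    by apply: xgenM xe; apply: xgenX => //; exact: leq_trans k00 kk.
  rewrite /= ez (@X_mid _ _ _ _ 0); first by rewrite -(natr1 N) l4; ring.
  by have := @exp2V_gt0 R k; rewrite /a => ?; apply/andP; split; lra.
move=> dx dy; have [m [n E]] := dyadB dy dx.
pose k := maxn k0 n; have kn : (n <= k.+2)%N by rewrite /k; lia.
have E' : y - x = (m * 2 ^+ (k.+2 - n))%:~R * 2 ^- k.+2.
  rewrite E intrM rmorphXn /= -{2}(subnK kn) exprD.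
  by field; rewrite !exp2_neq0.
move: (m * _) E' => {m E}m E.
have [N mN] : exists N : nat, m = N \/ m = - (N : int) by exists (absz m); lia.
case: mN => mN.
  have [g [e [xe ex]]] := up k x N (leq_maxl _ _) dx; exists g, e; split=> //.
  by rewrite ex; move: E; rewrite mN -pmulrn => <-; ring.
have [g [e [xe ey]]] := up k y N (leq_maxl _ _) dy.
have [e' [xe' ee' _]] := xgen_inv xe; exists (g^-1)%g, e'; split=> //.
rewrite -(ee' y) ey; congr e'; move: E; rewrite mN rmorphN /= -pmulrn.
by move=> E; lra.
Qed.

(** Small elementary elements act transitively on dyadic points, which reduces
    to the case of a lift fixing 0, that is, of an element supported in the
    whole circle cut at 0. *)
Theorem xgen_all k0 (g : thompsonT R) f : (0 < k0)%N -> ilift f g -> xgen (small k0) g f.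
Proof.
move=> k00 lf; have dyf : dyad (f 0).
  have /asboolP[_ _ _ gd] := thompsonT_mem g.
  apply/dyadicP; rewrite -lf.2 -gd; exists (to_circle 0) => //.
  by apply/dyadicP; exact: (dyad_nat 0).
have [h [e [xe e0]]] := xgen_transitive k00 (dyad_nat 0) dyf.
have [e' [xe' ee' e'e]] := xgen_inv xe.
have l := ilift_comp (xgen_ilift xe') lf.
have x : xgen (region 0 1 k0) (h^-1 * g)%g (e' \o f).
  apply: xgen_supported => //.
  - exact: (dyad_nat 0).
  - exact: (dyad_nat 1).
  - by rewrite add0r ltr01 lexx.
  - move=> t; rewrite add0r -eq_le => /eqP <-.
    by have [[_ _ p] _] := l; rewrite -[1]add0r p /= -e0 ee'.
have -> : g = (h * (h^-1 * g))%g by rewrite mulgA mulgV mul1g.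
have -> : f = e \o (e' \o f) by apply/funext => t /=; rewrite e'e.
by apply: xgenM => //; apply: xgenW x => a k [].
Qed.

Lemma thompson_lift (g : thompsonT R) : exists f, ilift f g.
Proof.
have /asboolP[og _ _ _] := thompsonT_mem g.
have [f [lf|[cf mf pf lf]]] := homeo_lift g; first by exists f.
exfalso.
have [|x [y [z]]] := (og (to_circle 0) (to_circle (1 / 4)) (to_circle (1 / 2))).2.
  by exists 0, (1 / 4), (1 / 2); split=> //; split; lra.
rewrite !lf => -[/to_circle_eq[i ->] /to_circle_eq[j ->] /to_circle_eq[k ->] [xy yz zx]].
have AB : f (1 / 4) < f 0 by apply: mf; lra.
have BC : f (1 / 2) < f (1 / 4) by apply: mf; lra.
have CA : f 0 - 1 < f (1 / 2) by rewrite -pf add0r; apply: mf; lra.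
have ij : i < j by rewrite -(ltr_int R); lra.
have jk : j < k by rewrite -(ltr_int R); lra.
have : k%:~R < (i + 2)%:~R :> R by rewrite intrD; lra.
by rewrite ltr_int; lia.
Qed.

Lemma thompson_ind k0 (Q : thompsonT R -> Prop) : (0 < k0)%N -> Q 1%g ->
  (forall g h, Q g -> Q h -> Q (g * h)%g) -> (forall g, Q g -> Q g^-1%g) ->
  (forall a k, dyad a -> (k0 <= k)%N -> Q (tX a k)) -> forall g, Q g.
Proof.
move=> k00 q1 qM qV qX g; have [f lf] := thompson_lift g.
by apply: (xgen_group q1 qM qV _ (xgen_all k00 lf)) => a k da _; exact: qX.
Qed.

Definition supported (g : circle R -> circle R) (c d : R) : Prop :=
  forall t, d <= t <= c + 1 -> g (to_circle t) = to_circle t.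

Lemma tX_supported a k : dyad a -> (0 < k)%N -> supported (tX a k) a (a + 2 ^- k).
Proof.
move=> da k0 t /andP[t1 t2]; rewrite (tXE da k0).2; congr to_circle.
by apply: (@X_out _ _ _ _ 1); apply/andP; split; lra.
Qed.

Lemma supportedW g (c d c' d' : R) : supported g c d -> c' <= c -> d <= d' ->
  supported g c' d'.
Proof. by move=> s cc dd t /andP[t1 t2]; apply: s; apply/andP; split; lra. Qed.

Lemma supported_commute (g h : thompsonT R) c d c' d' :
  supported g c d -> supported h c' d' -> d <= c' -> d' <= c + 1 -> (g * h = h * g)%g.
Proof.
move=> sg sh dc dc'.
have gh p : g p = p \/ h p = p.
  have [t tp] := to_circle_surj p; have [n /andP[n1 n2]] := floor_itv_shift t c.
  have et : p = to_circle (t + (- n)%:~R) by rewrite to_circleD.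
  have [td|td] := lerP d (t - n%:~R).
    by left; rewrite et; apply: sg; rewrite rmorphN; apply/andP; split; lra.
  right; rewrite et -to_circleD1; apply: sh; rewrite rmorphN.
  by apply/andP; split; lra.
apply: val_inj; apply: homeoP => p /=.
have [gp|gp] := pselect (g p = p); have [hp|hp] := pselect (h p = p).
- by rewrite hp gp.
- have [ghp|hhp] := gh (h p); first by rewrite ghp gp.
  by case: hp; exact: (can_inj (@homeo_funK _ h)) hhp.
- have [ggp|hgp] := gh (g p); last by rewrite hgp hp.
  by case: gp; exact: (can_inj (@homeo_funK _ g)) ggp.
- by have [] := gh p.
Qed.

End generation_all.

(** * Commuting conjugate homeomorphisms of the circle *)
Section commuting_conjugates.
Context {R : realType}.
Implicit Types (f h : R -> R) (t : R).

Lemma deg1_displacement f : deg1 f -> exists B : nat, forall t, t - B%:R <= f t <= t + B%:R.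
Proof.
move=> df; exists (Num.truncn (`|f 0| + 1)).+1 => t.
have /andP[] := frac_itv t; set n := Num.floor t; set s := t - n%:~R => s0 s1.
have hB : `|f 0| + 1 < (Num.truncn (`|f 0| + 1)).+1%:R by exact: truncnS_gt.
have -> : t = s + n%:~R by rewrite subrK.
rewrite (deg1_int _ _ df).
have f0 : f 0 <= f s by rewrite (deg1_le df).
have f1 : f s <= f 0 + 1 by have [_ _ <-] := df; rewrite (deg1_le df) add0r.
have := ler_norm (f 0); have := ler_norm (- f 0); rewrite normrN => ? ?.
by apply/andP; split; lra.
Qed.

Lemma deg1_iter f n : deg1 f -> deg1 (iter n f).
Proof.
move=> df; elim: n => [|n IH]; last exact: (deg1_comp df IH).
by split=> // t; exact: cvg_id.
Qed.

Lemma periodic_gap f f' : continuous f -> continuous f' ->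
  (forall t, f (t + 1) = f t + 1) -> (forall t, f' (t + 1) = f' t + 1) ->
  (forall t, f' t < f t) -> exists2 d, 0 < d & forall t, f' t + d <= f t.
Proof.
move=> cf cf' pf pf' lt.
have [|d d0 Hd] := @unit_uniform R (fun d t => f' t + d <= f t).
  move=> t _; pose e := (f t - f' t) / 4; have e0 : 0 < e by rewrite divr_gt0 ?subr_gt0.
  have /cvgrPdist_lt/(_ _ e0)/near_ballP[r1 r10 H1] := cf t.
  have /cvgrPdist_lt/(_ _ e0)/near_ballP[r2 r20 H2] := cf' t.
  exists (Num.min e (Num.min r1 r2)); first by rewrite !lt_min e0 r10 r20.
  move=> s d; rewrite !lt_min => /and3P[_ /H1 h1 /H2 h2] /and4P[d0 de _ _].
  move: h1 h2; rewrite !ltr_norml => /andP[? ?] /andP[? ?].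
  have e4 : f t - f' t = 4 * e by rewrite /e; field.
  by lra.
exists d => // t; have := Hd _ (frac_itv t); rewrite /= -rmorphN.
have pp s : f (s + 1) - f' (s + 1) = f s - f' s by rewrite pf pf'; ring.
by have := periodic_int pp t (- Num.floor t); lra.
Qed.

Section two_maps.
Variables (a a' h h' : R -> R).
Hypotheses (da : deg1 a) (dh : deg1 h) (dh' : deg1 h').
Hypotheses (hK : cancel h h') (h'K : cancel h' h).
Hypothesis conj : forall t, a' t = h (a (h' t)).

Let da' : deg1 a'.
Proof. by rewrite (_ : a' = h \o (a \o h')); [do 2!apply: deg1_comp => //|apply/funext]. Qed.

Let iter_conj n t : iter n a' t = h (iter n a (h' t)).
Proof. by elim: n => [|n IH] /=; rewrite ?h'K// IH conj hK. Qed.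

(** Conjugation by [h] changes all iterates by at most twice the displacement
    of [h]. *)
Let bounded : exists B : nat, forall n t,
  iter n a t - B%:R <= iter n a' t <= iter n a t + B%:R.
Proof.
have [B HB] := deg1_displacement dh; have [B' HB'] := deg1_displacement dh'.
exists (B + B')%N => n t; rewrite iter_conj natrD.
have := HB (iter n a (h' t)); have /andP[h1 h2] := HB' t.
have dn := deg1_iter n da; have hi := deg1_le dn.
have : iter n a (h' t) <= iter n a (t + (B' : int)%:~R) by rewrite hi.
have : iter n a (t + (- (B' : int))%:~R) <= iter n a (h' t) by rewrite hi rmorphN.
rewrite !(deg1_int _ _ dn) rmorphN /= -!pmulrn => ? ? /andP[? ?].
by apply/andP; split; lra.
Qed.

(** A shift [n] would make the iterates of [a'] and of its conjugate by [a]
    drift apart linearly. *)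
Lemma commutator_shift0 (n : int) : (forall t, a (a' t) = a' (a t) + n%:~R) -> n = 0.
Proof.
move=> com; have [B HB] := bounded.
have comj j t : a (iter j a' t) = iter j a' (a t) + (n * j)%:~R.
  elim: j => [|j IH] /=; first by rewrite mulr0 addr0.
  by rewrite com IH (deg1_int _ _ da') -addrA -intrD; congr (_ + _%:~R); lia.
have bd (j : nat) : `|(n * j)%:~R : R| <= 2 * B%:R.
  have e := comj j 0; have /andP[h1 h2] := HB j (a 0).
  have /andP[h3 h4] := HB j 0.
  have : a (iter j a' 0) <= a (iter j a 0 + (B : int)%:~R) by rewrite (deg1_le da).
  have : a (iter j a 0 + (- (B : int))%:~R) <= a (iter j a' 0) by rewrite (deg1_le da) rmorphN.
  rewrite !(deg1_int _ _ da) rmorphN /= -!pmulrn => h5 h6.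
  have ea : a (iter j a 0) = iter j a (a 0) by rewrite -iterS -iterSr.
  by rewrite ler_norml; apply/andP; split; lra.
have := bd (2 * B + 1)%N; rewrite -intr_norm.
rewrite (_ : 2 * B%:R = (2 * B)%N%:~R) ?ler_int; last by rewrite -pmulrn natrM.
by nia.
Qed.

(** By compactness the gap between [a'] and [a] is bounded below, and since the
    maps commute, it accumulates under iteration. *)
Lemma conj_not_above : (forall t, a (a' t) = a' (a t)) -> ~ (forall t, a' t < a t).
Proof.
move=> com lt; have [B HB] := bounded.
have [ca _ pa] := da; have [ca' _ pa'] := da'.
have [d d0 gap] := periodic_gap ca ca' pa pa' lt.
have comj j t : a (iter j a' t) = iter j a' (a t).
  by elim: j => [|j IH] //=; rewrite com IH.
have grow j t : iter j a' t + j%:R * d <= iter j a t.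
  elim: j t => [|j IH] t; first by rewrite mul0r addr0.
  rewrite [in leRHS]iterSr; apply: le_trans (IH (a t)); rewrite -comj iterS -natr1.
  by have := gap (iter j a' t); lra.
pose j := (Num.truncn (B%:R / d)).+1.
have : B%:R < j%:R * d by rewrite -ltr_pdivrMr//; exact: truncnS_gt.
by have := grow j 0; have /andP[? ?] := HB j 0; lra.
Qed.

Lemma conj_not_below : (forall t, a (a' t) = a' (a t)) -> ~ (forall t, a t < a' t).
Proof.
move=> com lt; have [B HB] := bounded.
have [ca _ pa] := da; have [ca' _ pa'] := da'.
have [d d0 gap] := periodic_gap ca' ca pa' pa lt.
have comj j t : a' (iter j a t) = iter j a (a' t).
  by elim: j => [|j IH] //=; rewrite -com IH.
have grow j t : iter j a t + j%:R * d <= iter j a' t.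
  elim: j t => [|j IH] t; first by rewrite mul0r addr0.
  rewrite [in leRHS]iterSr; apply: le_trans (IH (a' t)); rewrite -comj iterS -natr1.
  by have := gap (iter j a t); lra.
pose j := (Num.truncn (B%:R / d)).+1.
have : B%:R < j%:R * d by rewrite -ltr_pdivrMr//; exact: truncnS_gt.
by have := grow j 0; have /andP[? ?] := HB j 0; lra.
Qed.

Lemma conj_coincide (n : int) : (forall t, a (a' t) = a' (a t) + n%:~R) ->
  exists t, a t = a' t.
Proof.
move=> com; have n0 := commutator_shift0 com.
have {}com t : a (a' t) = a' (a t) by rewrite com n0 addr0.
have [ca _ pa] := da; have [ca' _ pa'] := da'.
apply: contrapT => ne.
have nz t : a t - a' t != 0 by apply/eqP => /eqP; rewrite subr_eq0 => /eqP ?; apply: ne; exists t.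
have [t1 h1] : exists t, a t < a' t.
  apply: contrapT => no; apply: (conj_not_above com) => t.
  by have := nz t; rewrite subr_eq0 lt_neqAle eq_sym => ->/=; rewrite leNgt; apply/negP => ?; apply: no; exists t.
have [t2 h2] : exists t, a' t < a t.
  apply: contrapT => no; apply: (conj_not_below com) => t.
  by have := nz t; rewrite subr_eq0 lt_neqAle => ->/=; rewrite leNgt; apply/negP => ?; apply: no; exists t.
have cD (t : R) : {for t, continuous (fun t => a t - a' t)}.
  by apply: cvgB; [exact: ca|exact: ca'].
have fin x y : x <= y -> Num.min (a x - a' x) (a y - a' y) <= 0 <= Num.max (a x - a' x) (a y - a' y) -> False.
  move=> xy /(@IVT _ (fun t => a t - a' t) _ _ _ xy)[]; last by move=> c _ /eqP; apply/negP.
  by apply: continuous_subspaceT => t; exact: cD.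
have [t12|t21] := lerP t1 t2.
  by apply: (fin _ _ t12); rewrite ge_min le_max; apply/andP; split; apply/orP; [left|right]; lra.
by apply: (fin _ _ (ltW t21)); rewrite ge_min le_max; apply/andP; split; apply/orP; [right|left]; lra.
Qed.

End two_maps.

(** Translation numbers are conjugacy invariant and additive on commuting
    homeomorphisms, so the quotient of two commuting conjugate homeomorphisms
    has rotation number 0, hence a fixed point. *)
Theorem commuting_conjugates_fixpoint (u v : homeo (circle R)) : incr u -> incr v ->
  commute u (v * u * v^-1)%g -> exists p, (u * (v * u * v^-1)^-1)%g p = p.
Proof.
move=> [a la] [h lh] com; have [h' [lh' hK h'K]] := ilift_inv lh.
have la' := ilift_comp (ilift_comp lh la) lh'.
have [n hn] : exists n : int, forall t, a (h (a (h' t))) = h (a (h' (a t))) + n%:~R.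
  have l1 := ilift_comp la la'; have l2 := ilift_comp la' la.
  by rewrite -com in l2; have [n hn] := ilift_unique l2 l1; exists n.
have [t ht] := conj_coincide la.1 lh.1 lh'.1 hK h'K (fun t => erefl) hn.
have uv : u (to_circle t) = (v * u * v^-1)%g (to_circle t).
  by rewrite la.2 la'.2; congr to_circle.
exists ((v * u * v^-1)%g (to_circle t)); rewrite -[in RHS]uv.
by rewrite -[LHS]/(u (((v * u * v^-1)^-1 * (v * u * v^-1))%g (to_circle t))) mulVg.
Qed.

End commuting_conjugates.

(** * Actions of the group on the circle: orientation and fixed points *)
Section action.
Context {R : realType} (tau : UMagmaMorphism.type (thompsonT R) (homeo (circle R))).
Implicit Types (a t : R) (g h : thompsonT R) (p : circle R).

Lemma tau_mul g h : tau (g * h)%g = (tau g * tau h)%g. Proof. exact: gmulfM. Qed.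

Lemma tau_one : tau 1%g = 1%g. Proof. exact: gmulf1. Qed.

Lemma tau_inv g : tau g^-1%g = (tau g)^-1%g. Proof. exact: gmulfV. Qed.

Lemma tauM g h p : tau (g * h)%g p = tau g (tau h p).
Proof. by rewrite tau_mul. Qed.

Lemma tau1 p : tau 1%g p = p.
Proof. by rewrite tau_one. Qed.

Lemma tauVK g p : tau g^-1%g (tau g p) = p.
Proof. by rewrite -tauM mulVg tau1. Qed.

Lemma tauKV g p : tau g (tau g^-1%g p) = p.
Proof. by rewrite -tauM mulgV tau1. Qed.

Lemma tau_fixV g p : tau g p = p -> tau g^-1%g p = p.
Proof. by move=> e; rewrite -{1}e tauVK. Qed.

Lemma tau_fix_xgen P g f p : (forall a k, dyad a -> (0 < k)%N -> P a k -> tau (tX a k) p = p) ->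
  xgen P g f -> tau g p = p.
Proof.
move=> H; apply: (@xgen_group _ P (fun g => tau g p = p)) => //; first exact: tau1.
  by move=> g1 g2 e1 e2; rewrite tauM e2 e1.
by move=> g1; exact: tau_fixV.
Qed.

Lemma tX_half_rot a k : dyad a -> (0 < k)%N ->
  tX (a + 2 ^- k) k = (tR (2 ^- k) * tX a k * (tR (2 ^- k))^-1)%g :> thompsonT R.
Proof. by move=> da k0; rewrite tX_rot//; exact: dyad_exp2V. Qed.

(** The pentagon turns into [s ^ 2 = s ^ 3] for the orientation sign [s] of
    an elementary element, since its two halves are conjugate to it. *)
Theorem tau_incr g : incr (tau g).
Proof.
apply: (@thompson_ind _ 2 (fun g => incr (tau g))) => //.
- by rewrite tau_one; exact: incr1.
- by move=> g1 g2 i1 i2; rewrite tau_mul; exact: incrM.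
- by move=> g1 i1; rewrite tau_inv; exact: incrV.
move=> a [//|[//|k]] da _.
have e1 := tX_left_conj da (isT : (0 < k.+1)%N).
have e2 := tX_half_rot da (isT : (0 < k.+3)%N).
have e3 := tX_pentagon da (isT : (0 < k.+2)%N).
apply: contrapT => nX.
have n1 : ~ incr (tau (tX a k.+3)).
  by move=> i; apply: nX; rewrite -e1 2!tau_mul tau_inv incr_conj.
have n2 : ~ incr (tau (tX (a + 2 ^- k.+3) k.+3)).
  by rewrite e2 2!tau_mul tau_inv incr_conj.
apply: n1; have := nincrM nX nX; rewrite -tau_mul e3 2!tau_mul.
by rewrite incrMl//; exact: nincrM.
Qed.

Lemma tau_lift g : exists f, ilift f (tau g). Proof. exact: tau_incr. Qed.

Lemma lift_fix (u : homeo (circle R)) t : incr u -> u (to_circle t) = to_circle t ->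
  exists f, ilift f u /\ f t = t.
Proof.
move=> [f lf]; rewrite lf.2 => /to_circle_eq[n e].
exists (fun s => f s + (- n)%:~R); split; first exact: ilift_addint.
by rewrite e rmorphN /= addrK.
Qed.

Lemma involution_fix (u : homeo (circle R)) p : incr u -> (u * u = 1)%g -> u p = p -> u = 1%g.
Proof.
have [t <-] := to_circle_surj p => iu uu /(lift_fix iu)[f [lf ft]].
have [n hn] := ilift_unique (@ilift1 R) (eq_ind _ (ilift (f \o f)) (ilift_comp lf lf) _ uu).
have n0 : n%:~R = 0 :> R by have := hn t; rewrite /= !ft; lra.
have {}hn s : f (f s) = s by have := hn s; rewrite /= n0 addr0.
apply: homeoP => q; have [s <-] := to_circle_surj q.
rewrite lf.2; congr to_circle; have mf := deg1_lt lf.1.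
have [lt|lt|//] := ltgtP (f s) s.
  by have := lt; rewrite -mf hn; lra.
by have := lt; rewrite -mf hn; lra.
Qed.

(** With a global fixed point, the rotation by a half turn acts trivially, so
    an elementary element acts like its copy on the opposite side.  Its action
    thus commutes with that of every element supported away from the copy, in
    particular with those conjugating it to its halves; so it acts like its
    halves, and the pentagon makes this action trivial. *)
Theorem fixpoint_trivial p : (forall g, tau g p = p) -> forall g, tau g = 1%g.
Proof.
move=> fp; pose r : thompsonT R := tR (2 ^- 1).
have r1 : tau r = 1%g.
  apply: (@involution_fix _ p) => //; first exact: tau_incr.
  rewrite -tau_mul; have -> : (r * r = 1)%g; last exact: tau_one.
  have lr := tRE (@dyad_exp2V R 1).
  apply: (@thompsonT_eq _ (r * r)%g 1%g _ (ilift_comp lr lr)).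
  rewrite (_ : _ \o _ = fun t => id t + 1%:~R); first exact: ilift_addint ilift1.
  by apply/funext => t /=; field.
have opp a k : dyad a -> (0 < k)%N -> tau (tX (a + 2 ^- 1) k) = tau (tX a k).
  move=> da k0; rewrite -tX_rot//; last exact: dyad_exp2V.
  by rewrite 2!tau_mul tau_inv -/r r1 invg1 mul1g mulg1.
have central a k g : dyad a -> (0 < k)%N -> supported g (a + 2 ^- 1 + 2 ^- k - 1) (a + 2 ^- 1) ->
    tau (g * tX a k * g^-1)%g = tau (tX a k).
  move=> da k0 sg; have dh := dyadD da (@dyad_exp2V R 1).
  rewrite 2!tau_mul -opp// -!tau_mul; congr (tau _).
  rewrite (supported_commute sg (tX_supported dh k0)) -?mulgA ?mulgV ?mulg1//.
  by lra.
have half1 : (2 : R) ^- 1 = 1 / 2 by rewrite expr1; lra.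
have left a k : dyad a -> tau (tX a k.+3) = tau (tX a k.+2).
  move=> da; rewrite -[in RHS](tX_left_conj da (isT : (0 < k.+1)%N)).
  apply/esym/central => //.
  apply: supportedW (tX_supported da (isT : (0 < k.+1)%N)) _ _.
    by have := @exp2V_le R 1 k.+3 isT; lra.
  by have := @exp2V_le R 1 k.+1 isT; lra.
have right a k : dyad a -> tau (tX (a + 2 ^- k.+3) k.+3) = tau (tX a k.+2).
  move=> da; pose b := a - 2 ^- k.+2.
  have db : dyad b by apply: dyadB => //; exact: dyad_exp2V.
  have := tX_right_conj db (isT : (0 < k.+1)%N); rewrite subrK => <-.
  apply: central => //.
  apply: supportedW (tX_supported db (isT : (0 < k.+1)%N)) _ _.
    have := @exp2V_le R 2 k.+2 isT; rewrite half1 /b expr2.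
    by lra.
  have := @exp2V_le R 1 k.+1 isT; have := @exp2V_gt0 R k.+2; rewrite /b; lra.
move=> g; apply: (@thompson_ind _ 2 (fun g => tau g = 1%g)) => //.
- exact: tau_one.
- by move=> g1 g2 i1 i2; rewrite tau_mul i1 i2 mulg1.
- by move=> g1 i1; rewrite tau_inv i1 invg1.
move=> a [//|[//|k]] da _.
have := congr1 tau (tX_pentagon da (isT : (0 < k.+2)%N)).
rewrite !tau_mul right// left// => e.
by apply: (mulgI (tau (tX a k.+2) * tau (tX a k.+2))%g); rewrite mulg1 -e.
Qed.

End action.

Section invariant_sets.
Context {R : realType}.
Implicit Types (A B : set R) (f : R -> R) (t : R).

Definition periodic_set A : Prop := forall t, A (t + 1) <-> A t.

Lemma periodic_setn A t (n : int) : periodic_set A -> A (t + n%:~R) <-> A t.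
Proof.
move=> pA; have pe s : A (s + 1) = A s by apply/propext; exact: pA.
by rewrite (periodic_int pe).
Qed.

Lemma openP_near A : (forall t, A t -> \forall s \near t, A s) -> open A.
Proof. by move=> H; rewrite openE => t /H. Qed.

Lemma closed_compl_ball A t : closed A -> ~ A t ->
  exists2 e, 0 < e & forall s, `|s - t| < e -> ~ A s.
Proof.
move=> cA nA; apply/near_ballP; apply: open_nbhs_nbhs; split=> //.
by rewrite openC.
Qed.

Lemma closed_int_preimage (h : R -> R) : continuous h ->
  closed [set t | h t \is a Num.int].
Proof.
move=> ch; rewrite -openC; apply: openP_near => t /= nt.
have /andP[n1 n2] := floor_itv (h t); set n := Num.floor (h t) in n1 n2.
have n1' : n%:~R < h t.
  by rewrite lt_neqAle n1 andbT; apply/eqP => e; apply: nt; rewrite -e intr_int.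
have hn : n%:~R < h t < (n + 1)%:~R by rewrite n1'.
have ns : \forall s \near t, n%:~R < h s < (n + 1)%:~R by exact: ch t _ (near_itv hn).
apply: filterS ns => s /= /andP[s1 s2] /intrP[m sm].
by move: s1 s2; rewrite sm !ltr_int; lia.
Qed.

(** A family of closed periodic sets is a family of closed subsets of the
    circle, which is compact. *)
Lemma periodic_compact (I : eqType) (Z : I -> set R) :
  (forall i, closed (Z i)) -> (forall i, periodic_set (Z i)) ->
  (forall s : seq I, exists t, forall i, i \in s -> Z i t) ->
  exists t, forall i, Z i t.
Proof.
move=> cZ pZ fin.
pose F : set_system R := fun U => exists s : seq I,
  forall t, 0 <= t <= 1 -> (forall i, i \in s -> Z i t) -> U t.
have FF : ProperFilter F.
  split.
    move=> [s Hs]; have [t Ht] := fin s.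
    apply: (Hs (t - (Num.floor t)%:~R) (frac_itv t)) => i /Ht Zt.
    by rewrite -rmorphN; exact: (periodic_setn _ (- Num.floor t) (pZ i)).2 Zt.
  split.
  - by exists [::].
  - move=> U V [s Hs] [s' Hs']; exists (s ++ s') => t t01 H; split.
      by apply: Hs => // i si; apply: H; rewrite mem_cat si.
    by apply: Hs' => // i si; apply: H; rewrite mem_cat si orbT.
  - by move=> U V UV [s Hs]; exists s => t t01 H; apply: UV; exact: Hs.
have [|t [_ ct]] := @segment_compact R 0 1 F FF.
  by exists [::] => t t01 _; rewrite /= in_itv.
exists t => i; apply: cZ => U nU.
have FZ : F (Z i) by exists [:: i] => s _; apply; rewrite inE.
by have [s [? ?]] := ct _ _ FZ nU; exists s.
Qed.

Section family.
Variable K : (R -> R) -> Prop.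
Hypothesis K_deg1 : forall f, K f -> deg1 f.
Hypothesis K_inv : forall f, K f -> exists f', [/\ K f', cancel f f' & cancel f' f].

Definition stable_set A : Prop := forall f, K f -> forall t, A t -> A (f t).

(** [S] consists of the points of [B] that are followed by a point of [A]
    before any other point of [B].  Two points of [S] are separated by a point
    of [A], whose distance to [B] is bounded below by compactness. *)
Lemma disjoint_invariant_discrete A B : closed A -> closed B ->
  periodic_set A -> periodic_set B -> A !=set0 -> B !=set0 ->
  stable_set A -> stable_set B -> (forall t, A t -> B t -> False) ->
  exists (S : set R) (d : R), [/\ 0 < d, S !=set0, stable_set S &
    forall s s', S s -> S s' -> s < s' -> s + d <= s'].
Proof.
move=> cA cB pA pB [a0 Aa0] [b0 Bb0] iA iB dis.
have [t _|d d0 Hd] := @unit_uniform R (fun d t => forall a b, A a -> B b ->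
    `|a - t| < d -> `|b - t| < d -> False).
  have [At|nAt] := pselect (A t).
    have nB : (~` B) t by move=> /(dis _ At).
    have [e e0 He] := closed_compl_ball cB nB.
    exists (e / 2); first by rewrite divr_gt0.
    move=> s d sts /andP[d0 de] a b _ Bb _ bs; apply: (He b) => //.
    by have := ler_distD s b t; lra.
  have [e e0 He] := closed_compl_ball cA nAt.
  exists (e / 2); first by rewrite divr_gt0.
  move=> s d sts /andP[d0 de] a b Aa _ as_ _; apply: (He a) => //.
  by have := ler_distD s a t; lra.
have far a b : A a -> B b -> b < a -> b + d <= a.
  move=> Aa Bb ba; rewrite leNgt; apply/negP => ab.
  apply: (Hd _ (frac_itv a) (a + (- Num.floor a)%:~R) (b + (- Num.floor a)%:~R)).
  - exact/(periodic_setn _ _ pA).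
  - exact/(periodic_setn _ _ pB).
  - by rewrite rmorphN subrr normr0.
  - rewrite rmorphN opprB addrA subrK ltr_norml; apply/andP; split; lra.
pose S := [set b | B b /\ exists2 a, A a & b < a /\ forall s, B s -> b < s -> a < s].
exists S, d; split=> //.
- pose T := [set b | B b /\ b <= a0].
  have T0 : T !=set0.
    exists (b0 + (Num.floor (a0 - b0))%:~R); split; first exact/(periodic_setn _ _ pB).
    by have /andP[? _] := floor_itv (a0 - b0); lra.
  have Tu : has_sup T by split=> //; exists a0 => b [].
  have cT : closed T.
    rewrite (_ : T = B `&` [set b | b <= a0]); last by apply/seteqP; split.
    by apply: closedI => //; exact: closed_le.
  have [Bs sa] : T (sup T) by apply: cT; apply: closure_sup => //; exact: Tu.2.
  exists (sup T); split=> //; exists a0 => //; split.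
    by rewrite lt_neqAle sa andbT; apply/eqP => e; apply: (dis a0) => //; rewrite -e.
  move=> s Bs' ss; rewrite ltNge; apply/negP => sa0.
  by have := sup_upper_bound Tu (conj Bs' sa0); lra.
- move=> f Kf b [Bb [a Aa [ba nb]]]; have df := K_deg1 Kf.
  have [f' [Kf' fK f'K]] := K_inv Kf; have df' := K_deg1 Kf'.
  split; first exact: iB.
  exists (f a); first exact: iA.
  split; first by rewrite (deg1_lt df).
  move=> s Bs bs; rewrite -(deg1_lt df') fK; apply: nb; first exact: iB.
  by rewrite -(deg1_lt df) f'K.
- move=> s s' [Bs [a Aa [sa na]]] [Bs' _] ss'.
  by have := far _ _ Aa Bs sa; have := na _ Bs' ss'; lra.
Qed.

(** If [f] moved a point of [S] upwards, its iterates would move it by [d] each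
    time, and finally past some translate of the fixed point [p]. *)
Lemma discrete_invariant_fix S (d : R) f p : 0 < d -> stable_set S ->
  (forall s s', S s -> S s' -> s < s' -> s + d <= s') ->
  K f -> f p = p -> forall s, S s -> f s = s.
Proof.
move=> d0 iS sep.
have up h q : K h -> h q = q -> forall s, S s -> ~ s < h s.
  move=> Kh hq s Ss lt; have dh := K_deg1 Kh.
  have it n : S (iter n h s) /\ iter n h s < iter n.+1 h s.
    elim: n => [|n [IH1 IH2]]; first by split.
    split; first exact: iS Kh _ IH1.
    by rewrite iterS [X in _ < X]iterS (deg1_lt dh).
  have grow n : s + n%:R * d <= iter n h s.
    elim: n => [|n IH]; first by rewrite mul0r addr0.
    have [S1 lt1] := it n; have [S2 _] := it n.+1.
    by have := sep _ _ S1 S2 lt1; rewrite -(natr1 n); lra.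
  pose N := Num.floor (s - q) + 1.
  have sN : s < q + N%:~R.
    by have /andP[_] := floor_itv (s - q); rewrite -/N; lra.
  have top n : iter n h s < q + N%:~R.
    elim: n => [//|n IH]; rewrite iterS -hq -(deg1_int _ _ dh) (deg1_lt dh).
    by [].
  pose n := (Num.truncn ((q + N%:~R - s) / d)).+1.
  have : (q + N%:~R - s) / d < n%:R by exact: truncnS_gt.
  rewrite ltr_pdivrMr// => h1.
  by have := grow n; have := top n; lra.
move=> Kf fp s Ss; have [f' [Kf' fK f'K]] := K_inv Kf.
have [lt|lt|//] := ltgtP (f s) s; exfalso; last exact: (up _ _ Kf fp _ Ss lt).
apply: (up _ p Kf' _ _ Ss); first by rewrite -{1}fp fK.
by rewrite -{1}(fK s) (deg1_lt (K_deg1 Kf')).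
Qed.

End family.
End invariant_sets.

(** * Fixed points of arc subgroups *)
Section arc_fixpoints.
Context {R : realType} (tau : UMagmaMorphism.type (thompsonT R) (homeo (circle R))).
Implicit Types (a c d t : R) (g h : thompsonT R) (p : circle R) (k : nat).

Definition Fix g : set R := [set t | tau g (to_circle t) = to_circle t].

Lemma Fix_closed g : closed (Fix g).
Proof.
have [f [[cf _ _] lf]] := tau_lift tau g.
rewrite (_ : Fix g = [set t | f t - t \is a Num.int]).
  by apply: closed_int_preimage => t; apply: cvgB; [exact: cf|exact: cvg_id].
by apply/seteqP; split=> t /=; rewrite /Fix /= lf => /to_circleP.
Qed.

Lemma Fix_periodic g : periodic_set (Fix g).
Proof. by move=> t; rewrite /Fix /= to_circleD1. Qed.

Lemma supportedM g h c d : supported g c d -> supported h c d -> supported (g * h)%g c d.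
Proof. by move=> sg sh t tcd; rewrite /= sh// sg. Qed.

Lemma supportedV g c d : supported g c d -> supported (g^-1)%g c d.
Proof. by move=> sg t tcd; rewrite -{1}(sg _ tcd) /= homeo_funK. Qed.

Definition arc_lifts c d (f : R -> R) : Prop :=
  exists2 g : thompsonT R, supported g c d & ilift f (tau g).

Lemma arc_lifts_deg1 c d f : arc_lifts c d f -> deg1 f.
Proof. by move=> [g _ []]. Qed.

Lemma arc_lifts_inv c d f : arc_lifts c d f ->
  exists f', [/\ arc_lifts c d f', cancel f f' & cancel f' f].
Proof.
move=> [g sg lf]; have [f' [lf' fK f'K]] := ilift_inv lf.
by exists f'; split=> //; exists g^-1%g; [exact: supportedV|rewrite tau_inv].
Qed.

(** The fixed point sets of the elements of the second arc subgroup are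
    invariant under the first one.  If invariant closed sets always meet, then
    those that are nonempty have a common point by compactness.  Otherwise the
    first subgroup has a finite orbit, and an element of it with a fixed point
    fixes this orbit pointwise. *)
Lemma common_fixpoint_alternative c d c' d' : d <= c' -> d' <= c + 1 ->
  (exists p, forall g, supported g c d -> (exists q, tau g q = q) -> tau g p = p) \/
  (exists p, forall g, supported g c' d' -> (exists q, tau g q = q) -> tau g p = p).
Proof.
move=> dc dc'; pose K := arc_lifts c d.
pose good (A : set R) := [/\ closed A, periodic_set A, A !=set0 & stable_set K A].
have [meet|nomeet] := pselect (forall A B, good A -> good B -> good (A `&` B)).
  right; pose Z (g : thompsonT R) : set R :=
    [set t | supported g c' d' -> (exists q, tau g q = q) -> Fix g t].
  have goodF g : supported g c' d' -> (exists q, tau g q = q) -> good (Fix g).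
    move=> sg [q gq]; split; [exact: Fix_closed|exact: Fix_periodic| |].
      by have [t tq] := to_circle_surj q; exists t; rewrite /Fix /= tq.
    move=> f [h sh lf] t gt; rewrite /Fix /= -lf.2 -tauM.
    by rewrite -(supported_commute sh sg dc dc') tauM gt.
  have ZE g : Z g = Fix g \/ Z g = setT.
    have [sg|nsg] := pselect (supported g c' d' /\ exists q, tau g q = q).
      by left; case: sg => s q; apply/seteqP; split=> t h; [exact: (h s q)|by move=> _ _].
    by right; apply/seteqP; split=> t // _ s q; case: nsg.
  have [|||t Ht] := @periodic_compact R _ Z.
  - by move=> g; case: (ZE g) => ->; [exact: Fix_closed|exact: closedT].
  - by move=> g; case: (ZE g) => ->; [exact: Fix_periodic|].
  - move=> s; suff [A [gA HA]] : exists A, good A /\ forall t, A t -> forall g, g \in s -> Z g t.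
      by have [_ _ [t At] _] := gA; exists t; exact: HA.
    elim: s => [|g s [A [gA HA]]].
      by exists setT; split=> //; split=> //; exists 0.
    have [sg|nsg] := pselect (supported g c' d' /\ exists q, tau g q = q).
      exists (Fix g `&` A); split; first by apply: meet => //; apply: goodF; case: sg.
      move=> t [gt At] h; rewrite inE => /orP[/eqP ->|hs]; first by move=> _ _.
      exact: HA.
    exists A; split=> // t At h; rewrite inE => /orP[/eqP -> s1 q1|hs]; last exact: HA.
    by case: nsg.
  by exists (to_circle t) => g; exact: Ht.
left; have [A [B [gA gB nAB]]] : exists A B, [/\ good A, good B & ~ good (A `&` B)].
  apply: contrapT => H; apply: nomeet => A B gA gB; apply: contrapT => n.
  by apply: H; exists A, B.
have [cA pA nA iA] := gA; have [cB pB nB iB] := gB.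
have dis t : A t -> B t -> False.
  move=> At Bt; apply: nAB; split; first exact: closedI.
  - by move=> s; split=> -[As Bs]; split; apply/pA || apply/pB.
  - by exists t.
  - by move=> f Kf s [As Bs]; split; [exact: iA|exact: iB].
have [S [e [e0 [s0 Ss0] iS sep]]] :=
  disjoint_invariant_discrete (@arc_lifts_deg1 c d) (@arc_lifts_inv c d)
    cA cB pA pB nA nB iA iB dis.
exists (to_circle s0) => g sg [q gq]; have [t tq] := to_circle_surj q.
rewrite -tq in gq; have [f [lf ft]] := lift_fix (tau_incr tau g) gq.
have Kf : K f by exists g.
have := discrete_invariant_fix (@arc_lifts_deg1 c d) (@arc_lifts_inv c d) e0 iS sep Kf ft Ss0.
by rewrite lf.2 => ->.
Qed.

(** Elements of a quarter arc that have a fixed point and hence fix [p] form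
    a normal subgroup of the arc subgroup.  Modulo it an elementary element
    equals any disjoint conjugate of it, hence each of its halves, and the
    pentagon shows that it is trivial. *)
Lemma elementary_fix p a e k : dyad a -> (3 <= k)%N -> e <= a -> a + 2 ^- k <= e + 1 / 8 ->
  (forall g, supported g e (e + 1 / 4) -> (exists q, tau g q = q) -> tau g p = p) ->
  tau (tX a k) p = p.
Proof.
case: k => [//|k] da k3 ea ae fixp; pose Y g := supported g e (e + 1 / 4).
have k0 : (0 < k)%N by lia.
pose N g := Y g /\ tau g p = p.
have NM g h : N g -> N h -> N (g * h)%g.
  by move=> [Yg gp] [Yh hp]; split; [exact: supportedM|rewrite tauM hp].
have NV g : N g -> N g^-1%g.
  by move=> [Yg gp]; split; [exact: supportedV|exact: tau_fixV].
have NJ g y : N g -> Y y -> N (y^-1 * g * y)%g.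
  move=> [Yg gp] Yy; have Yc : Y (y^-1 * g * y)%g.
    by apply: supportedM => //; apply: supportedM => //; exact: supportedV.
  by split=> //; apply: fixp => //; exists (tau y^-1%g p); rewrite !tauM tauKV gp.
have Nconj (u v : thompsonT R) c d c' d' : supported u c d -> supported (v * u * v^-1)%g c' d' ->
    d <= c' -> d' <= c + 1 -> Y u -> Y (v * u * v^-1)%g -> N (u * (v * u * v^-1)^-1)%g.
  move=> su sv dc dc' Yu Yv; have Yuv : Y (u * (v * u * v^-1)^-1)%g.
    by apply: supportedM => //; exact: supportedV.
  split=> //; apply: fixp => //.
  have := @commuting_conjugates_fixpoint R (tau u) (tau v) (tau_incr _ _) (tau_incr _ _).
  rewrite -tau_inv -!tau_mul -tau_inv -tau_mul; apply.
  by rewrite /commute -!tau_mul (supported_commute su sv dc dc').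
have d8 : dyad (1 / 8 : R).
  by rewrite (_ : 1 / 8 = 2 ^- 3); [exact: dyad_exp2V|rewrite !exprS expr0; field].
pose r : thompsonT R := tR (1 / 8).
pose x := tX a k.+1; pose x' := tX (a + 1 / 8) k.+1.
pose x1 := tX a k.+2; pose x2 := tX (a + 2 ^- k.+2) k.+2.
have da8 := dyadD da d8.
have l1 : 2 ^- k.+2 + 2 ^- k.+2 = 2 ^- k.+1 :> R by rewrite (exp2VS k.+1); field; rewrite exp2_neq0.
have lp := @exp2V_gt0 R k.+2.
have dh := dyadD da (@dyad_exp2V R k.+2).
have sx : supported x a (a + 2 ^- k.+1) by exact: tX_supported.
have sx' : supported x' (a + 1 / 8) (a + 1 / 8 + 2 ^- k.+1) by exact: tX_supported.
have sx1 : supported x1 a (a + 2 ^- k.+1).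
  by apply: supportedW (tX_supported da (isT : (0 < k.+2)%N)) _ _; lra.
have sx2 : supported x2 a (a + 2 ^- k.+1).
  by apply: supportedW (tX_supported dh (isT : (0 < k.+2)%N)) _ _; lra.
have Yx : Y x by apply: supportedW sx _ _; lra.
have Yx' : Y x' by apply: supportedW sx' _ _; lra.
have Yx1 : Y x1 by apply: supportedW sx1 _ _; lra.
have Yx2 : Y x2 by apply: supportedW sx2 _ _; lra.
have ex' : x' = (r * x * r^-1)%g by rewrite /x' /r tX_rot.
have ex : x = (tX a k * x1 * (tX a k)^-1)%g by rewrite /x1 tX_left_conj.
have ex2 : x2 = (tR (2 ^- k.+2) * x1 * (tR (2 ^- k.+2))^-1)%g.
  by rewrite /x2 tX_half_rot.
have ex1 : x' = (r * tX a k * x1 * (r * tX a k)^-1)%g by rewrite ex' ex invgM !mulgA.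
have ex12 : x' = (r * tX a k * (tR (2 ^- k.+2))^-1 * x2 * (r * tX a k * (tR (2 ^- k.+2))^-1)^-1)%g.
  by rewrite ex1 ex2 !invgM !invgK !mulgA !mulgVK.
have e0 : N (x * x'^-1)%g.
  by move: sx' Yx'; rewrite ex' => s Y'; apply: (Nconj _ _ _ _ _ _ sx s) => //; lra.
have e1 : N (x1 * x'^-1)%g.
  by move: sx' Yx'; rewrite ex1 => s Y'; apply: (Nconj _ _ _ _ _ _ sx1 s) => //; lra.
have e2 : N (x2 * x'^-1)%g.
  by move: sx' Yx'; rewrite ex12 => s Y'; apply: (Nconj _ _ _ _ _ _ sx2 s) => //; lra.
have f1 : N (x1 * x^-1)%g.
  by rewrite -(mulgVK x' x1) -mulgA -[(x' * x^-1)%g]invgK invgM invgK; apply: NM => //; exact: NV.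
have f2 : N (x2 * x^-1)%g.
  by rewrite -(mulgVK x' x2) -mulgA -[(x' * x^-1)%g]invgK invgM invgK; apply: NM => //; exact: NV.
have pent : (x * x = x2 * x * x1)%g by rewrite /x /x1 /x2 tX_pentagon.
have [] : N x; last by [].
rewrite (_ : x = ((x1 * x^-1)^-1 * ((x * x)^-1 * (x2 * x^-1)^-1 * (x * x)))%g).
  apply: NM; first exact: NV.
  by apply: NJ; [exact: NV|exact: supportedM].
by rewrite [in X in (_ * (_ * X))%g]pent !invgM !invgK !mulgA ?mulgVK ?mulgK ?mulgV ?mul1g.
Qed.

End arc_fixpoints.

Section point_fixpoints.
Context {R : realType} (tau : UMagmaMorphism.type (thompsonT R) (homeo (circle R))).
Implicit Types (a c d t x : R) (g h : thompsonT R) (p : circle R) (k : nat).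

Lemma supported_lift g c d : c < d <= c + 1 -> supported g c d ->
  exists f, ilift f g /\ forall t, d <= t <= c + 1 -> f t = t.
Proof.
move=> /andP[cd dc] sg.
have gd : g (to_circle d) = to_circle d by apply: sg; rewrite lexx.
have ig : incr g by have [f0 lf0] := thompson_lift g; exists f0.
have [f [lf fd]] := lift_fix ig gd.
exists f; split=> // t /andP[dt tc].
have /to_circle_eq[n fn] : to_circle (f t) = to_circle t.
  by rewrite -lf.2 sg// dt.
have f1 : d <= f t by rewrite -{1}fd (deg1_le lf.1).
have f2 : f t < d + 1.
  by rewrite -{1}fd; have [_ _ <-] := lf.1; rewrite (deg1_lt lf.1); lra.
have : (- 1)%:~R < n%:~R :> R by rewrite rmorphN /=; lra.
have : n%:~R < 1%:~R :> R by lra.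
by rewrite !ltr_int => h1 h2; rewrite fn (_ : n = 0) ?addr0//; lia.
Qed.

Lemma supported_fix p c d k0 : (0 < k0)%N -> dyad c -> dyad d -> c < d <= c + 1 ->
  (forall a k, dyad a -> (0 < k)%N -> region c d k0 a k -> tau (tX a k) p = p) ->
  forall g, supported g c d -> tau g p = p.
Proof.
move=> k00 dc dd cd H g sg; have [f [lf fid]] := supported_lift cd sg.
exact: tau_fix_xgen H (xgen_supported k00 lf dc dd cd fid).
Qed.

Lemma short_arc_fixpoint : exists e p, dyad e /\
  forall g, supported g e (e + 1 / 8) -> tau g p = p.
Proof.
have d8 : dyad (1 / 8 : R).
  by rewrite (_ : 1 / 8 = 2 ^- 3); [exact: dyad_exp2V|rewrite !exprS expr0; field].
have fin e p : dyad e ->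
    (forall g, supported g e (e + 1 / 4) -> (exists q, tau g q = q) -> tau g p = p) ->
    forall g, supported g e (e + 1 / 8) -> tau g p = p.
  move=> de H g; apply: (@supported_fix _ _ _ 3) => //; first exact: dyadD.
    by apply/andP; split; lra.
  by move=> a k da k0 [h1 h2 h3]; exact: (elementary_fix da h3 h1 h2 H).
have [||[p Hp]|[p Hp]] := @common_fixpoint_alternative R tau 0 (0 + 1 / 4) (1 / 2) (1 / 2 + 1 / 4).
- lra.
- lra.
- by exists 0, p; split; [exact: (dyad_nat 0)|apply: fin => //; exact: (dyad_nat 0)].
- have dh : dyad (1 / 2 : R) by rewrite mul1r; exact: dyad_half.
  by exists (1 / 2), p; split=> //; exact: fin.
Qed.

(** The end of the arc is moved back by one step of the dyadic grid at a time,
    by the inverse of an elementary element whose translating part is placed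
    there. *)
Lemma contraction_steps c m i : dyad c -> (3 <= m)%N -> (i + 2 <= 2 ^ m)%N ->
  exists g f, [/\ ilift f g, f c = c & f (c + i%:R * 2 ^- m) <= c + 2 ^- m] :> Prop.
Proof.
move=> dc m3; have l0 := @exp2V_gt0 R m; elim: i => [|i IH] im.
  by exists 1%g, id; split; [exact: ilift1|by []|rewrite mul0r addr0; lra].
case: i => [|i] in IH im *.
  by exists 1%g, id; split; [exact: ilift1|by []|rewrite mul1r].
have [|g [f [lf fc fi]]] := IH; first by lia.
have [k mk] : exists k, m = k.+2 by exists m.-2; lia.
have k0 : (0 < k)%N by lia.
have lk : 2 ^- k = 4 * 2 ^- m :> R by rewrite mk !exp2VS; field; rewrite exp2_neq0.
pose a := c + i%:R * 2 ^- m.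
have da : dyad a.
  by apply: dyadD => //; apply: dyadM; [exact: dyad_nat|exact: dyad_exp2V].
have im1 : (i.+4)%:R * 2 ^- m <= 1 :> R.
  rewrite -[X in _ <= X](divff (exp2_neq0 (R := R) m)) ler_pM2r// -natrX ler_nat.
  by lia.
have i0 : 0 <= i%:R * 2 ^- m :> R by rewrite mulr_ge0// ltW.
have E4 : (i.+4)%:R * 2 ^- m = i%:R * 2 ^- m + 4 * 2 ^- m :> R.
  by rewrite -mulrDl -natrD addn4.
have E1 : (i.+1)%:R * 2 ^- m = i%:R * 2 ^- m + 2 ^- m :> R by rewrite -natr1 mulrDl mul1r.
have E2 : (i.+2)%:R * 2 ^- m = i%:R * 2 ^- m + 2 * 2 ^- m :> R.
  by rewrite -mulrDl -natrD addn2.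
exists (g * (tX a k)^-1)%g, (f \o XV a k); split.
- exact: ilift_comp lf (tXVE da k0).
- rewrite /= -[X in XV _ _ X](@X_out _ a k c 0) ?XK//.
  by rewrite /a lk; apply/andP; split; lra.
- rewrite /= (_ : c + i.+2%:R * 2 ^- m = X a k (c + i.+1%:R * 2 ^- m)) ?XK//.
  rewrite (@X_mid _ _ _ _ 0); last by rewrite /a lk E1; apply/andP; split; lra.
  by rewrite lk E1 E2; field; rewrite exp2_neq0.
Qed.

Lemma contraction c d : dyad c -> dyad d -> c < d < c + 1 ->
  exists g f, [/\ ilift f g, f c = c & f d <= c + 1 / 8] :> Prop.
Proof.
move=> dc dd /andP[cd dc1]; have [j [n E]] := dyadB dd dc.
pose m := maxn 3 n.+1; have mn : (n < m)%N by rewrite /m; lia.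
have m3 : (3 <= m)%N by rewrite /m; lia.
have lp := @exp2_gt0 R n.
have j0 : 0 < j.
  have : 0 < j%:~R / (2 : R) ^+ n by rewrite -E; lra.
  by rewrite pmulr_lgt0 ?invr_gt0// ltr0z.
have j1 : j < 2 ^+ n.
  have : j%:~R / (2 : R) ^+ n < 1 by rewrite -E; lra.
  by rewrite ltr_pdivrMr// mul1r -[2 ^+ n]/((2%:~R : R) ^+ n) -rmorphXn /= ltr_int.
pose i := (absz j * 2 ^ (m - n))%N.
have jn : (absz j < 2 ^ n)%N by rewrite -ltz_nat gtz0_abs// -[X in _ < X]natz natrX.
have im : (i + 2 <= 2 ^ m)%N.
  have -> : (2 ^ m = 2 ^ n * 2 ^ (m - n))%N by rewrite -expnD subnKC// ltnW.
  have : (2 <= 2 ^ (m - n))%N.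
    by rewrite -{1}(expn1 2) leq_exp2l//; lia.
  by rewrite /i; move: (2 ^ (m - n))%N (2 ^ n)%N jn => A B AB; nia.
have di : d = c + i%:R * 2 ^- m.
  rewrite -[d in LHS](subrK c) addrC E; congr (_ + _).
  rewrite /i natrM natrX -[in RHS](subnKC (ltnW mn)) exprD.
  rewrite addKn.
  have -> : (absz j)%:R = j%:~R :> R by rewrite -[j in RHS]gtz0_abs.
  by field; rewrite !exp2_neq0.
have [g [f [lf fc fd]]] := contraction_steps dc m3 im.
exists g, f; split=> //; rewrite di; apply: le_trans fd _; rewrite lerD2l.
apply: le_trans (exp2V_le m3) _; rewrite !exprS expr0; lra.
Qed.

(** A contraction conjugates the subgroup of the given arc into that of an arc
    of length 1/8. *)
Theorem arc_fixpoint c d : dyad c -> dyad d -> c < d < c + 1 ->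
  exists p, forall g, supported g c d -> tau g p = p.
Proof.
move=> dc dd cd; have [e [p [de Hp]]] := short_arc_fixpoint.
have [h0 [f0 [l0 f0c f0d]]] := contraction dc dd cd.
pose h := (tR (e - c) * h0)%g; pose f := (fun t => t + (e - c)) \o f0.
have lf : ilift f h by apply: ilift_comp => //; apply: tRE; exact: dyadB.
have fc : f c = e by rewrite /f /= f0c; ring.
have fd : f d <= e + 1 / 8 by rewrite /f /=; lra.
have [f' [lf' fK f'K]] := ilift_inv lf.
exists (tau h^-1%g p) => g sg.
have : tau (h * g * h^-1)%g p = p.
  apply: Hp => t /andP[t1 t2].
  rewrite -[LHS]/(h (g (homeo_inv h (to_circle t)))).
  have -> : homeo_inv h (to_circle t) = to_circle (f' t) by rewrite -lf'.2.
  rewrite sg; first by rewrite lf.2 f'K.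
  rewrite -(deg1_le lf.1) f'K -[X in _ && X](deg1_le lf.1) f'K.
  by have [_ _ ->] := lf.1; rewrite fc; apply/andP; split; lra.
rewrite (tauM _ (h * g)%g) (tauM _ h) => e1.
by rewrite -[in RHS]e1 tauVK.
Qed.

End point_fixpoints.

(** * The correspondence between the two circles *)
Section correspondence.
Context {R : realType} (tau : UMagmaMorphism.type (thompsonT R) (homeo (circle R))).
Hypothesis tau_nontrivial : exists g : thompsonT R, tau g <> 1%g.
Implicit Types (a c d t x y : R) (g h : thompsonT R) (k : nat).

Lemma exp2V_lt (r : R) : 0 < r -> exists k, 2 ^- k < r.
Proof.
move=> r0; exists (Num.truncn r^-1).+1.
rewrite -[ltRHS]invrK ltf_pV2 ?posrE ?invr_gt0 ?exp2_gt0//.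
apply: lt_trans (truncnS_gt _) _; rewrite -natrX ltr_nat; exact: ltn_expl.
Qed.

Lemma dyad_dense (u v : R) : u < v -> exists2 q, dyad q & u < q < v.
Proof.
move=> uv; have [|k kuv] := @exp2V_lt (v - u); first by rewrite subr_gt0.
have l0 := @exp2_gt0 R k; have ln := @exp2_neq0 R k.
exists ((Num.floor (u * 2 ^+ k) + 1)%:~R / 2 ^+ k); first by exists (Num.floor (u * 2 ^+ k) + 1), k.
have /andP[h1 h2] := floor_itv (u * 2 ^+ k).
rewrite ltr_pdivlMr// h2/=; rewrite intrD mulrDl mul1r.
have : (Num.floor (u * 2 ^+ k))%:~R / 2 ^+ k <= u by rewrite ler_pdivrMr.
by lra.
Qed.

Lemma nonint_gap (z : R) : z \isn't a Num.int -> exists2 r, 0 < r & forall n : int, r <= `|z - n%:~R|.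
Proof.
move=> zn; have /andP[h1 h2] := floor_itv z; set m := Num.floor z in h1 h2.
have h1' : m%:~R < z.
  by rewrite lt_neqAle h1 andbT; apply: contra zn => /eqP <-; exact: intr_int.
rewrite intrD in h2.
exists (Num.min (z - m%:~R) (m%:~R + 1 - z)); first by rewrite lt_min; apply/andP; split; lra.
move=> n; have [nm|mn] := lerP n m.
  have : n%:~R <= m%:~R :> R by rewrite ler_int.
  by move=> ?; rewrite ger0_norm ?ge_min; [apply/orP; left|]; lra.
have : (m + 1)%:~R <= n%:~R :> R by rewrite ler_int; lia.
rewrite intrD => ?; rewrite ler0_norm ?ge_min; [apply/orP; right|]; lra.
Qed.

Lemma no_int_inside (n : int) : 0 < n%:~R :> R -> n%:~R < 1 :> R -> False.
Proof. by rewrite ltr0z -[1]/(1%:~R) ltr_int; lia. Qed.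

Definition near_trivial g x : Prop := \forall s \near x, g (to_circle s) = to_circle s.

(** The graph of the future semi-conjugacy, restricted to the closed set of
    those [t] for which such an [x] exists. *)
Definition corresponds t x : Prop := forall g, near_trivial g x -> Fix tau g t.

Lemma near_trivial_shift g x : near_trivial g (x + 1) <-> near_trivial g x.
Proof.
split=> /near_ballP[e e0 He]; apply/near_ballP; exists e => // s sx.
  by rewrite -to_circleD1; apply: He; rewrite opprD addrACA subrr addr0.
rewrite -[s](subrK 1) to_circleD1; apply: He.
by rewrite (_ : s - 1 - x = s - (x + 1))//; ring.
Qed.

Lemma corresponds_intl t x (n : int) : corresponds (t + n%:~R) x <-> corresponds t x.
Proof.
have e g := periodic_setn t n (@Fix_periodic _ tau g).
by split=> H g /H; rewrite e.
Qed.

Lemma corresponds_intr t x (n : int) : corresponds t (x + n%:~R) <-> corresponds t x.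
Proof.
have pe g : near_trivial g (x + n%:~R) <-> near_trivial g x.
  have p1 s : near_trivial g (s + 1) = near_trivial g s.
    by apply/propext; exact: near_trivial_shift.
  by rewrite (periodic_int p1).
by split=> H g /pe; exact: H.
Qed.

(** Finitely many elements trivial near [x] are supported in a common proper
    arc; compactness extends the conclusion to all of them. *)
Lemma corresponds_total x : exists t, corresponds t x.
Proof.
pose Z g : set R := [set t | near_trivial g x -> Fix tau g t].
have ZE g : Z g = Fix tau g \/ Z g = setT.
  have [ng|ng] := pselect (near_trivial g x).
    by left; apply/seteqP; split=> t h; [exact: (h ng)|by move=> _].
  by right; apply/seteqP; split=> t // _ h.
have [|||t Ht] := @periodic_compact R _ Z; last by exists t.
- by move=> g; case: (ZE g) => ->; [exact: Fix_closed|exact: closedT].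
- by move=> g; case: (ZE g) => ->; [exact: Fix_periodic|].
move=> s.
have [e /andP[e0 e4] He] : exists2 e, 0 < e < 1 / 4 & forall g, g \in s ->
    near_trivial g x -> forall r, `|r - x| < e -> g (to_circle r) = to_circle r.
  elim: s => [|g s [e /andP[e0 e4] He]]; first by exists (1 / 8) => //; apply/andP; split; lra.
  have [ng|ng] := pselect (near_trivial g x); last first.
    by exists e; [rewrite e0|move=> h; rewrite inE => /orP[/eqP ->//|]; exact: He].
  have /near_ballP[e' e'0 He'] := ng; exists (Num.min e e').
    by rewrite lt_min e0 e'0 gt_min e4.
  move=> h; rewrite inE => /orP[/eqP ->|hs] nh r; rewrite lt_min => /andP[r1 r2].
    exact: He'.
  exact: (He h hs nh).
have xe : x < x + e by lra.
have [c dc /andP[c1 c2]] := dyad_dense xe.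
have xe1 : x + 1 - e < x + 1 by lra.
have [d dd /andP[d1 d2]] := dyad_dense xe1.
have [|p Hp] := arc_fixpoint tau dc dd; first by apply/andP; split; lra.
have [t tp] := to_circle_surj p; exists t => g gs ng; rewrite /Fix /= tp.
apply: Hp => r /andP[r1 r2]; rewrite -[r](subrK 1) to_circleD1.
by apply: (He g gs ng); rewrite ltr_norml; apply/andP; split; lra.
Qed.

Lemma tX_near_trivial a k x : dyad a -> (0 < k)%N ->
  (forall n : int, ~ (0 <= x - a - n%:~R <= 2 ^- k)) -> near_trivial (tX a k) x.
Proof.
move=> da k0 H; have [n /andP[h1 h2]] := floor_itv_shift x a.
have h3 : 2 ^- k < x - a - n%:~R.
  by rewrite ltNge; apply/negP => h3; apply: (H n); rewrite h3 andbT; lra.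
have : a + n%:~R + 2 ^- k < x < a + n%:~R + 1 by apply/andP; split; lra.
move/near_itv; apply: filterS => s /andP[s1 s2]; rewrite (tXE da k0).2; congr to_circle.
by apply: (@X_out _ _ _ _ (n + 1)); rewrite intrD; apply/andP; split; lra.
Qed.

(** A small enough arc avoids [x] or [y], so all small elementary elements would
    fix the point over [t], which would be a global fixed point. *)
Lemma corresponds_inj t x y : corresponds t x -> corresponds t y -> x - y \is a Num.int.
Proof.
move=> cx cy; apply: contrapT => /negP /nonint_gap[r r0 Hr].
have [k kr] := exp2V_lt r0; have [g ng] := tau_nontrivial; apply: ng.
apply: (@fixpoint_trivial _ _ (to_circle t)) => {}g.
apply: (@thompson_ind _ k.+1 (fun g => tau g (to_circle t) = to_circle t)) => //.
- exact: tau1.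
- by move=> g1 g2 e1 e2; rewrite tauM e2 e1.
- by move=> g1; exact: tau_fixV.
move=> a j da kj; have j0 : (0 < j)%N by lia.
have [Hx|] := pselect (forall n : int, ~ (0 <= x - a - n%:~R <= 2 ^- j)).
  by apply: cx; exact: tX_near_trivial.
move=> /existsNP[n /contrapT /andP[x1 x2]]; apply: cy; apply: tX_near_trivial => // m /andP[y1 y2].
have := Hr (n - m); rewrite leNgt => /negP; apply; apply: le_lt_trans kr.
have lj : 2 ^- j <= 2 ^- k :> R by apply: exp2V_le; lia.
by rewrite intrB ler_norml; apply/andP; split; lra.
Qed.

Lemma corresponds_equivariant g f e t x : ilift f (tau g) -> ilift e g ->
  corresponds t x -> corresponds (f t) (e x).
Proof.
move=> lf le ctx h nh.
have : near_trivial (g^-1 * h * g)%g x.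
  have [[ce _ _] _] := le.
  have : \forall s \near x, h (to_circle (e s)) = to_circle (e s) by exact: ce _ _ nh.
  apply: filterS => s hs.
  rewrite -[LHS]/(homeo_inv g (h (g (to_circle s)))) le.2 hs -le.2.
  exact: homeo_funK.
move=> /ctx; rewrite /Fix /= (tauM _ (g^-1 * h)%g) (tauM _ g^-1%g) lf.2 => e1.
by rewrite -[LHS](tauKV tau g) e1 lf.2.
Qed.

(** The correspondence is a closed relation; since the circle is compact, the
    points [y] corresponding to [t] near [t0] are close to those
    corresponding to [t0]. *)
Lemma corresponds_near (Q : R -> Prop) t0 :
  (forall y, corresponds t0 y -> \forall z \near y, Q z) ->
  exists2 d, 0 < d & forall t, `|t - t0| < d -> forall y, 0 <= y <= 1 -> corresponds t y -> Q y.
Proof.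
move=> H; have [y _|d d0 Hd] := @unit_uniform R (fun d y => forall t, `|t - t0| < d ->
    corresponds t y -> Q y); last by exists d => // t tt0 y y01; exact: Hd.
have [cy|ncy] := pselect (corresponds t0 y).
  have /near_ballP[e e0 He] := H _ cy; exists e => // s d sy _ t _ _; exact: He.
move: ncy => /existsNP[g /not_implyP[ng nF]].
have [e1 e10 He1] := closed_compl_ball (Fix_closed (tau := tau) (g := g)) nF.
have /near_ballP[e2 e20 He2] := ng.
exists (Num.min e1 e2); first by rewrite lt_min e10.
move=> s d; rewrite lt_min => /andP[_ sy] /andP[d0]; rewrite lt_min => /andP[d1 _] t tt0 cts.
exfalso; apply: (He1 t (lt_trans tt0 d1)); apply: cts.
apply/near_ballP; exists (e2 - `|s - y|); first by rewrite subr_gt0.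
move=> r rs; apply: He2.
by have := ler_distD s r y; lra.
Qed.

Lemma X_moves a k t : (0 < k)%N -> 0 < t - a < 2 ^- k -> t < X a k t < t + 1.
Proof.
move=> k0 /andP[h1 h2]; have /andP[l0 l1] := exp2V_half (R := R) k0.
have [c0|c0] := lerP (t - a) (2 ^- k / 4).
  by rewrite (@X_left _ _ _ _ 0); apply/andP; split; lra.
have [c1|c1] := lerP (t - a) (2 ^- k / 2).
  by rewrite (@X_mid _ _ _ _ 0); apply/andP; split; lra.
by rewrite (@X_right _ _ _ _ 0); apply/andP; split; lra.
Qed.

(** If [x] and [y] differed, an element trivial near [x] and moving [y] would
    fix the first end of the gap, hence preserve the gap and fix its other
    end, which would then correspond to two points. *)
Lemma corresponds_gap t t' x y : t < t' -> corresponds t x -> corresponds t' y ->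
  (forall s, t < s < t' -> forall z, ~ corresponds s z) -> x - y \is a Num.int.
Proof.
move=> tt' cx cy gap; apply: contrapT => /negP /nonint_gap[r r0 Hr].
have [k' kr'] := exp2V_lt r0; pose k := k'.+1.
have kr : 2 ^- k < r by apply: le_lt_trans kr'; exact: exp2V_le.
have l0 := @exp2V_gt0 R k.
have yk : y - 2 ^- k < y by lra.
have [a da /andP[a1 a2]] := dyad_dense yk.
pose g := tX a k.
have ng : near_trivial g x.
  apply: tX_near_trivial => // n /andP[x1 x2].
  have := Hr n; rewrite leNgt => /negP; apply; apply: le_lt_trans kr.
  by rewrite ler_norml; apply/andP; split; lra.
have [f [lf ft]] := lift_fix (tau_incr tau g) (cx g ng).
have [f' [lf' fK f'K]] := ilift_inv lf.
have c1 := corresponds_equivariant lf (tXE da (isT : (0 < k)%N)) cy.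
have lf'g : ilift f' (tau g^-1%g) by rewrite tau_inv.
have c2 := corresponds_equivariant lf'g (tXVE da (isT : (0 < k)%N)) cy.
have f't : f' t = t by rewrite -{1}ft fK.
have h1 : t' <= f t'.
  rewrite leNgt; apply/negP => lt; apply: (gap (f t')) c1; rewrite lt andbT.
  by rewrite -{1}ft (deg1_lt lf.1).
have h2 : t' <= f' t'.
  rewrite leNgt; apply/negP => lt; apply: (gap (f' t')) c2; rewrite lt andbT.
  by rewrite -{1}f't (deg1_lt lf'.1).
have ft' : f t' = t'.
  by apply/eqP; rewrite eq_le h1 andbT -(f'K t') (deg1_le lf.1) f'K.
rewrite ft' in c1; have /intrP[n hn] := corresponds_inj c1 cy.
have ya : 0 < y - a < 2 ^- k by apply/andP; split; lra.
have /andP[m1 m2] := X_moves (isT : (0 < k)%N) ya.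
by apply: (no_int_inside (n := n)); rewrite -hn; lra.
Qed.

End correspondence.

(** * The semi-conjugacy *)
Section equivariant_map.
Context {R : realType} (tau : UMagmaMorphism.type (thompsonT R) (homeo (circle R))).
Hypothesis tau_nontrivial : exists g : thompsonT R, tau g <> 1%g.
Implicit Types (t x y : R) (g : thompsonT R).

Definition domain : set R := [set t | exists x, corresponds tau t x].

Lemma domain_nonempty : domain !=set0.
Proof. by have [t ct] := corresponds_total tau 0; exists t, 0. Qed.

Lemma domain_periodic : periodic_set domain.
Proof.
have e t x : corresponds tau (t + 1) x <-> corresponds tau t x.
  exact: (corresponds_intl tau t x 1).
by move=> t; split=> -[x cx]; exists x; apply/e.
Qed.

Lemma corresponds_near_all (Q : R -> Prop) t0 : (forall y, Q (y + 1) <-> Q y) ->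
  (forall y, corresponds tau t0 y -> \forall z \near y, Q z) ->
  exists2 d, 0 < d & forall t, `|t - t0| < d -> forall y, corresponds tau t y -> Q y.
Proof.
move=> pQ H; have [d d0 Hd] := corresponds_near H; exists d => // t tt0 y cy.
have pe s : Q (s + 1) = Q s by apply/propext.
rewrite -(periodic_int pe y (- Num.floor y)) rmorphN.
apply: Hd tt0 _ (frac_itv y) _; rewrite -rmorphN.
exact/corresponds_intr.
Qed.

Lemma domain_closed : closed domain.
Proof.
rewrite -openC; apply: openP_near => t0 nt0.
have [//|y cy|d d0 Hd] := @corresponds_near_all (fun _ => False) t0.
  by exfalso; apply: nt0; exists y.
by apply/near_ballP; exists d => // t tt0 [x cx]; exact: Hd tt0 _ cx.
Qed.

Definition over t : R := if pselect (domain t) is left H then projT1 (cid H) else 0.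

Lemma overP t : domain t -> corresponds tau t (over t).
Proof. by move=> dt; rewrite /over; case: pselect => // H; case: cid. Qed.

Lemma over_unique t x : corresponds tau t x -> to_circle (over t) = to_circle x.
Proof.
move=> cx; apply/to_circleP; apply: (corresponds_inj tau_nontrivial _ cx).
by apply: overP; exists x.
Qed.

Definition last_before t : R := sup [set s | domain s /\ s <= t].

Lemma last_beforeP t : [/\ domain (last_before t), last_before t <= t &
  forall s, domain s -> s <= t -> s <= last_before t].
Proof.
pose T := [set s | domain s /\ s <= t].
have T0 : T !=set0.
  have [s ds] := domain_nonempty.
  exists (s + (Num.floor (t - s))%:~R); split; first exact/(periodic_setn _ _ domain_periodic).
  by have /andP[? _] := floor_itv (t - s); lra.
have Tu : has_sup T by split=> //; exists t => s [].
have cT : closed T.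
  rewrite (_ : T = domain `&` [set s | s <= t]); last by apply/seteqP; split.
  by apply: closedI; [exact: domain_closed|exact: closed_le].
have [dT leT] : T (sup T) by apply: cT; apply: closure_sup => //; exact: Tu.2.
by split=> // s ds st; apply: sup_upper_bound.
Qed.

Lemma last_before_unique t u : domain u -> u <= t ->
  (forall s, domain s -> s <= t -> s <= u) -> last_before t = u.
Proof.
move=> du ut max; have [d1 l1 m1] := last_beforeP t.
by apply/eqP; rewrite eq_le max// m1.
Qed.

Lemma last_before_equivariant g f t : ilift f (tau g) -> last_before (f t) = f (last_before t).
Proof.
move=> lf; have [d1 l1 m1] := last_beforeP t.
have [f' [lf' fK f'K]] := ilift_inv lf; rewrite -tau_inv in lf'.
have dom h e s : ilift e (tau h) -> domain s -> domain (e s).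
  move=> le [x cx]; have [b lb] := thompson_lift h.
  by exists (b x); exact: corresponds_equivariant le lb cx.
apply: last_before_unique.
- exact: dom lf d1.
- by rewrite (deg1_le lf.1).
- move=> s ds sf; rewrite -(deg1_le lf'.1) fK; apply: m1; first exact: dom lf' ds.
  by rewrite -(deg1_le lf.1) f'K.
Qed.

(** The correspondence, extended to be constant on the gaps of its domain. *)
Definition over_path t : circle R := to_circle (over (last_before t)).

Lemma over_path_equivariant g f t : ilift f (tau g) -> over_path (f t) = g (over_path t).
Proof.
move=> lf; have [e le] := thompson_lift g; rewrite /over_path (last_before_equivariant _ lf) le.2.
apply: over_unique; apply: corresponds_equivariant lf le _; apply: overP.
by have [] := last_beforeP t.
Qed.

Lemma over_path_periodic t : over_path (t + 1) = over_path t.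
Proof.
have l : ilift (fun s => s + 1%:~R) (tau 1%g).
  by rewrite tau_one; exact: ilift_addint (@ilift1 R).
exact: (over_path_equivariant t l).
Qed.

Lemma over_path_continuous : continuous over_path.
Proof.
move=> /= t0; have [dl l1 m1] := last_beforeP t0.
apply/(continuous_circleP (erefl : to_circle (over (last_before t0)) = over_path t0)) => e e0.
have [dt0|ndt0] := pselect (domain t0); last first.
  have [r r0 Hr] := closed_compl_ball domain_closed ndt0.
  have below t : `|t - t0| < r -> last_before t <= t0 - r.
    move=> tr; have [d2 l2 _] := last_beforeP t; rewrite leNgt; apply/negP => lt.
    move: tr; rewrite ltr_norml => /andP[? ?].
    by apply: (Hr (last_before t)) => //; rewrite ltr_norml; apply/andP; split; lra.
  apply/near_ballP; exists r => // t tr; exists (over (last_before t0)).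
    by rewrite subrr normr0.
  congr (to_circle (over _)); apply/esym; apply: last_before_unique => //.
    have := below t0; rewrite subrr normr0 => /(_ r0).
    by move: tr; rewrite ltr_norml => /andP[? ?]; lra.
  move=> s ds st; apply: m1 => //; have [_ _ m2] := last_beforeP t.
  by have := below t tr; have := m2 s ds st; lra.
have -> : last_before t0 = t0 by exact: last_before_unique.
pose x := over t0; have cx : corresponds tau t0 x by exact: overP.
have [|y cy|d d0 Hd] := @corresponds_near_all (fun y => exists n : int, `|y + n%:~R - x| < e) t0.
- move=> y; split=> -[n yn]; [exists (n + 1)|exists (n - 1)];
    by move: yn; rewrite !intrD ?rmorphN /=; congr (`|_| < _); ring.
- have /intrP[n hn] := corresponds_inj tau_nontrivial cx cy.
  apply/near_ballP; exists e => // z zy; exists n.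
  by rewrite (_ : z + n%:~R - x = z - y)//; lra.
have close u : domain u -> `|u - t0| < d ->
    exists2 y, `|y - x| < e & to_circle y = to_circle (over u).
  move=> /overP cu ud; have [n hn] := Hd _ ud _ cu.
  by exists (over u + n%:~R) => //; exact: to_circleD.
have [[s [ds /andP[s1 s2]]]|none] := pselect (exists s, domain s /\ t0 - d < s < t0).
  have : s < t0 < t0 + d by apply/andP; split; lra.
  move/near_itv; apply: filterS => t /andP[st td].
  have [d2 l2 m2] := last_beforeP t; have := m2 s ds (ltW st).
  by move=> sl; apply: close => //; rewrite ltr_norml; apply/andP; split; lra.
apply/near_ballP; exists d => // t td; have [d2 l2 m2] := last_beforeP t.
move: (td); rewrite ltr_norml => /andP[t1 t2].
have [lt|le] := ltrP (t0 - d) (last_before t).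
  by apply: close => //; rewrite ltr_norml; apply/andP; split; lra.
have tt0 : t < t0 by rewrite ltNge; apply/negP => /(m2 _ dt0); lra.
exists x; first by rewrite subrr normr0.
apply/esym/to_circleP; apply: (corresponds_gap tau_nontrivial _ (overP d2) cx); first lra.
move=> s /andP[s1 s2] z cz; have ds : domain s by exists z.
have [st|ts] := lerP s t; first by have := m2 s ds st; lra.
by apply: none; exists s; split=> //; apply/andP; split; lra.
Qed.

Lemma equivariant_lift : exists (Phi : R -> R) (d : int), [/\ continuous Phi,
  forall t, Phi (t + 1) = Phi t + d%:~R,
  forall t x, corresponds tau t x -> Phi t - x \is a Num.int &
  forall g f e, ilift f (tau g) -> ilift e g ->
    exists n : int, forall t, Phi (f t) = e (Phi t) + n%:~R].
Proof.
have [Phi [d [cP lP pP]]] := circle_lift over_path_continuous over_path_periodic.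
exists Phi, d; split=> //.
- move=> t x cx; apply/to_circleP; rewrite lP -(over_unique cx); congr (to_circle (over _)).
  by apply: last_before_unique => //; exists x.
- move=> g f e lf le; apply: lift_unique.
  + by move=> t; apply: continuous_comp; [exact: cP|case: le => -[ce _ _] _; exact: ce].
  + by move=> t; apply: continuous_comp; [case: lf => -[cf _ _] _; exact: cf|exact: cP].
  + by move=> t /=; rewrite -le.2 !lP (over_path_equivariant _ lf).
Qed.

(** The translation by 1 is a product of lifts of elementary elements having
    fixed points.  A lift of the action of an elementary element that fixes a
    point over one of these fixed points is intertwined with it exactly, so
    the product of these lifts, which is a translation by an integer, is
    intertwined with the translation by 1. *)
Lemma equivariant_degree (Phi : R -> R) (d : int) :
  (forall t, Phi (t + 1) = Phi t + d%:~R) ->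
  (forall t x, corresponds tau t x -> Phi t - x \is a Num.int) ->
  (forall g f e, ilift f (tau g) -> ilift e g ->
    exists n : int, forall t, Phi (f t) = e (Phi t) + n%:~R) ->
  d = 1 \/ d = -1.
Proof.
move=> pP cP eP.
have exact_lift g e : xgen (small 2) g e ->
    exists2 f, ilift f (tau g) & forall t, Phi (f t) = e (Phi t).
  have inv h f b : ilift f (tau h) -> ilift b h -> (forall t, Phi (f t) = b (Phi t)) ->
      forall b', cancel b b' -> exists2 f', ilift f' (tau h^-1%g) & forall t, Phi (f' t) = b' (Phi t).
    move=> lf lb H b' bK; have [f' [lf' fK f'K]] := ilift_inv lf.
    by exists f' => [|t]; [rewrite tau_inv|rewrite -[in RHS](f'K t) H bK].
  have gen a k : dyad a -> (0 < k)%N -> small 2 a k ->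
      exists2 f, ilift f (tau (tX a k)) & forall t, Phi (f t) = X a k (Phi t).
    move=> da k0 k2; have l4 := @exp2V_le R 2 k k2; rewrite expr2 in l4.
    have l0 := @exp2V_gt0 R k.
    pose x0 := a + 2 ^- k + 1 / 8; have [t0 ct0] := corresponds_total tau x0.
    have nt : near_trivial (tX a k) x0.
      apply: tX_near_trivial => // n; rewrite /x0 => /andP[h1 h2].
      by apply: (no_int_inside (n := n)); lra.
    have [f [lf ft]] := lift_fix (tau_incr tau _) (ct0 _ nt).
    exists f => //; have [n hn] := eP _ _ _ lf (tXE da k0).
    suff n0 : n%:~R = 0 :> R by move=> t; rewrite hn n0 addr0.
    have /intrP[m hm] := cP _ _ ct0.
    have := hn t0; rewrite ft (_ : Phi t0 = x0 + m%:~R); last by rewrite -hm; ring.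
    rewrite (deg1_int _ _ (X_deg1 a k0)) (@X_out _ a k x0 1); first by lra.
    by rewrite /x0; apply/andP; split; lra.
  elim=> [|a k da k0 k2|a k da k0 k2|g1 g2 f1 f2 x1 [h1 l1 H1] x2 [h2 l2 H2]].
  - by exists id => //; rewrite tau_one; exact: ilift1.
  - exact: gen.
  - have [f lf H] := gen a k da k0 k2.
    exact: inv lf (tXE da k0) H _ (@XK _ a k).
  - exists (h1 \o h2); first by rewrite tau_mul; exact: ilift_comp.
    by move=> t /=; rewrite H1 H2.
have x1 : xgen (small 2) 1%g (fun t : R => t + 1%:~R).
  by apply: xgen_all => //; exact: ilift_addint (@ilift1 R).
have [f lf H] := exact_lift _ _ x1; rewrite tau_one in lf.
have [m hm] := ilift_unique (@ilift1 R) lf.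
have pn t (n : int) : Phi (t + n%:~R) = Phi t + d%:~R * n%:~R.
  have pp s : Phi (s + 1) - d%:~R * (s + 1) = Phi s - d%:~R * s by rewrite pP; ring.
  by have := periodic_int pp t n; lra.
have dm : d * m = 1.
  have : (d * m)%:~R = 1%:~R :> R by have := H 0; rewrite hm pn intrM; lra.
  by move=> /eqP; rewrite eqr_int => /eqP.
move: (congr1 absz dm); rewrite abszM => /eqP; rewrite muln_eq1 => /andP[/eqP].
by lia.
Qed.

End equivariant_map.

Section running_sup.
Context {R : realType}.
Variable Phi : R -> R.
Hypothesis Phi_cont : continuous Phi.
Hypothesis Phi1 : forall t, Phi (t + 1) = Phi t + 1.
Implicit Types s t : R.

(** Increasing lifts commute with this supremum, so it makes an equivariant map
    monotone without losing equivariance. *)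
Definition running_sup t : R := sup [set Phi s | s in [set s | s <= t]].

Let bounded : exists B, forall t, Phi t <= t + B.
Proof.
have cD : {within `[0, 1], continuous (fun t => Phi t - t)}.
  by apply: continuous_subspaceT => t; apply: cvgB; [exact: Phi_cont|exact: cvg_id].
have [c _ Hc] := @EVT_max R _ 0 1 ler01 cD; exists (Phi c - c) => t.
have := Hc (t - (Num.floor t)%:~R); rewrite in_itv /= frac_itv => /(_ isT).
have pp s : Phi (s + 1) - (s + 1) = Phi s - s by rewrite Phi1; ring.
by rewrite -rmorphN (periodic_int pp); lra.
Qed.

Let has_sup_Phi t : has_sup [set Phi s | s in [set s | s <= t]].
Proof.
have [B HB] := bounded; split; first by exists (Phi t), t => /=.
by exists (t + B) => _ [s /= st <-]; apply: le_trans (HB s) _; rewrite lerD2r.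
Qed.

Lemma running_sup_ge s t : s <= t -> Phi s <= running_sup t.
Proof. by move=> st; apply: sup_upper_bound; [exact: has_sup_Phi|exists s]. Qed.

Lemma running_sup_le t u : (forall s, s <= t -> Phi s <= u) -> running_sup t <= u.
Proof.
move=> H; apply: ge_sup; first by have [] := has_sup_Phi t.
by move=> _ [s /= st <-]; exact: H.
Qed.

Lemma running_sup_mono : {homo running_sup : s t / s <= t}.
Proof.
move=> s t st; apply: running_sup_le => r rs; apply: running_sup_ge.
exact: le_trans rs st.
Qed.

Lemma running_sup_continuous : continuous running_sup.
Proof.
move=> /= t0; apply/cvgrPdist_lt => e e0; have e3 : 0 < e / 3 by rewrite divr_gt0.
have /cvgrPdist_lt/(_ _ e3)/near_ballP[d d0 Hd] := @Phi_cont t0.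
apply/near_ballP; exists d => // t td; have g0 := running_sup_ge (lexx t0).
have gt := running_sup_ge (lexx t).
have near s : `|s - t0| < d -> Phi t0 - e / 3 < Phi s < Phi t0 + e / 3.
  by move=> /Hd; rewrite ltr_norml => /andP[? ?]; apply/andP; split; lra.
have [tt0|tt0] := lerP t0 t.
  have m := running_sup_mono tt0.
  have : running_sup t <= running_sup t0 + e / 3.
    apply: running_sup_le => s st; have [st0|st0] := lerP s t0.
      by have := running_sup_ge st0; lra.
    have /near/andP[? ?] : `|s - t0| < d; last lra.
    by move: td; rewrite !ltr_norml => /andP[? ?]; apply/andP; split; lra.
  by move=> ?; rewrite ltr_norml; apply/andP; split; lra.
have m := running_sup_mono (ltW tt0); have /andP[n1 n2] := near t td.
have : running_sup t0 <= running_sup t + 2 * (e / 3).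
  apply: running_sup_le => s st; have [st0|st0] := lerP s t.
    by have := running_sup_ge st0; lra.
  have /near/andP[? ?] : `|s - t0| < d; last lra.
  by move: td; rewrite !ltr_norml => /andP[? ?]; apply/andP; split; lra.
by move=> ?; rewrite ltr_norml; apply/andP; split; lra.
Qed.

Lemma running_sup_equivariant f f' e e' : deg1 f -> cancel f' f ->
  deg1 e -> deg1 e' -> cancel e e' -> cancel e' e ->
  (forall t, Phi (f t) = e (Phi t)) -> forall t, running_sup (f t) = e (running_sup t).
Proof.
move=> df f'K de de' eK e'K H t; apply/eqP; rewrite eq_le; apply/andP; split.
  apply: running_sup_le => s; rewrite -(f'K s) (deg1_le df) H (deg1_le de).
  exact: running_sup_ge.
rewrite -(deg1_le de') eK; apply: running_sup_le => s st.
by rewrite -(eK (Phi s)) -H (deg1_le de'); apply: running_sup_ge; rewrite (deg1_le df).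
Qed.

Lemma running_sup1 t : running_sup (t + 1) = running_sup t + 1.
Proof.
apply: (@running_sup_equivariant (fun t => t + 1) (fun t => t - 1)
  (fun t => t + 1) (fun t => t - 1)) => //; try exact: deg1_trans.
- exact: subrK.
- exact: addrK.
- exact: subrK.
Qed.

End running_sup.

Section semi_conjugacy.
Context {R : realType} (tau : thompsonT R -> homeo (circle R)).

Definition intertwines (Psi : R -> R) : Prop := forall g : thompsonT R,
  exists f e, [/\ ilift f (tau g), ilift e g & forall t, Psi (f t) = e (Psi t)].

Lemma semi_conjugate_of_lift (Psi : R -> R) (d : int) : continuous Psi -> intertwines Psi ->
  (forall t, Psi (t + 1) = Psi t + d%:~R) ->
  d = 1 /\ {homo Psi : s t / s <= t} \/ d = - 1 /\ {homo Psi : s t / s <= t >-> t <= s} ->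
  semi_conjugate tau (@standard_action R).
Proof.
move=> cP iP pP dP; pose phi (p : circle R) := to_circle (Psi (circle_repr p)).
have pn t (n : int) : Psi (t + n%:~R) = Psi t + d%:~R * n%:~R.
  have pp s : Psi (s + 1) - d%:~R * (s + 1) = Psi s - d%:~R * s by rewrite pP; ring.
  by have := periodic_int pp t n; lra.
have phiE t : phi (to_circle t) = to_circle (Psi t).
  rewrite /phi; have /to_circle_eq[n ->] := circle_reprK (to_circle t).
  by rewrite pn -intrM to_circleD.
exists phi; split.
- apply/quotient_continuous => t; rewrite (_ : _ \o _ = @to_circle R \o Psi).
    by apply: continuous_comp; [exact: cP|exact: to_circle_continuous].
  by apply/funext => s; exact: phiE.
- move=> b; have [y <-] := to_circle_surj b.
  have [u [v [uv Hu]]] : exists u v : R, u <= v /\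
      exists2 y', to_circle y' = to_circle y &
      Num.min (Psi u) (Psi v) <= y' <= Num.max (Psi u) (Psi v).
    exists 0, (0 + 1); split; first by rewrite add0r.
    pose n := Num.floor (y - Num.min (Psi 0) (Psi (0 + 1))).
    exists (y + (- n)%:~R); first exact: to_circleD.
    have := floor_itv (y - Num.min (Psi 0) (Psi (0 + 1))); rewrite -/n rmorphN intrD /=.
    rewrite pP; move: dP => [[-> _]|[-> _]]; rewrite ?rmorphN /=.
      rewrite min_l ?lerDl// max_r ?lerDl// => /andP[? ?].
      by apply/andP; split; lra.
    rewrite min_r ?gerBl// max_l ?gerBl// => /andP[? ?].
    by apply/andP; split; lra.
  have [y' <- Hy] := Hu.
  have [|c _ <-] := IVT uv _ Hy; first exact: continuous_subspaceT.
  by exists (to_circle c); exact: phiE.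
- move=> g a; have [t <-] := to_circle_surj a.
  have [f [e [lf le H]]] := iP g.
  by rewrite lf.2 !phiE H /standard_action le.2.
- case: dP => -[dE mP]; [left|right] => _ _ _ [x [y [z [<- <- <- [xy yz zx]]]]]; rewrite !phiE.
    exists (Psi x), (Psi y), (Psi z); split=> //; split; [exact: mP|exact: mP|].
    by have := mP _ _ zx; rewrite pP dE.
  exists (Psi z), (Psi y), (Psi x); split=> //; split; [exact: mP|exact: mP|].
  by have := mP _ _ zx; rewrite pP dE rmorphN /= => ?; lra.
- by case: dP => -[dE _]; [left|right]; exists Psi; split=> // t; rewrite pP dE.
Qed.

End semi_conjugacy.

Theorem corollary1p9 (R : realType)
    (tau : UMagmaMorphism.type (thompsonT R) (homeo (circle R))) :
  (exists g : thompsonT R, tau g <> 1%g) ->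
  semi_conjugate tau (@standard_action R).
Proof.
move=> nt; have [Phi [d [cP pP iP eP]]] := equivariant_lift nt.
have exact_lift g : exists f e, [/\ ilift f (tau g), ilift e g & forall t, Phi (f t) = e (Phi t)].
  have [f lf] := tau_lift tau g; have [e le] := thompson_lift g.
  have [n hn] := eP _ _ _ lf le.
  by exists f, (fun t => e t + n%:~R); split=> //; exact: ilift_addint.
have [d1|d1] := equivariant_degree pP iP eP.
- have p1 t : Phi (t + 1) = Phi t + 1 by rewrite pP d1.
  apply: (@semi_conjugate_of_lift _ _ (running_sup Phi) 1).
  + exact: running_sup_continuous.
  + move=> g; have [f [e [lf le H]]] := exact_lift g.
    have [f' [_ _ f'K]] := ilift_inv lf; have [e' [le' eK e'K]] := ilift_inv le.
    exists f, e; split=> //.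
    exact: (running_sup_equivariant cP p1 lf.1 f'K le.1 le'.1 eK e'K H).
  + exact: running_sup1.
  + by left; split=> //; exact: running_sup_mono.
- pose Phi' t := Phi (- t).
  have cP' : continuous Phi'.
    by move=> t; apply: continuous_comp; [exact: opp_continuous|exact: cP].
  have p1 t : Phi' (t + 1) = Phi' t + 1.
    have := pP (- t - 1); rewrite subrK d1 rmorphN /= /Phi' opprD => ->; ring.
  apply: (@semi_conjugate_of_lift _ _ (fun t => running_sup Phi' (- t)) (- 1)).
  + move=> t; apply: (@continuous_comp _ _ _ (fun t => - t) (running_sup Phi')).
      exact: opp_continuous.
    exact: running_sup_continuous.
  + move=> g; have [f [e [lf le H]]] := exact_lift g.
    have [f' [lf' _ f'K]] := ilift_inv lf; have [e' [le' eK e'K]] := ilift_inv le.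
    have df : deg1 (fun t => - f (- t)).
      have [cf mf pf] := lf.1; split.
      - move=> t; apply: (@continuous_comp _ _ _ (fun t => f (- t)) (fun t => - t)).
          by apply: continuous_comp; [exact: opp_continuous|exact: cf].
        exact: opp_continuous.
      - by move=> s t st; rewrite ltrN2; apply: mf; rewrite ltrN2.
      - move=> t; have := pf (- t - 1); rewrite subrK opprD => ->; ring.
    have f'K' : cancel (fun t => - f' (- t)) (fun t => - f (- t)).
      by move=> t; rewrite opprK f'K opprK.
    have H' t : Phi' (- f (- t)) = e (Phi' t) by rewrite /Phi' opprK H.
    exists f, e; split=> // t; rewrite -{1}(opprK t).
    exact: (running_sup_equivariant cP' p1 df f'K' le.1 le'.1 eK e'K H').
  + move=> t; rewrite rmorphN /=.
    have := running_sup1 cP' p1 (- t - 1); rewrite subrK opprD => ->; ring.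
  + right; split=> // s t st; apply: running_sup_mono => //; by rewrite lerN2.
Qed.
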